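(* Let $U,V,W\subset\mathbb{C}$ be nonempty compact sets. Then $$\Sigma_+\ =\ \Sigma\cup\Sigma_{\pm1}\ =\ \Sigma\cup E_{\pm 1}\ =\ \Sigma\cup E_\cap\ =\ \Sigma\cup E_\cup .$$ Moreover, exactly one of the following cases applies: (i) $w_*\le u^*$ and $u_*\le w^*$, in which case $\Sigma_{\pm1}=E_{\pm1}=\varnothing$ and $E_\cup\subset\Sigma_+=\Sigma$; (ii) $w_*>u^*$, in which case $\Sigma_{-1}=E_{-1}=\varnothing$ and $\Sigma_1\subset E_1=E_\cap$; (iii) $u_*>w^*$, in which case $\Sigma_1=E_1=\varnothing$ and $\Sigma_{-1}\subset E_{-1}=E_\cap$.
   Context: $\mathbb{N}=\{1,2,\dots\}$, $\mathbb{T}$ is the unit circle. $M(U,V,W)$ is the set of bi-infinite tridiagonal matrices $A=(a_{ij})_{i,j\in\mathbb{Z}}$ with $a_{i,i-1}\in U$, $a_{i,i}\in V$, $a_{i,i+1}\in W$ for all $i$, all other entries zero. $M_+(U,V,W)$ is the set of semi-infinite tridiagonal matrices $(a_{ij})_{i,j\in\mathbb{N}}$ with subdiagonal entries in $U$, diagonal entries in $V$, superdiagonal entries in $W$, all other entries zero. $M_n(U,V,W)$ is the set of $n\times n$ matrices of the same kind. These act as bounded operators on $\ell^p(\mathbb{Z})$, $\ell^p(\mathbb{N})$, $p\in[1,\infty]$; spectra, essential spectra ($\operatorname{spec}_{\rm ess}B=\{\lambda: B-\lambda I \text{ not Fredholm}\}$) and Fredholm indices do not depend on $p$. The index of a Fredholm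 operator is the dimension of its null space minus the codimension of its image. $A\in M(U,V,W)$ is pseudoergodic, $A\in \Psi E(U,V,W)$, if for every $n\in\mathbb N$, every $B\in M_n(U,V,W)$ and every $\varepsilon>0$ there is a submatrix $C$ of $A$ composed of rows and columns $k+1,\dots,k+n$ of $A$, for some integer $k$, with $\|B-C\|<\varepsilon$; $\Psi E_+(U,V,W)\subset M_+(U,V,W)$ is defined in the same way. $\Sigma:=\bigcup_{C\in M(U,V,W)}\operatorname{spec}C$, which equals $\operatorname{spec}A=\operatorname{spec}_{\rm ess}A=\operatorname{spec}_{\rm ess}B_+$ for every $A\in\Psi E(U,V,W)$ and $B_+\in\Psi E_+(U,V,W)$. $\Sigma_+:=\bigcup_{C_+\in M_+(U,V,W)}\operatorname{spec}C_+$, which equals $\operatorname{spec}B_+$ for every $B_+\in\Psi E_+(U,V,W)$. For $k\in\{-1,1\}$, $\Sigma_k:=\{\lambda\in\mathbb{C}: B_+-\lambda I_+\text{ is Fredholm with index }k\}$, where $B_+\in\Psi E_+(U,V,W)$ is arbitrary (the set does not depend on the choice of $B_+$). $\Sigma_{\pm1}:=\Sigma_{-1}\cup\Sigma_1$. $u_*=\min_{u\in U}|u|$, $u^*=\max_{u\in U}|u|$, $w_*=\min_{w\in W}|w|$, $w^*=\max_{w\in W}|w|$. For $u\in U,v\in V,w\in W$, $E(u,v,w)=\{ut+v+wt^{-1}:t\in\mathbb{T}\}$ is an ellipse, with the orientation inherited from the counter-clockwise orientation of $\mathbb{T}$: counter-clockwise if $|u|>|w|$, clockwise if $|u|<|w|$;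 it degenerates to a line segment if $|u|=|w|$, in which case its interior is taken to be empty and its exterior to be $\mathbb{C}\setminus E(u,v,w)$. Let $\mathcal{E}$ be the set of all these ellipses, and - $E_0$: the set of $\lambda\in\mathbb{C}$ in the exterior of every ellipse in $\mathcal E$; - $E_\cap$: the set of $\lambda\in\mathbb{C}$ in the interior of every ellipse in $\mathcal E$; - $E_1$ (resp. $E_{-1}$): the set of $\lambda\in E_\cap$ circumnavigated clockwise (resp. counter-clockwise) by all ellipses in $\mathcal{E}$; - $E_{\pm1}:=E_{-1}\cup E_1$; - $E_\cup:=\mathbb{C}\setminus E_0=\bigcup_{u\in U,v\in V,w\in W}\operatorname{conv}E(u,v,w)$, with $\operatorname{conv}$ denoting convex hull. *)

(* Defs.v *)
From HB Require Import structures.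
From mathcomp Require Import all_boot all_order all_algebra.
From mathcomp Require Import complex.
From mathcomp Require Import all_classical all_reals all_analysis.

Set Implicit Arguments.
Unset Strict Implicit.
Unset Printing Implicit Defensive.

Import Order.TTheory GRing.Theory Num.Theory.
Import numFieldNormedType.Exports.

Local Open Scope classical_set_scope.
Local Open Scope complex_scope.
Local Open Scope ring_scope.

(* Complex numbers are R[i]; their topology lives on the alias R[i]^o. The
   modulus is Normc.normc, with values in R. *)

(* The l^p norm over an index set I (int or nat below), for p in [1, +oo]; the
   value at -oo is irrelevant. *)
Definition lpnorm (R : realType) (I : choiceType) (p : \bar R)
    (x : I -> R[i]) : \bar R :=
  match p with
  | r%:E => ((\esum_(i in [set: I]) ((Normc.normc (x i)) `^ r)%:E) `^ r^-1)%E
  | +oo%E => ereal_sup [set (Normc.normc (x i))%:E | i in [set: I]]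
  | -oo%E => 0%E
  end.

Definition lp (R : realType) (I : choiceType) (p : \bar R) : set (I -> R[i]) :=
  [set x | (lpnorm p x < +oo)%E].

(* Only the restriction of S to l^p matters. *)
Definition bounded_operator (R : realType) (I : choiceType) (p : \bar R)
    (S : (I -> R[i]) -> I -> R[i]) : Prop :=
  [/\ forall x, lp p x -> lp p (S x),
      forall (a : R[i]) x y, lp p x -> lp p y ->
        S (fun i => a * x i + y i) = (fun i => a * S x i + S y i)
    & exists M : R, forall x, lp p x ->
        (lpnorm p (S x) <= M%:E * lpnorm p x)%E].

Definition invertible_operator (R : realType) (I : choiceType) (p : \bar R)
    (T : (I -> R[i]) -> I -> R[i]) : Prop :=
  exists S : (I -> R[i]) -> I -> R[i],
    bounded_operator p S /\
    forall x, lp p x -> S (T x) = x /\ T (S x) = x.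

(* The action of the infinite matrix A. The sum over j is the finitely
   supported sum of fsbigop, so this is meaningful when each row of A has
   finitely many nonzero entries, as is the case for tridiagonal A. *)
Definition mxop (R : realType) (I : choiceType) (A : I -> I -> R[i])
    (x : I -> R[i]) : I -> R[i] :=
  fun i => \sum_(j \in [set: I]) A i j * x j.

Definition mxop_sub (R : realType) (I : choiceType) (A : I -> I -> R[i])
    (l : R[i]) (x : I -> R[i]) : I -> R[i] :=
  fun i => mxop A x i - l * x i.

Definition spec (R : realType) (I : choiceType) (p : \bar R)
    (A : I -> I -> R[i]) : set R[i] :=
  [set l | ~ invertible_operator p (mxop_sub A l)].

(* dim (X / Y) = n for linear spaces Y `<=` X of sequences: the classes of
   b_0, ..., b_(n-1) form a basis of X / Y. *)
Definition quotient_dim (R : realType) (I : choiceType)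
    (X Y : set (I -> R[i])) (n : nat) : Prop :=
  exists b : 'I_n -> I -> R[i],
    (forall k, X (b k)) /\
    forall x, X x -> exists! c : 'rV[R[i]]_n,
      Y (fun i => x i - \sum_(k < n) c ord0 k * b k i).

Definition lp_kernel (R : realType) (I : choiceType) (p : \bar R)
    (T : (I -> R[i]) -> I -> R[i]) : set (I -> R[i]) :=
  [set x | lp p x /\ T x = (fun=> 0)].

Definition lp_image (R : realType) (I : choiceType) (p : \bar R)
    (T : (I -> R[i]) -> I -> R[i]) : set (I -> R[i]) :=
  [set T x | x in lp p].

Definition fredholm_index (R : realType) (I : choiceType) (p : \bar R)
    (T : (I -> R[i]) -> I -> R[i]) (k : int) : Prop :=
  exists m n : nat,
    [/\ quotient_dim (lp_kernel p T) [set (fun=> 0)] m,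
        quotient_dim (lp p) (lp_image p T) n
      & k = m%:Z - n%:Z].

(* next i j means that j is the successor of i in the index set. *)
Definition tridiagonal (R : realType) (I : eqType) (next : I -> I -> bool)
    (U V W : set R[i]) (A : I -> I -> R[i]) : Prop :=
  forall i j,
    if i == j then V (A i j)
    else if next i j then W (A i j)
    else if next j i then U (A i j)
    else A i j = 0.

Definition M_bi (R : realType) (U V W : set R[i]) : set (int -> int -> R[i]) :=
  [set A | tridiagonal (fun i j : int => j == i + 1) U V W A].

(* Semi-infinite matrices are indexed from 0 instead of 1. *)
Definition M_semi (R : realType) (U V W : set R[i]) :
    set (nat -> nat -> R[i]) :=
  [set A | tridiagonal (fun i j : nat => j == i.+1) U V W A].

Definition M_fin (R : realType) (n : nat) (U V W : set R[i]) :
    set 'M[R[i]]_n :=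
  [set A | tridiagonal (fun i j : 'I_n => j == i.+1 :> nat) U V W A].

(* The matrix norm is the entrywise maximum; all norms on 'M_n are equivalent,
   so the notion does not depend on this choice. *)
Definition PE_semi (R : realType) (U V W : set R[i]) :
    set (nat -> nat -> R[i]) :=
  [set A | M_semi U V W A /\
    forall n, (0 < n)%N -> forall B : 'M[R[i]]_n, M_fin U V W B ->
    forall e : R, 0 < e -> exists k : nat,
      `|B - \matrix_(i < n, j < n) A (k + i)%N (k + j)%N| < e%:C].

Definition Sigma (R : realType) (p : \bar R) (U V W : set R[i]) : set R[i] :=
  \bigcup_(C in M_bi U V W) spec p C.

Definition Sigma_plus (R : realType) (p : \bar R) (U V W : set R[i]) :
    set R[i] :=
  \bigcup_(C in M_semi U V W) spec p C.

(* To be used with B in PE_semi U V W. *)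
Definition Sigma_idx (R : realType) (p : \bar R) (B : nat -> nat -> R[i])
    (k : int) : set R[i] :=
  [set l | fredholm_index p (mxop_sub B l) k].

Definition Sigma_pm1 (R : realType) (p : \bar R) (B : nat -> nat -> R[i]) :
    set R[i] :=
  Sigma_idx p B (-1) `|` Sigma_idx p B 1.

(* For nonempty compact U these are a minimum and a maximum. *)
Definition abs_min (R : realType) (U : set R[i]) : R :=
  inf [set Normc.normc u | u in U].

Definition abs_max (R : realType) (U : set R[i]) : R :=
  sup [set Normc.normc u | u in U].

Definition ellipse (R : realType) (u v w : R[i]) : set R[i]^o :=
  [set u * t + v + w * t^-1 | t in [set t : R[i] | Normc.normc t = 1]].

(* The interior (exterior) of the curve is the union of the bounded (unbounded)
   components of its complement, except that it is fixed by convention when the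
   ellipse degenerates, i.e. when |u| = |w|. *)
Definition ellipse_interior (R : realType) (u v w : R[i]) : set R[i]^o :=
  if Normc.normc u == Normc.normc w then set0
  else [set l | (~` ellipse u v w) l /\
                bounded_set (connected_component (~` ellipse u v w) l)].

Definition ellipse_exterior (R : realType) (u v w : R[i]) : set R[i]^o :=
  if Normc.normc u == Normc.normc w then ~` ellipse u v w
  else [set l | (~` ellipse u v w) l /\
                ~ bounded_set (connected_component (~` ellipse u v w) l)].

(* Orientation of t |-> u * t + v + w * t^-1 as t runs counter-clockwise
   through the unit circle. *)
Definition ellipse_ccw (R : realType) (u w : R[i]) : Prop :=
  Normc.normc w < Normc.normc u.

Definition ellipse_cw (R : realType) (u w : R[i]) : Prop :=
  Normc.normc u < Normc.normc w.

Definition E_zero (R : realType) (U V W : set R[i]) : set R[i] :=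
  [set l | forall u v w, U u -> V v -> W w -> ellipse_exterior u v w l].

Definition E_cap (R : realType) (U V W : set R[i]) : set R[i] :=
  [set l | forall u v w, U u -> V v -> W w -> ellipse_interior u v w l].

Definition E_one (R : realType) (U V W : set R[i]) : set R[i] :=
  [set l | E_cap U V W l /\ forall u w, U u -> W w -> ellipse_cw u w].

Definition E_mone (R : realType) (U V W : set R[i]) : set R[i] :=
  [set l | E_cap U V W l /\ forall u w, U u -> W w -> ellipse_ccw u w].

Definition E_pm1 (R : realType) (U V W : set R[i]) : set R[i] :=
  E_mone U V W `|` E_one U V W.

Definition E_cup (R : realType) (U V W : set R[i]) : set R[i] :=
  ~` E_zero U V W.

Definition exactly_one (P Q S : Prop) : Prop :=
  [/\ P \/ Q \/ S, ~ (P /\ Q), ~ (P /\ S) & ~ (Q /\ S)].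

(* Main.v *)
Require Import Defs.
From HB Require Import structures.
From mathcomp Require Import all_boot all_order all_algebra.
From mathcomp Require Import complex.
From mathcomp Require Import all_classical all_reals all_analysis.
From mathcomp Require Import zify ring lra.

(* Absorb [l] into the diagonal and write [J x i = u i x(i-1) + v i x i + w i x(i+1)]
   for the operators with coefficients in the given sets. Call [l] regular if all
   these operators on the line are injective on bounded sequences. By compactness
   they are then uniformly bounded below, and since an injective periodic operator
   is bijective on periodic sequences, periodic approximation makes them onto;
   exponential weights turn the lower bound into a local estimate, which bounds the
   inverse in every l^p. Conversely a bounded null sequence, cut off by exponential
   weights, is an approximate null vector in every l^p, and infinitely many disjoint
   copies of such vectors are incompatible with finite kernel and cokernel
   dimensions. So [Sigma] is the set of non-regular [l] and Fredholm pseudoergodic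
   half-line operators only occur at regular [l].

   For regular [l], a bounded null vector of some right half-line operator and one
   of some left half-line operator could be glued at a common zero site to a null
   vector on the line; the same holds after transposition. Hence either all half-line
   operators are invertible, or all right ones are onto with one-dimensional kernel,
   or all right ones are injective with codimension one. Toeplitz operators, whose
   kernels are read off from the roots of a quadratic, tell which case holds: the
   second iff [l] lies inside all ellipses and these are clockwise, the third iff it
   lies inside all of them and they are counter-clockwise. *)

Set Implicit Arguments.
Unset Strict Implicit.
Unset Printing Implicit Defensive.

Import Order.TTheory GRing.Theory Num.Theory.
Import numFieldNormedType.Exports.

Local Open Scope classical_set_scope.
Local Open Scope complex_scope.
Local Open Scope ring_scope.

(** Bounded sequences are the common ground for all [p] in [1, +oo]. At p = +oo the dual is not a
    sequence space, so transposition enters only through Green functions: for regular l, the bounded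
    solution of J e = delta_0 and its counterpart for the transpose agree at site 0. This one number
    is the pivot of the trichotomy. It vanishes exactly when the operator has a null vector on one
    of its two half lines; when it is nonzero, subtracting a multiple of e decouples the half lines.
    A free ultrafilter is fixed once, so that limits of countably many coordinates exist together
    and no diagonal subsequence has to be extracted. Fredholmness is given by dimensions alone, so
    closed range and perturbation arguments are replaced by counting: disjoint approximate null
    vectors with errors 4^-k are superposed with amplitudes 2^k, and more such superpositions are
    formed than kernel and cokernel can absorb. *)

Local Notation nc := Normc.normc.

(** * Moduli and limits along an ultrafilter *)

Section Modulus.
Variable R : realType.
Implicit Types x y z : R[i].

Lemma nc_ge0 x : 0 <= nc x. Proof. by case: x => a b; exact: sqrtr_ge0. Qed.
Lemma nc0 : nc (0 : R[i]) = 0. Proof. exact: Normc.normc0. Qed.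
Lemma nc1 : nc (1 : R[i]) = 1. Proof. exact: Normc.normc1. Qed.
Lemma ncM x y : nc (x * y) = nc x * nc y. Proof. exact: Normc.normcM. Qed.
Lemma ncV x : nc x^-1 = (nc x)^-1. Proof. exact: Normc.normcV. Qed.
Lemma ncN x : nc (- x) = nc x. Proof. exact: normcN. Qed.
Lemma ncD x y : nc (x + y) <= nc x + nc y. Proof. exact: le_normcD. Qed.
Lemma ncB x y : nc (x - y) <= nc x + nc y. Proof. by rewrite -(ncN y) ncD. Qed.
Lemma nc_dist x y : nc (x - y) = nc (y - x). Proof. by rewrite -ncN opprB. Qed.
Lemma nc_eq0 x : (nc x == 0) = (x == 0).
Proof. by apply/eqP/eqP => [/Normc.eq0_normc //|->]; exact: nc0. Qed.
Lemma nc_gt0 x : (0 < nc x) = (x != 0).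
Proof. by rewrite lt0r nc_eq0 nc_ge0 andbT. Qed.
Lemma ncX x n : nc (x ^+ n) = nc x ^+ n.
Proof. by elim: n => [|n IH]; rewrite ?expr0 ?nc1 // !exprS ncM IH. Qed.
Lemma nc_real (a : R) : nc a%:C = `|a|.
Proof. by rewrite /Normc.normc /= expr0n /= addr0 sqrtr_sqr. Qed.
Lemma nc_le_ReIm (a b : R) : nc (a +i* b) <= `|a| + `|b|.
Proof.
have -> : a +i* b = a%:C + 'i * b%:C by apply/eqP; rewrite eq_complex /=; apply/andP; split; apply/eqP; ring.
apply: (le_trans (ncD _ _)); rewrite ncM !nc_real /Normc.normc /= expr0n /= add0r.
by rewrite expr1n sqrtr1 mul1r.
Qed.
Lemma nc_Re x : `|complex.Re x| <= nc x.
Proof.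
case: x => a b /=; rewrite -sqrtr_sqr ler_sqrt ?addr_ge0 ?sqr_ge0 //.
by rewrite lerDl sqr_ge0.
Qed.
Lemma nc_Im x : `|complex.Im x| <= nc x.
Proof.
case: x => a b /=; rewrite -sqrtr_sqr ler_sqrt ?addr_ge0 ?sqr_ge0 //.
by rewrite lerDr sqr_ge0.
Qed.
Lemma normr_nc x : `|x| = (nc x)%:C. Proof. by []. Qed.
Lemma nc_conj x : nc (x^*)%C = nc x.
Proof. by case: x => a b; rewrite /Normc.normc /= sqrrN. Qed.
End Modulus.

Lemma ultra_fmap (T U : Type) (f : T -> U) (F : set_system T) :
  UltraFilter F -> UltraFilter (fmap f F).
Proof.
move=> FU; have FP : ProperFilter F by exact: ultra_proper.
split=> [|G GP sub]; first exact: fmap_proper_filter.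
apply/seteqP; split=> [A GA|A FA]; last exact: sub.
have [//|FA] := in_ultra_setVsetC (f @^-1` A) FU.
have GA' : G (~` A) by apply: sub; rewrite /fmap /= preimage_setC.
by have [a [h1 h2]] := filter_ex (filterI GA GA').
Qed.

Section UltraLimit.
Variable R : realType.
Variable F : set_system nat.
Hypothesis FU : UltraFilter F.
Hypothesis Foo : \oo `<=` F.

#[local] Instance FU_proper : ProperFilter F.
Proof. exact: ultra_proper. Qed.

Definition ulim (s : nat -> R[i]) (l : R[i]) :=
  forall e : R, 0 < e -> F [set n | nc (s n - l) < e].

(** Sequential compactness along the fixed [F]. Coordinates of a sequence of sequences can be
    treated one at a time, and all their limits refer to the same [F]. *)
Definition ultra_closed (K : set R[i]) :=
  forall s : nat -> R[i], (forall n, K (s n)) -> exists2 l, K l & ulim s l.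

Lemma ultra_meet (P Q : set nat) : F P -> F Q -> exists n, P n /\ Q n.
Proof. by move=> FP FQ; have [n hn] := filter_ex (filterI FP FQ); exists n. Qed.

Lemma ulim_ex s l e : ulim s l -> 0 < e -> exists n, nc (s n - l) < e.
Proof. by move=> sl e0; have [n hn] := filter_ex (sl _ e0); exists n. Qed.

Lemma ulim_cst l : ulim (fun=> l) l.
Proof. by move=> e e0; apply: filterE => n; rewrite /= subrr nc0. Qed.

Lemma ulimD s t a b : ulim s a -> ulim t b -> ulim (fun n => s n + t n) (a + b).
Proof.
move=> sa tb e e0; have e2 : 0 < e / 2 by lra.
apply: filterS (filterI (sa _ e2) (tb _ e2)) => n [/= h1 h2].
rewrite opprD addrACA; apply: (le_lt_trans (ncD _ _)); lra.
Qed.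

Lemma ulimM s t a b : ulim s a -> ulim t b -> ulim (fun n => s n * t n) (a * b).
Proof.
move=> sa tb e e0.
have B0 := nc_ge0 b; have A0 := nc_ge0 a.
set M := nc a + nc b + 1.
have M0 : 0 < M by rewrite /M; lra.
have e1 : 0 < Num.min 1 (e / (2 * M)) by rewrite lt_min ltr01 divr_gt0 // mulr_gt0.
apply: filterS (filterI (sa _ e1) (tb _ e1)) => n [/=].
rewrite !lt_min => /andP[_ h1] /andP[h2 h3].
have -> : s n * t n - a * b = (s n - a) * t n + a * (t n - b) by ring.
apply: (le_lt_trans (ncD _ _)); rewrite !ncM.
have ht : nc (t n) <= nc b + 1.
  by rewrite -[t n](subrK b); apply: (le_trans (ncD _ _)); lra.
have h1' : nc (s n - a) * M < e / 2.
  by rewrite -ltr_pdivlMr //; apply: (lt_le_trans h1); rewrite invfM mulrA lexx.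
have h3' : nc (t n - b) * M < e / 2.
  by rewrite -ltr_pdivlMr //; apply: (lt_le_trans h3); rewrite invfM mulrA lexx.
have N1 := nc_ge0 (s n - a); have N2 := nc_ge0 (t n - b).
have : nc (s n - a) * nc (t n) <= nc (s n - a) * M.
  by apply: ler_wpM2l => //; apply: (le_trans ht); rewrite /M; lra.
have : nc a * nc (t n - b) <= nc (t n - b) * M.
  by rewrite mulrC; apply: ler_wpM2l => //; rewrite /M; lra.
lra.
Qed.

Lemma ulim_near s l l' : ulim s l -> (\forall n \near \oo, s n = l') -> l = l'.
Proof.
move=> sl ev; apply/eqP; rewrite -subr_eq0 -nc_eq0; apply/negPn/negP => h.
have h0 : 0 < nc (l - l') by rewrite lt0r h nc_ge0.
have [n [/= h1 h2]] := ultra_meet (sl _ h0) (Foo ev).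
by move: h1; rewrite h2 nc_dist ltxx.
Qed.

Lemma ulim_le s l (b : R) : ulim s l -> (forall n, nc (s n) <= b) -> nc l <= b.
Proof.
move=> sl sb; rewrite leNgt; apply/negP => h.
have h0 : 0 < nc l - b by rewrite subr_gt0.
have [n hn] := ulim_ex sl h0; have := sb n.
have := ncB (s n) (s n - l); rewrite subKr; lra.
Qed.

Lemma ulim_ge s l (b : R) : ulim s l -> (forall n, b <= nc (s n)) -> b <= nc l.
Proof.
move=> sl sb; rewrite leNgt; apply/negP => h.
have h0 : 0 < b - nc l by rewrite subr_gt0.
have [n hn] := ulim_ex sl h0; have := sb n.
have : nc (s n) <= nc (s n - l) + nc l by rewrite -{1}[s n](subrK l); exact: ncD.
lra.
Qed.

Lemma ulim0 s : (forall e : R, 0 < e -> \forall n \near \oo, nc (s n) <= e) -> ulim s 0.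
Proof.
move=> h e e0; have e2 : 0 < e / 2 by lra.
apply: filterS (Foo (h _ e2)) => n /=; rewrite subr0; lra.
Qed.

Lemma ulim_uniq s l l' : ulim s l -> ulim s l' -> l = l'.
Proof.
move=> sl sl'; apply/eqP; rewrite -subr_eq0 -nc_eq0; apply/negPn/negP => h.
have h0 : 0 < nc (l - l') / 2 by rewrite divr_gt0 // lt0r h nc_ge0.
have [n [/= h1 h2]] := ultra_meet (sl _ h0) (sl' _ h0).
have : nc (l - l') <= nc (s n - l) + nc (s n - l').
  by rewrite -[l - l']opprB ncN (_ : l' - l = (s n - l) - (s n - l')); [exact: ncB|ring].
lra.
Qed.

Lemma real_ulim (a : nat -> R) (M : R) : (forall n, `|a n| <= M) ->
  exists l : R, forall e, 0 < e -> F [set n | `|a n - l| < e].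
Proof.
move=> aM.
have cK : compact `[- M, M] by exact: segment_compact.
have GU : UltraFilter (a @ F) by exact: ultra_fmap.
have GK : F (a @^-1` `[- M, M]%classic).
  by apply: filterE => n /=; rewrite in_itv /= -ler_norml.
have [l [_ al]] : (`[- M, M]%classic `&` [set p | a @ F --> p]) !=set0.
  by move: cK; rewrite compact_ultra => cK; exact: (cK _ GU GK).
exists l => e e0; have h : F (a @^-1` ball l e) := al _ (nbhsx_ballx l e e0).
by apply: filterS h => n; rewrite /ball /= distrC.
Qed.

Lemma disc_ultra_closed (M : R) : ultra_closed [set z | nc z <= M].
Proof.
move=> s sM.
have [a ha] : exists l : R, forall e, 0 < e -> F [set n | `|complex.Re (s n) - l| < e].
  by apply: (@real_ulim _ M) => n; exact: le_trans (nc_Re _) (sM n).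
have [b hb] : exists l : R, forall e, 0 < e -> F [set n | `|complex.Im (s n) - l| < e].
  by apply: (@real_ulim _ M) => n; exact: le_trans (nc_Im _) (sM n).
have sl : ulim s (a +i* b).
  move=> e e0; have e2 : 0 < e / 2 by lra.
  apply: filterS (filterI (ha _ e2) (hb _ e2)) => n [/= h1 h2].
  have -> : s n - (a +i* b) = (complex.Re (s n) - a) +i* (complex.Im (s n) - b).
    by case: (s n).
  apply: (le_lt_trans (nc_le_ReIm _ _)); lra.
by exists (a +i* b) => //=; exact: ulim_le sl sM.
Qed.

Lemma compact_ultra_closed (K : set R[i]) : compact (K : set R[i]^o) -> ultra_closed K.
Proof.
move=> cK s sK.
have GU : UltraFilter ((s : nat -> R[i]^o) @ F) by exact: ultra_fmap.
have GK : F ((s : nat -> R[i]^o) @^-1` K) by apply: filterE.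
have [l [Kl al]] : ((K : set R[i]^o) `&` [set p | (s : nat -> R[i]^o) @ F --> p]) !=set0.
  by move: cK; rewrite compact_ultra => cK; exact: (cK _ GU GK).
exists l => // e e0; have e0' : 0 < e%:C by rewrite ltcR.
have h : F ((s : nat -> R[i]^o) @^-1` ball (l : R[i]^o) e%:C) := al _ (nbhsx_ballx (l : R[i]^o) e%:C e0').
by apply: filterS h => n; rewrite /ball /= distrC normr_nc ltcR.
Qed.

Lemma ultra_closed_shift (K : set R[i]) (a : R[i]) :
  ultra_closed K -> ultra_closed [set v - a | v in K].
Proof.
move=> cK s sK.
have [l Kl sl] : exists2 l, K l & ulim (fun n => s n + a) l.
  by apply: cK => n; have [v Kv <-] := sK n; rewrite subrK.
exists (l - a); first by exists l.
by move=> e /sl; apply: filterS => n /=; rewrite opprB addrA.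
Qed.

Lemma ultra_closed_bounded (K : set R[i]) : ultra_closed K ->
  exists M : R, forall z, K z -> nc z <= M.
Proof.
move=> cK; apply: contrapT => nb.
have /choice[s hs] : forall n, exists z, K z /\ n%:R < nc z.
  move=> n; apply: contrapT => h; apply: nb; exists n%:R => z Kz.
  by rewrite leNgt; apply/negP => zn; apply: h; exists z.
have [l _ sl] := cK s (fun n => (hs n).1).
have [n [/= h1 h2]] := ultra_meet (sl _ ltr01) (Foo (nbhs_infty_ge (Num.trunc (nc l + 1)).+1)).
have := (hs n).2.
have : nc (s n) <= nc (s n - l) + nc l by rewrite -{1}[s n](subrK l); exact: ncD.
have : (Num.trunc (nc l + 1)).+1%:R <= n%:R :> R by rewrite ler_nat.
have : nc l + 1 < (Num.trunc (nc l + 1)).+1%:R by apply: truncnS_gt.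
lra.
Qed.

End UltraLimit.

(** * Jacobi operators on bounded sequences *)

Section Jacobi.
Variable R : realType.
Local Notation C := R[i].
Implicit Types (u v w x y : int -> C) (U V W : set C).

Definition jac u v w x (i : int) : C := u i * x (i - 1) + v i * x i + w i * x (i + 1).

Definition bdd x := exists b : R, forall i, nc (x i) <= b.

Definition coefs U V W u v w := forall i, [/\ U (u i), V (v i) & W (w i)].

Definition inj_family U V W := forall u v w, coefs U V W u v w ->
  forall x, bdd x -> (forall i, jac u v w x i = 0) -> forall i, x i = 0.

Lemma jac_shift u v w x k i :
  jac (fun j => u (j + k)) (fun j => v (j + k)) (fun j => w (j + k))
      (fun j => x (j + k)) i = jac u v w x (i + k).
Proof. by rewrite /jac [i - 1 + k]addrAC [i + 1 + k]addrAC. Qed.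

Lemma jacZ u v w x a i : jac u v w (fun j => a * x j) i = a * jac u v w x i.
Proof. by rewrite /jac; ring. Qed.

Lemma jacD u v w x y i :
  jac u v w (fun j => x j + y j) i = jac u v w x i + jac u v w y i.
Proof. by rewrite /jac; ring. Qed.

Lemma jacDZ u v w x y a i :
  jac u v w (fun j => x j + a * y j) i = jac u v w x i + a * jac u v w y i.
Proof. by rewrite /jac; ring. Qed.

Lemma bddD x y : bdd x -> bdd y -> bdd (fun i => x i + y i).
Proof.
move=> [a ha] [b hb]; exists (a + b) => i; apply: (le_trans (ncD _ _)).
exact: lerD.
Qed.

Lemma bddZ x a : bdd x -> bdd (fun i => a * x i).
Proof.
move=> [b hb]; exists (nc a * b) => i; rewrite ncM.
by apply: ler_wpM2l => //; exact: nc_ge0.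
Qed.

Lemma bddDZ x y a : bdd x -> bdd y -> bdd (fun i => x i + a * y i).
Proof. by move=> bx by_; apply: bddD => //; exact: bddZ. Qed.

Lemma bdd_sup x : bdd x -> exists b, [/\ 0 <= b, forall i, nc (x i) <= b &
  forall d, (forall i, nc (x i) <= d) -> b <= d].
Proof.
move=> [a ha]; exists (sup [set nc (x i) | i in [set: int]]).
have hs : has_sup [set nc (x i) | i in [set: int]].
  by split; [exists (nc (x 0)); exists 0|exists a => _ [i _ <-]].
have ub i : nc (x i) <= sup [set nc (x i) | i in [set: int]].
  by apply: ub_le_sup; [exact: hs.2|exists i].
split=> //; first exact: le_trans (nc_ge0 _) (ub 0).
by move=> d hd; apply: ge_sup; [exact: hs.1|move=> _ [i _ <-]].
Qed.

Section Compactness.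
Variable F : set_system nat.
Hypothesis FU : UltraFilter F.
Hypothesis Foo : \oo `<=` F.

Lemma ulim_jac (u v w x : nat -> int -> C) u' v' w' x' i :
  (forall j, ulim F (fun n => u n j) (u' j)) ->
  (forall j, ulim F (fun n => v n j) (v' j)) ->
  (forall j, ulim F (fun n => w n j) (w' j)) ->
  (forall j, ulim F (fun n => x n j) (x' j)) ->
  ulim F (fun n => jac (u n) (v n) (w n) (x n) i) (jac u' v' w' x' i).
Proof.
by move=> hu hv hw hx; apply: ulimD => //; [apply: ulimD => //|]; apply: ulimM.
Qed.

Variables U V W : set C.
Hypothesis cU : ultra_closed F U.
Hypothesis cV : ultra_closed F V.
Hypothesis cW : ultra_closed F W.
Hypothesis injF : inj_family U V W.

(** The family is closed under translations and coordinatewise limits. Counterexamples to c = n + 1,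
    scaled to supremum at most 1 and translated so that site 0 is large, converge to a bounded null
    sequence that is nonzero at 0, against [injF]. *)
Lemma uniform_bound : exists2 c : R, 0 < c & forall u v w, coefs U V W u v w ->
  forall x s, bdd x -> (forall i, nc (jac u v w x i) <= s) ->
  forall i, nc (x i) <= c * s.
Proof.
apply: contrapT => H.
have step (n : nat) : exists t : (int -> C) * (int -> C) * (int -> C) * (int -> C),
  [/\ coefs U V W t.1.1.1 t.1.1.2 t.1.2, forall i, nc (t.2 i) <= 1,
      1 / 2 <= nc (t.2 0) &
      forall i, nc (jac t.1.1.1 t.1.1.2 t.1.2 t.2 i) <= n.+1%:R^-1].
  apply: contrapT => Hn; apply: H; exists n.+1%:R => // u v w cuvw x s bx Jx i.
  rewrite leNgt; apply/negP => xi; apply: Hn.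
  have s0 : 0 <= s := le_trans (nc_ge0 _) (Jx 0).
  have [b [b0 xb bmin]] := bdd_sup bx.
  have bgt0 : 0 < b.
    by apply: lt_le_trans (xb i); apply: le_lt_trans xi; rewrite mulr_ge0.
  (* The supremum need not be attained; a site carrying half of it is enough to keep the limit
     nonzero. *)
  have [k xk] : exists k, b / 2 <= nc (x k).
    apply: contrapT => hk; have : b <= b / 2; last lra.
    by apply: bmin => j; rewrite leNgt; apply/negP => /ltW h; apply: hk; exists j.
  exists (fun j => u (j + k), fun j => v (j + k), fun j => w (j + k),
          fun j => (b%:C)^-1 * x (j + k)); split => /=.
  - by move=> j; exact: cuvw.
  - move=> j; rewrite ncM ncV nc_real ger0_norm // mulrC ler_pdivrMr // mul1r.
    exact: xb.
  - by rewrite add0r ncM ncV nc_real ger0_norm // ler_pdivlMl // mulrA mulr1.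
  - move=> j; rewrite jacZ jac_shift ncM ncV nc_real ger0_norm // mulrC.
    rewrite ler_pdivrMr //; apply: (le_trans (Jx _)).
    by rewrite ler_pdivlMl //; apply: (le_trans (ltW xi)); exact: xb.
have [t ht] := choice step.
have /choice[u' hu'] j : exists l, U l /\ ulim F (fun n => (t n).1.1.1 j) l.
  by have [|l Ul] := @cU (fun n => (t n).1.1.1 j);
     [move=> n; have [/(_ j)[]] := ht n|exists l].
have /choice[v' hv'] j : exists l, V l /\ ulim F (fun n => (t n).1.1.2 j) l.
  by have [|l Ul] := @cV (fun n => (t n).1.1.2 j);
     [move=> n; have [/(_ j)[]] := ht n|exists l].
have /choice[w' hw'] j : exists l, W l /\ ulim F (fun n => (t n).1.2 j) l.
  by have [|l Ul] := @cW (fun n => (t n).1.2 j);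
     [move=> n; have [/(_ j)[]] := ht n|exists l].
have /choice[x' hx'] j : exists l, nc l <= 1 /\ ulim F (fun n => (t n).2 j) l.
  by have [|l Ul] := @disc_ultra_closed _ _ FU (1) (fun n => (t n).2 j);
     [move=> n; have [_ /(_ j)] := ht n|exists l].
have x0 : x' 0 = 0.
  apply: (@injF u' v' w' _ x').
  - by move=> j; split; [case: (hu' j)|case: (hv' j)|case: (hw' j)].
  - by exists 1 => j; case: (hx' j).
  - move=> i; apply: (ulim_uniq FU (s := fun n => jac (t n).1.1.1 (t n).1.1.2 (t n).1.2 (t n).2 i)).
      by apply: ulim_jac => j; [case: (hu' j)|case: (hv' j)|case: (hw' j)|case: (hx' j)].
    apply: ulim0 => // e e0; near=> n.
    have [_ _ _ /(_ i) h] := ht n; apply: (le_trans h).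
    by apply: ltW; near: n; exact: near_infty_natSinv_lt (PosNum e0).
have : 1 / 2 <= nc (x' 0).
  by apply: (ulim_ge FU (hx' 0).2) => n; have [] := ht n.
by rewrite x0 nc0; lra.
Unshelve. all: by end_near. Qed.

Section Surjectivity.
Variables (u v w : int -> C) (n : nat).
Hypothesis cuvw : coefs U V W u v w.
Let P := n.*2.+1.
(** The representative of [i] in [-n, n] modulo [P]. Composing the coefficients with [rho] gives a
    periodic member of the family that agrees with the original one on the window |i| <= n. *)
Let rho (i : int) : int := ((i + n%:Z) %% P%:Z)%Z - n%:Z.
Let per (z : 'rV[C]_P) (i : int) : C := z 0 (inord `|((i + n%:Z) %% P%:Z)%Z|%N).
Let f (z : 'rV[C]_P) : 'rV[C]_P :=
  \row_k jac (u \o rho) (v \o rho) (w \o rho) (per z) (k%:Z - n%:Z).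

Let perE z i j : (i = j %[mod P%:Z])%Z -> per z i = per z j.
Proof. by move=> ij; rewrite /per -modzDml ij modzDml. Qed.

Let rhoE i j : (i = j %[mod P%:Z])%Z -> rho i = rho j.
Proof. by move=> ij; rewrite /rho -modzDml ij modzDml. Qed.

Let rho_id i : (`|i| <= n)%N -> rho i = i.
Proof. by move=> hi; rewrite /rho modz_small ?addrK //; apply/andP; split; lia. Qed.

Let rho_bnd i : exists k : 'I_P, (i = k%:Z - n%:Z %[mod P%:Z])%Z /\ rho i = k%:Z - n%:Z.
Proof.
have h0 : (0 <= (i + n%:Z) %% P%:Z)%Z by rewrite modz_ge0.
have h1 : ((i + n%:Z) %% P%:Z < P%:Z)%Z by rewrite ltz_pmod.
have h2 : (`|((i + n%:Z) %% P%:Z)%Z| < P)%N by lia.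
exists (Ordinal h2); rewrite /= gez0_abs //; split=> //.
by rewrite modzDml addrK.
Qed.

Let jacper z i : exists k : 'I_P, rho i = k%:Z - n%:Z /\
  jac (u \o rho) (v \o rho) (w \o rho) (per z) i = f z 0 k.
Proof.
have [k [ik rk]] := rho_bnd i; exists k; split=> //; rewrite mxE /jac /=.
rewrite (rhoE ik) (@perE _ i _ ik).
by rewrite (@perE _ (i - 1) (k%:Z - n%:Z - 1)) 1?(@perE _ (i + 1) (k%:Z - n%:Z + 1)) //;
   rewrite -modzDml ik modzDml.
Qed.

Let bdd_per z : bdd (per z).
Proof.
exists (\sum_k nc (z 0 k)) => i; rewrite /per; set k := inord _.
by rewrite (bigD1 k) //= lerDl sumr_ge0 // => *; exact: nc_ge0.
Qed.

Let linf : linear f.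
Proof. by move=> a z1 z2; apply/rowP => k; rewrite !mxE /jac /per !mxE; ring. Qed.

(** On one period the operator is an injective endomorphism of a finite-dimensional space, hence
    onto. The middle clause says that the image takes only values of [y], so that [uniform_bound]
    controls x independently of [n]. *)
Lemma surjective_window (y : int -> C) : exists x, bdd x /\
  exists u' v' w', [/\ coefs U V W u' v' w',
    forall i, exists j, jac u' v' w' x i = y j &
    forall i, (`|i| <= n)%N -> jac u v w x i = y i].
Proof.
pose lf : {linear 'rV[C]_P -> 'rV[C]_P} :=
  HB.pack f (GRing.isLinear.Build _ _ _ _ f linf).
have cr : coefs U V W (u \o rho) (v \o rho) (w \o rho) by move=> i; exact: cuvw.
have finj z : f z = 0 -> z = 0.
  move=> fz; have h : forall i, per z i = 0.
    apply: (@injF _ _ _ cr) => // i; have [k [_ ->]] := jacper z i; by rewrite fz mxE.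
  apply/rowP => k; rewrite mxE -(h (k%:Z - n%:Z)) /per subrK modz_small.
    by congr (z _ _); apply: val_inj; rewrite /= inordK.
  by have := ltn_ord k; lia.
have unitM : lin1_mx lf \in unitmx.
  rewrite -row_free_unit -kermx_eq0; apply/rowV0P => z /sub_kermxP.
  by rewrite mul_rV_lin1 => /finj.
pose z := (\row_k y (k%:Z - n%:Z)) *m invmx (lin1_mx lf).
have fz : f z = \row_k y (k%:Z - n%:Z).
  by rewrite -[f z]/(lf z) -mul_rV_lin1 mulmxKV.
have E i : jac (u \o rho) (v \o rho) (w \o rho) (per z) i = y (rho i).
  by have [k [-> ->]] := jacper z i; rewrite fz mxE.
exists (per z); split=> //; exists (u \o rho), (v \o rho), (w \o rho); split=> //.
- by move=> i; exists (rho i).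
- by move=> i hi; have := E i; rewrite /jac /= (rho_id hi).
Qed.
End Surjectivity.

(** The window solutions share one bound, so they have a coordinatewise limit; the equation at row i
    holds for all n >= |i| and survives the limit. *)
Lemma jac_surjective u v w : coefs U V W u v w -> forall y, bdd y ->
  exists2 x, bdd x & forall i, jac u v w x i = y i.
Proof.
move=> cuvw y [s ys]; have [c c0 hc] := uniform_bound.
have /choice[x hx] n : exists x, (forall i, nc (x i) <= c * s) /\
    forall i, (`|i| <= n)%N -> jac u v w x i = y i.
  have [x [bx [u' [v' [w' [cf Jy Jn]]]]]] := surjective_window n cuvw y.
  exists x; split=> //; apply: (hc _ _ _ cf) => // i.
  by have [j ->] := Jy i.
have /choice[x' hx'] j : exists l, nc l <= c * s /\ ulim F (fun n => x n j) l.
  by have [|l Ul] := @disc_ultra_closed _ _ FU (c * s) (fun n => x n j);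
     [move=> n; exact: (hx n).1|exists l].
exists x'; first by exists (c * s) => i; case: (hx' i).
move=> i; apply: (ulim_near FU Foo (s := fun n => jac u v w (x n) i)).
  by apply: ulim_jac => j; [exact: ulim_cst..|case: (hx' j)].
exists `|i|%N => // n /= hn; exact: (hx n).2.
Qed.

Lemma weight_step (q : R) (i j k : int) : 0 < q < 1 -> (`|j - k| <= 1)%N ->
  `|q ^+ `|j - i|%N - q ^+ `|k - i|%N| <= (q^-1 - 1) * q ^+ `|k - i|%N.
Proof.
move=> /andP[q0 q1] jk; have qi : 1 < q^-1 by rewrite invf_gt1.
have X m : 0 < q ^+ m by exact: exprn_gt0.
have qq : (q^-1 - 1) * q = 1 - q by rewrite mulrBl mulVf ?gt_eqF // mul1r.
have [->|[e|e]] : `|j - i|%N = `|k - i|%N \/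
    (`|j - i|%N = `|k - i|%N.+1 \/ `|k - i|%N = `|j - i|%N.+1) by lia.
- by rewrite subrr normr0 mulr_ge0 // ltW // subr_gt0.
- have Z := X `|k - i|%N; rewrite e exprS ler0_norm; last by nra.
  have : (1 - q) <= q^-1 - 1.
    rewrite -qq; rewrite ger_pMr //; [exact: ltW|lra].
  nra.
- have Z := X `|j - i|%N; rewrite e exprS mulrA qq ger0_norm; last by nra.
  by rewrite mulrBl mul1r.
Qed.

(** The commutator of the operator with an exponential weight: the diagonal cancels, and the
    neighbours enter with the relative variation q^-1 - 1 of the weight, which is small for q near
    1. *)
Lemma jac_weight u v w x (i : int) (q K : R) j : 0 < q < 1 ->
  nc (u j) <= K -> nc (w j) <= K ->
  nc (jac u v w (fun k => (q ^+ `|k - i|%N)%:C * x k) j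
      - (q ^+ `|j - i|%N)%:C * jac u v w x j)
  <= K * (q^-1 - 1) * (nc ((q ^+ `|(j - 1 - i)%R|%N)%:C * x (j - 1))
                     + nc ((q ^+ `|(j + 1 - i)%R|%N)%:C * x (j + 1))).
Proof.
move=> q01 hu hw; have /andP[q0 q1] := q01.
set a := q ^+ `|j - i|%N; set b := q ^+ `|(j - 1 - i)%R|%N; set d := q ^+ `|(j + 1 - i)%R|%N.
have -> : jac u v w (fun k => (q ^+ `|k - i|%N)%:C * x k) j - a%:C * jac u v w x j
   = u j * ((b%:C - a%:C) * x (j - 1)) + w j * ((d%:C - a%:C) * x (j + 1)).
  by rewrite /jac -/a -/b -/d; ring.
apply: (le_trans (ncD _ _)); rewrite !ncM -!rmorphB !nc_real /=.
have h1 : `|b - a| <= (q^-1 - 1) * b by rewrite distrC; apply: weight_step => //; lia.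
have h2 : `|d - a| <= (q^-1 - 1) * d by rewrite distrC; apply: weight_step => //; lia.
have b0 : 0 < b by exact: exprn_gt0.
have d0 : 0 < d by exact: exprn_gt0.
rewrite (gtr0_norm b0) (gtr0_norm d0).
have -> (N1 N2 : R) : K * (q^-1 - 1) * (b * N1 + d * N2)
  = K * ((q^-1 - 1) * b * N1) + K * ((q^-1 - 1) * d * N2) by ring.
by apply: lerD; apply: ler_pM => //; rewrite ?mulr_ge0 ?nc_ge0 //;
   apply: ler_wpM2r => //; exact: nc_ge0.
Qed.

(** A lower bound that holds around every site with exponentially decaying weights. Being pointwise
    it does not depend on [p], and it yields the decay of Green functions. *)
Definition local_estimate (c q : R) u v w := forall x, bdd x -> forall i s,
  (forall j, q ^+ `|j - i|%N * nc (jac u v w x j) <= s) -> nc (x i) <= c * s.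

Lemma small_rate (K e : R) : 0 < e -> exists2 q : R, 1 / 2 < q < 1 & K * (q^-1 - 1) <= e.
Proof.
move=> e0; set M := `|K| + e + 1; have M0 : 0 < M by rewrite /M; have := normr_ge0 K; lra.
(* With this q, q^-1 - 1 is e / M, and M exceeds both |K| and e; the latter gives q > 1/2. *)
exists (1 + e / M)^-1.
  have h : 0 < e / M by rewrite divr_gt0.
  have h1 : e / M < 1 by rewrite ltr_pdivrMr // /M; have := normr_ge0 K; lra.
  apply/andP; split; last by rewrite invf_lt1; lra.
  by rewrite -[ltRHS]mul1r ltr_pdivlMr; lra.
rewrite invrK [1 + _]addrC addrK mulrA ler_pdivrMr //.
by rewrite mulrC ler_pM2l //; have := ler_norm K; rewrite /M; lra.
Qed.

(** [uniform_bound] is applied to the weighted sequence [y]. By the choice of q the commutator term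
    is at most half the supremum of [y] and can be absorbed on the left, which doubles c. *)
Lemma family_local_estimate : exists2 cq : R * R, 0 < cq.1 /\ 0 < cq.2 < 1 &
  forall u v w, coefs U V W u v w -> local_estimate cq.1 cq.2 u v w.
Proof.
have [c c0 hc] := uniform_bound.
have [K1 hK1] := ultra_closed_bounded FU Foo cU.
have [K2 hK2] := ultra_closed_bounded FU Foo cW.
set K := Num.max K1 K2.
have [q /andP[q2 q1] hq] : exists2 q : R, 1 / 2 < q < 1 & (c * K * 2) * (q^-1 - 1) <= 1 / 2.
  by apply: small_rate; lra.
have q01 : 0 < q < 1 by apply/andP; split; lra.
exists (2 * c, q) => /=; first by split => //; rewrite mulr_gt0.
move=> u v w cuvw x [d xd] i s hs /=.
set y := fun k => (q ^+ `|k - i|%N)%:C * x k.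
have yx k : nc (y k) <= nc (x k).
  rewrite ncM nc_real ger0_norm ?exprn_ge0 //; last by lra.
  by rewrite ler_piMl ?nc_ge0 // exprn_ile1 //; lra.
have by_ : bdd y by exists d => k; exact: le_trans (yx k) (xd k).
have [b [b0 yb bmin]] := bdd_sup by_.
have Kb : 0 <= K * (q^-1 - 1).
  rewrite mulr_ge0 //; last by rewrite subr_ge0 invf_ge1 //; lra.
  by have [h _ _] := cuvw 0; rewrite le_max (le_trans (nc_ge0 _) (hK1 _ h)).
have Jy j : nc (jac u v w y j) <= s + K * (q^-1 - 1) * (b + b).
  have [hu _ hw] := cuvw j.
  have := @jac_weight u v w x i q K j q01 _ _; rewrite -/y => /(_ _ _) h.
  have {}h := h (le_trans (hK1 _ hu) _) (le_trans (hK2 _ hw) _).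
  rewrite -[jac u v w y j](subrK ((q ^+ `|j - i|%N)%:C * jac u v w x j)).
  apply: (le_trans (ncD _ _)); rewrite [leLHS]addrC; apply: lerD.
    by rewrite ncM nc_real ger0_norm ?exprn_ge0 //; lra.
  apply: (le_trans (h _ _)); rewrite ?le_max ?lexx ?orbT //.
  by apply: ler_wpM2l => //; apply: lerD; exact: yb.
have bb : b <= c * (s + K * (q^-1 - 1) * (b + b)).
  by apply: bmin => k; exact: (hc _ _ _ cuvw).
have : nc (x i) <= b.
  by have := yb i; rewrite /y subrr expr0 mul1r.
have : c * (K * (q^-1 - 1) * (b + b)) = (c * K * 2 * (q^-1 - 1)) * b by ring.
have : (c * K * 2 * (q^-1 - 1)) * b <= 1 / 2 * b by apply: ler_wpM2r.
move: bb; rewrite mulrDr; lra.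
Qed.

End Compactness.
End Jacobi.

(** * Coburn's lemma and the trichotomy *)

Section Coburn.
Variable R : realType.
Local Notation C := R[i].
Implicit Types (u v w x y e : int -> C) (U V W : set C).

Definition delta (k i : int) : C := (i == k)%:R.

(** The half line consists of the sites i > 0, and row 0 is left free: there the operator takes the
    value w 0 * x 1. [lkernel] is the mirror image, so site 0 belongs to neither half line. *)
Definition rkernel u v w x := [/\ bdd x, forall i, i <= 0 -> x i = 0,
  forall i, 0 < i -> jac u v w x i = 0 & exists i, x i != 0].

Definition lkernel u v w x := [/\ bdd x, forall i, 0 <= i -> x i = 0,
  forall i, i < 0 -> jac u v w x i = 0 & exists i, x i != 0].

Lemma jac_flip u v w x i :
  jac (fun j => w (- j)) (fun j => v (- j)) (fun j => u (- j)) (fun j => x (- j)) i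
  = jac u v w x (- i).
Proof. by rewrite /jac opprB opprD [1 - i]addrC; ring. Qed.

Lemma bdd_comp x (f : int -> int) : bdd x -> bdd (x \o f).
Proof. by move=> [b xb]; exists b => i; exact: xb. Qed.

Lemma bdd_mask x (P : pred int) : bdd x -> bdd (fun i => if P i then x i else 0).
Proof.
move=> [b xb]; exists b => i; case: ifP => // _; rewrite nc0.
exact: le_trans (nc_ge0 _) (xb i).
Qed.

Lemma coefs_flip U V W u v w : coefs U V W u v w ->
  coefs W V U (fun j => w (- j)) (fun j => v (- j)) (fun j => u (- j)).
Proof. by move=> h i; have [] := h (- i). Qed.

Lemma coefs_shift U V W u v w k : coefs U V W u v w ->
  coefs U V W (fun j => u (j + k)) (fun j => v (j + k)) (fun j => w (j + k)).
Proof. by move=> h i; exact: h. Qed.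

Lemma coefs_tr U V W u v w : coefs U V W u v w ->
  coefs W V U (fun j => w (j - 1)) v (fun j => u (j + 1)).
Proof. by move=> h i; have [_ ? _] := h i; have [? _ _] := h (i + 1); have [] := h (i - 1). Qed.

Lemma inj_family_flip U V W : inj_family U V W -> inj_family W V U.
Proof.
move=> H u v w cf x bx Jx i; rewrite -(opprK i).
apply: (H _ _ _ (coefs_flip cf) (fun j => x (- j))) => [|j]; first exact: bdd_comp.
by rewrite jac_flip.
Qed.

Lemma lkernel_flip u v w x : rkernel u v w x ->
  lkernel (fun j => w (- j)) (fun j => v (- j)) (fun j => u (- j)) (fun j => x (- j)).
Proof.
move=> [bx x0 Jx [i xi]]; split; first exact: (bdd_comp (fun j => - j)).
- by move=> j j0; apply: x0; lia.
- by move=> j j0; rewrite jac_flip; apply: Jx; lia.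
- by exists (- i); rewrite opprK.
Qed.

Lemma rkernel_flip u v w x : lkernel u v w x ->
  rkernel (fun j => w (- j)) (fun j => v (- j)) (fun j => u (- j)) (fun j => x (- j)).
Proof.
move=> [bx x0 Jx [i xi]]; split; first exact: (bdd_comp (fun j => - j)).
- by move=> j j0; apply: x0; lia.
- by move=> j j0; rewrite jac_flip; apply: Jx; lia.
- by exists (- i); rewrite opprK.
Qed.

Definition glue (l r : int -> C) (P : pred int) i := if P i then l i else r i.

(* Both kernel vectors vanish at site 0, so a suitable linear combination of
   them solves the remaining equation, at row 0. *)
Lemma coburn U V W u v w u' v' w' x y : inj_family U V W ->
  coefs U V W u v w -> coefs U V W u' v' w' ->
  rkernel u v w x -> lkernel u' v' w' y -> False.
Proof.
move=> H cf cf' [bx x0 Jx [i xi]] [by_ y0 Jy [k yk]].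
(* Row 0 of the spliced operator takes its left coupling from the primed operator and its right
   coupling from the other one; hence the strict inequality in [w2]. *)
pose u2 := glue u' u (fun i => i <= 0); pose v2 := glue v' v (fun i => i <= 0).
pose w2 := glue w' w (fun i => i < 0).
have cf2 : coefs U V W u2 v2 w2.
  move=> j; have [? ? ?] := cf j; have [? ? ?] := cf' j.
  by split; rewrite /u2 /v2 /w2 /glue; case: ifP.
have [a [b [ab ab0]]] : exists a b : C, (a != 0) || (b != 0) /\
    a * (u' 0 * y (-1)) + b * (w 0 * x 1) = 0.
  have [e|e] := eqVneq (w 0 * x 1) 0.
    by exists 0, 1; rewrite oner_neq0 orbT e; split=> //; ring.
  by exists (w 0 * x 1), (- (u' 0 * y (-1))); rewrite e; split=> //; ring.
pose z j := a * y j + b * x j.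
have bz : bdd z by apply: bddDZ => //; exact: bddZ.
have Jz j : jac u2 v2 w2 z j = 0.
  have [jn|jp|->] := ltgtP j 0.
  - transitivity (a * jac u' v' w' y j); last by rewrite Jy // mulr0.
    rewrite /jac /u2 /v2 /w2 /glue jn (ltW jn) /z.
    rewrite (x0 (j - 1)) 1?(x0 j) 1?(x0 (j + 1)); [|lia..]; ring.
  - transitivity (b * jac u v w x j); last by rewrite Jx // mulr0.
    rewrite /jac /u2 /v2 /w2 /glue ltNge (ltW jp) leNgt jp /= /z.
    rewrite (y0 (j - 1)) 1?(y0 j) 1?(y0 (j + 1)); [|lia..]; ring.
  - rewrite /jac /u2 /v2 /w2 /glue /= /z sub0r add0r.
    by rewrite (x0 (-1)) // (x0 0) // (y0 0) // (y0 1) // -[RHS]ab0; ring.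
have zz := H _ _ _ cf2 z bz Jz.
have [a0|b0] := orP ab.
- have k0 : k < 0 by rewrite ltNge; apply: contra yk => /y0 ->.
  by have := zz k; rewrite /z x0 ?(ltW k0) // mulr0 addr0 => /eqP; rewrite mulf_eq0 (negbTE a0) (negbTE yk).
- have i0 : 0 < i by rewrite ltNge; apply: contra xi => /x0 ->.
  by have := zz i; rewrite /z y0 ?(ltW i0) // mulr0 add0r => /eqP; rewrite mulf_eq0 (negbTE b0) (negbTE xi).
Qed.

(** Transposition and reflection each exchange [U] and [W], so the reflected transpose lies in the
    original family, and the second kernel vector becomes a left one there. *)
Lemma coburn_tr U V W u v w u' v' w' x y : inj_family U V W ->
  coefs U V W u v w -> coefs U V W u' v' w' ->
  rkernel u v w x ->
  rkernel (fun j => w' (j - 1)) v' (fun j => u' (j + 1)) y -> False.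
Proof.
move=> H cf cf' kx ky.
exact: (coburn H cf (coefs_flip (coefs_tr cf')) kx (lkernel_flip ky)).
Qed.

Section Green.
Variables (u v w e : int -> C).
Hypothesis inj : forall x, bdd x -> (forall i, jac u v w x i = 0) -> forall i, x i = 0.
Hypotheses (be : bdd e) (Je : forall i, jac u v w e i = delta 0 i).

Lemma green_mul x a : bdd x -> (forall i, jac u v w x i = a * delta 0 i) ->
  forall i, x i = a * e i.
Proof.
move=> bx Jx i; apply/eqP; rewrite -subr_eq0; apply/eqP.
rewrite -mulNr; apply: (inj (x := fun i => x i + - a * e i)); first exact: bddDZ.
by move=> j; rewrite jacDZ Je Jx mulNr subrr.
Qed.

Lemma rkernel_green x : rkernel u v w x -> forall i, x i = w 0 * x 1 * e i.
Proof.
move=> [bx x0 Jx _]; apply: green_mul => // i; rewrite /delta.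
have [i0|i0|->] := ltgtP i 0; rewrite ?mulr0 ?mulr1.
- by rewrite /jac (x0 (i - 1)) 1?(x0 i) 1?(x0 (i + 1)) ?mulr0 ?addr0 //; lia.
- exact: Jx.
- by rewrite /jac sub0r add0r (x0 (-1)) // (x0 0) // !mulr0 !add0r.
Qed.

Lemma lkernel_green x : lkernel u v w x -> forall i, x i = u 0 * x (-1) * e i.
Proof.
move=> [bx x0 Jx _]; apply: green_mul => // i; rewrite /delta.
have [i0|i0|->] := ltgtP i 0; rewrite ?mulr0 ?mulr1.
- exact: Jx.
- by rewrite /jac (x0 (i - 1)) 1?(x0 i) 1?(x0 (i + 1)) ?mulr0 ?addr0 //; lia.
- by rewrite /jac sub0r add0r (x0 1) // (x0 0) // !mulr0 !addr0.
Qed.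

Lemma green0_rkernel x : rkernel u v w x -> e 0 = 0.
Proof.
move=> kx; have E := rkernel_green kx; have [_ x0 _ [i xi]] := kx.
have a0 : w 0 * x 1 != 0 by apply: contra xi => /eqP a0; rewrite E a0 mul0r.
by have := E 0; rewrite x0 // => /esym/eqP; rewrite mulf_eq0 (negbTE a0) => /eqP.
Qed.

Lemma green0_lkernel x : lkernel u v w x -> e 0 = 0.
Proof.
move=> kx; have E := lkernel_green kx; have [_ x0 _ [i xi]] := kx.
have a0 : u 0 * x (-1) != 0 by apply: contra xi => /eqP a0; rewrite E a0 mul0r.
by have := E 0; rewrite x0 // => /esym/eqP; rewrite mulf_eq0 (negbTE a0) => /eqP.
Qed.

Lemma green_right : e 0 = 0 -> (exists2 i, 0 < i & e i != 0) ->
  rkernel u v w (fun i => if 0 < i then e i else 0).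
Proof.
move=> e0 [k k0 ek]; split.
- exact: bdd_mask.
- by move=> i i0; rewrite ltNge i0.
- move=> i i0; transitivity (jac u v w e i); last by rewrite Je /delta gt_eqF.
  rewrite /jac i0; congr (_ + _ * _); last by case: ifP => //; lia.
  congr (_ * _ + _); case: ifP => // h; have -> : i - 1 = 0 by lia.
  by rewrite e0.
- by exists k; rewrite k0.
Qed.

Lemma green_left : e 0 = 0 -> (exists2 i, i < 0 & e i != 0) ->
  lkernel u v w (fun i => if i < 0 then e i else 0).
Proof.
move=> e0 [k k0 ek]; split.
- exact: bdd_mask.
- by move=> i i0; rewrite ltNge i0.
- move=> i i0; transitivity (jac u v w e i); last by rewrite Je /delta lt_eqF.
  rewrite /jac i0; congr (_ * _ + _ + _ * _); first by case: ifP => //; lia.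
  case: ifP => // h; have -> : i + 1 = 0 by lia.
  by rewrite e0.
- by exists k; rewrite k0.
Qed.

(** If [e] vanishes at site 0, its two halves solve the half-line equations separately, and they
    cannot both be zero. With [green0_rkernel] and [green0_lkernel], the vanishing of [e 0] detects
    half-line kernels. *)
Lemma green_dichotomy : e 0 = 0 ->
  (exists x, rkernel u v w x) \/ (exists x, lkernel u v w x).
Proof.
move=> e0.
have [i ei] : exists i, e i != 0.
  apply: contrapT => h; have := Je 0; rewrite /jac /delta eqxx.
  have z i : e i = 0 by apply/eqP/negPn/negP => h'; apply: h; exists i.
  by rewrite !z !mulr0 !addr0 => /eqP; rewrite eq_sym oner_eq0.
have [i0|i0|i0] := ltgtP i 0.
- by right; eexists; apply: green_left => //; exists i.
- by left; eexists; apply: green_right => //; exists i.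
- by move: ei; rewrite i0 e0 eqxx.
Qed.

End Green.

Lemma geometric_le0 (a b q : R) : 0 < q < 1 -> (forall n, a <= b * q ^+ n) -> a <= 0.
Proof.
move=> /andP[q0 q1] h; rewrite leNgt; apply/negP => a0.
have b0 : 0 < b by have := h 0%N; rewrite expr0; lra.
have := @cvg_expr _ q; rewrite gtr0_norm // => /(_ q1) /cvgrPdist_lt /(_ (a / b)).
rewrite divr_gt0 // => /(_ isT)[n _ /(_ n (leqnn n))].
rewrite /= sub0r normrN ger0_norm ?exprn_ge0 ?(ltW q0) // ltr_pdivlMr // mulrC.
by rewrite ltNge h.
Qed.

(** Only the source j = k contributes to the weighted supremum, so the weight itself is the decay
    rate. *)
Lemma local_estimate_delta (c q : R) u v w e k : 0 < q < 1 -> local_estimate c q u v w ->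
  bdd e -> (forall i, jac u v w e i = delta k i) -> forall i, nc (e i) <= c * q ^+ `|k - i|%N.
Proof.
move=> /andP[q0 q1] le be Je i; apply: le => // j; rewrite Je /delta.
have [->|_] := eqVneq j k; first by rewrite nc1 mulr1.
by rewrite nc0 mulr0 exprn_ge0 // ltW.
Qed.

(* Summation by parts: [a (J b) - (J^T a) b] telescopes, and the boundary terms
   decay. *)
Lemma green_tr (c q K : R) u v w e e' : 0 < q < 1 -> local_estimate c q u v w ->
  (forall i, nc (u i) <= K /\ nc (w i) <= K) ->
  bdd e -> bdd e' -> (forall i, jac u v w e i = delta 0 i) ->
  (forall i, jac (fun j => w (j - 1)) v (fun j => u (j + 1)) e' i = delta 0 i) ->
  e' 0 = e 0.
Proof.
move=> q01 le uwK be [b' eb'] Je Je'.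
have ee := local_estimate_delta q01 le be Je.
have /andP[q0 q1] := q01.
pose D i := e' i * (w i * e (i + 1)) - e' (i + 1) * (u (i + 1) * e i).
have Dstep i : D i - D (i - 1) = e' i * delta 0 i - delta 0 i * e i.
  rewrite -{1}(Je i) -(Je' i) /D /jac !subrK; ring.
have K0 : 0 <= K by apply: le_trans (uwK 0).1; exact: nc_ge0.
have b0 : 0 <= b' by apply: le_trans (eb' 0); exact: nc_ge0.
have c0 : 0 <= c by have := ee 0; rewrite expr0 mulr1; apply: le_trans; exact: nc_ge0.
have Dle i (n : nat) : (n < `|i|)%N -> nc (D i) <= (2 * b' * K * c) * q ^+ n.
  move=> ni; have X k : (n <= `|k|)%N -> nc (e k) <= c * q ^+ n.
    move=> nk; apply: (le_trans (ee k)); apply: ler_wpM2l => //.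
    by apply: ler_wiXn2l; [exact: ltW|exact: ltW|lia].
  apply: (le_trans (ncB _ _)); rewrite !ncM.
  have T a b d : nc a <= b' -> nc b <= K -> nc d <= c * q ^+ n ->
      nc a * (nc b * nc d) <= b' * (K * (c * q ^+ n)).
    by move=> *; apply: ler_pM; rewrite ?mulr_ge0 ?nc_ge0 //; apply: ler_pM; rewrite ?nc_ge0.
  have h1 := T _ _ _ (eb' i) (uwK i).2 (X (i + 1) ltac:(lia)).
  have h2 := T _ _ _ (eb' (i + 1)) (uwK (i + 1)).1 (X i ltac:(lia)).
  have -> : 2 * b' * K * c * q ^+ n = b' * (K * (c * q ^+ n)) + b' * (K * (c * q ^+ n)) by ring.
  exact: lerD.
(* [D] changes only at the source. It is therefore constant on i >= 0 and on i <= -1, decay makes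
   both constants zero, and its jump at 0 is e' 0 - e 0. *)
have Dp (n : nat) : D n%:Z = D 0.
  elim: n => // n <-; have := Dstep n.+1%:Z.
  rewrite /delta (_ : (n.+1%:Z == 0) = false) ?mulr0 ?mul0r ?subr0 // => /eqP.
  by rewrite subr_eq0 => /eqP ->; congr D; lia.
have Dn (n : nat) : D (- n.+1%:Z) = D (-1).
  elim: n => // n <-; have := Dstep (- n.+1%:Z).
  rewrite /delta (_ : (- n.+1%:Z == 0) = false) ?mulr0 ?mul0r ?subr0; last by lia.
  by move/eqP; rewrite subr_eq0 => /eqP ->; congr D; lia.
have D0 : D 0 = 0.
  apply/eqP; rewrite -nc_eq0 eq_le nc_ge0 andbT.
  by apply: (@geometric_le0 _ (2 * b' * K * c) q) => // n; rewrite -(Dp n.+1); apply: Dle; lia.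
have D1 : D (-1) = 0.
  apply/eqP; rewrite -nc_eq0 eq_le nc_ge0 andbT.
  by apply: (@geometric_le0 _ (2 * b' * K * c) q) => // n; rewrite -(Dn n.+1); apply: Dle; lia.
have := Dstep 0; rewrite sub0r D0 D1 subrr /delta eqxx mulr1 mul1r.
by move/esym/eqP; rewrite subr_eq0 => /eqP.
Qed.

Section Family.
Variable F : set_system nat.
Hypothesis FU : UltraFilter F.
Hypothesis Foo : \oo `<=` F.

Definition good_family U V W :=
  [/\ ultra_closed F U, ultra_closed F V, ultra_closed F W & inj_family U V W].

Lemma good_family_flip U V W : good_family U V W -> good_family W V U.
Proof. by move=> [hu hv hw /inj_family_flip]. Qed.

Lemma bdd_delta k : bdd (delta k).
Proof. by exists 1 => i; rewrite /delta; case: eqP; rewrite ?nc1 ?nc0. Qed.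

Lemma greenP U V W u v w k : good_family U V W -> coefs U V W u v w ->
  exists e, bdd e /\ forall i, jac u v w e i = delta k i.
Proof.
move=> [hu hv hw inj] cf.
by have [e] := jac_surjective FU Foo hu hv hw inj cf (bdd_delta k); exists e.
Qed.

Lemma good_inj U V W u v w : good_family U V W -> coefs U V W u v w ->
  forall x, bdd x -> (forall i, jac u v w x i = 0) -> forall i, x i = 0.
Proof. by move=> [_ _ _ inj] cf; exact: inj. Qed.

Lemma green_tr_good U V W u v w e e' : good_family U V W -> coefs U V W u v w ->
  bdd e -> bdd e' -> (forall i, jac u v w e i = delta 0 i) ->
  (forall i, jac (fun j => w (j - 1)) v (fun j => u (j + 1)) e' i = delta 0 i) ->
  e' 0 = e 0.
Proof.
move=> [hu hv hw inj] cf.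
have [[c q] [_ q01] /(_ _ _ _ cf) le] := family_local_estimate FU Foo hu hv hw inj.
have [K1 hK1] := ultra_closed_bounded FU Foo hu.
have [K2 hK2] := ultra_closed_bounded FU Foo hw.
apply: (green_tr (K := Num.max K1 K2) q01 le) => i.
by have [ui _ wi] := cf i; split; rewrite le_max; apply/orP;
  [left; exact: hK1|right; exact: hK2].
Qed.

(** Suppose the primed operator has no right kernel. Coburn's lemma excludes a left one, so its
    Green function is nonzero at 0. Splice the primed operator on the left with the other one on the
    right. The splice inherits the right kernel, so its Green function, and by [green_tr_good] that
    of its transpose, vanishes at 0. The transpose of the splice thus has a half-line kernel, which
    [coburn_tr] forces to be a left one. The left half sees primed coefficients only, so the Green
    function of the primed transpose vanishes at 0, and hence so does that of the primed operator, a
    contradiction. *)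
Lemma rkernel_propagates U V W u v w u' v' w' : good_family U V W ->
  coefs U V W u v w -> coefs U V W u' v' w' ->
  (exists x, rkernel u v w x) -> exists x, rkernel u' v' w' x.
Proof.
move=> G cf cf' [x kx]; apply: contrapT => nr.
have G' := good_family_flip G; have [_ _ _ inj] := G.
have [e [be Je]] := greenP 0 G cf'.
have e0 : e 0 != 0.
  apply/eqP => /(green_dichotomy be Je)[//|[y ky]].
  exact: (coburn inj cf cf' kx ky).
pose u2 := glue u' u (fun i => i <= 0); pose v2 := glue v' v (fun i => i <= 0).
pose w2 := glue w' w (fun i => i < 0).
have cf2 : coefs U V W u2 v2 w2.
  move=> j; have [? ? ?] := cf j; have [? ? ?] := cf' j.
  by split; rewrite /u2 /v2 /w2 /glue; case: ifP.
have kx2 : rkernel u2 v2 w2 x.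
  have [bx x0 Jx nx] := kx; split=> // i i0; rewrite -(Jx _ i0).
  by rewrite /jac /u2 /v2 /w2 /glue ltNge (ltW i0) leNgt i0.
have [e2 [be2 Je2]] := greenP 0 G cf2.
have e20 : e2 0 = 0 by exact: (green0_rkernel (good_inj G cf2) be2 Je2 kx2).
have [f2 [bf2 Jf2]] := greenP 0 G' (coefs_tr cf2).
have f20 : f2 0 = 0 by rewrite (green_tr_good G cf2 be2 bf2 Je2 Jf2).
have [[y ky]|[y ky]] := green_dichotomy bf2 Jf2 f20.
  exact: (coburn_tr inj cf2 cf2 kx2 ky).
have ky' : lkernel (fun j => w' (j - 1)) v' (fun j => u' (j + 1)) y.
  have [by_ y0 Jy ny] := ky; split=> // i i0; rewrite -(Jy _ i0).
  rewrite /jac /u2 /v2 /w2 /glue (ltW i0).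
  have -> : (i - 1 < 0) by lia.
  by have -> : (i + 1 <= 0) by lia.
have [f [bf Jf]] := greenP 0 G' (coefs_tr cf').
have f0 : f 0 = 0 by exact: (green0_lkernel (good_inj G' (coefs_tr cf')) bf Jf ky').
by move: e0; rewrite -(green_tr_good G cf' be bf Je Jf) f0 eqxx.
Qed.

(** One right kernel in the family makes every Green function one-sided. By propagation to the
    operator shifted by [k], [e] vanishes at its source; a nonzero part further left would be a left
    kernel, which Coburn's lemma excludes. Row [k] then reads off the last equation. *)
Lemma rkernel_green_supp U V W u v w k e : good_family U V W ->
  (exists u v w x, coefs U V W u v w /\ rkernel u v w x) ->
  coefs U V W u v w -> bdd e -> (forall i, jac u v w e i = delta k i) ->
  (forall i, i <= k -> e i = 0) /\ w k * e (k + 1) = 1.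
Proof.
move=> G [u0 [v0 [w0 [x0 [cf0 kx0]]]]] cf be Je.
have cfs := coefs_shift k cf; have [_ _ _ inj] := G.
have [x kx] := rkernel_propagates G cf0 cfs (ex_intro _ _ kx0).
pose d i := e (i + k).
have bd : bdd d by exact: (bdd_comp (fun i => i + k)).
have Jd i : jac (fun j => u (j + k)) (fun j => v (j + k)) (fun j => w (j + k)) d i = delta 0 i.
  by rewrite jac_shift Je /delta -subr_eq0 addrK.
have d0 := green0_rkernel (good_inj G cfs) bd Jd kx.
have dn i : i <= 0 -> d i = 0.
  rewrite le_eqVlt => /predU1P[->//|i0]; apply/eqP/negPn/negP => di.
  by apply: (coburn inj cfs cfs kx); apply: (green_left bd Jd d0); exists i.
have en i : i <= k -> e i = 0 by move=> ik; rewrite -(subrK k i) -/(d _) dn //; lia.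
split=> //; have := Je k; rewrite /delta eqxx /jac (en k) // (en (k - 1)); last by lia.
by rewrite !mulr0 !add0r.
Qed.

Lemma lkernel_green_supp U V W u v w k e : good_family U V W ->
  (exists u v w x, coefs U V W u v w /\ lkernel u v w x) ->
  coefs U V W u v w -> bdd e -> (forall i, jac u v w e i = delta k i) ->
  (forall i, k <= i -> e i = 0) /\ u k * e (k - 1) = 1.
Proof.
move=> G [u0 [v0 [w0 [x0 [cf0 kx0]]]]] cf be Je.
pose d i := e (- i).
have [||d0 d1] := @rkernel_green_supp W V U _ _ _ (- k) d (good_family_flip G) _
  (coefs_flip cf) (bdd_comp (fun j => - j) be).
- by do 4 eexists; split; [exact: coefs_flip cf0|exact: rkernel_flip kx0].
- by move=> i; rewrite jac_flip Je /delta eqr_oppLR.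
split=> [i ki|]; first by rewrite -(opprK i) -/(d _) d0 //; lia.
by move: d1; rewrite /d opprK opprD opprK.
Qed.

(** The conclusion of [local_estimate] detached from the operator, so that it can also be stated for
    the corrected and truncated solutions on the half line. *)
Definition dominated (c q : R) (g x : int -> C) :=
  forall i s, (forall j, q ^+ `|j - i|%N * nc (g j) <= s) -> nc (x i) <= c * s.

Lemma dominated_solution U V W u v w : good_family U V W -> coefs U V W u v w ->
  exists c q : R, [/\ 0 < c, 0 < q < 1 &
    forall g, bdd g -> exists x, [/\ bdd x, forall i, jac u v w x i = g i & dominated c q g x]].
Proof.
move=> [hu hv hw inj] cf.
have [[c q] [c0 q01] /(_ _ _ _ cf) le] := family_local_estimate FU Foo hu hv hw inj.
exists c, q; split=> // g bg.
have [x bx Jx] := jac_surjective FU Foo hu hv hw inj cf bg.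
exists x; split=> // i s hs; apply: le => // j; by rewrite Jx.
Qed.

(* Subtracting a multiple of the Green function [e] makes the solution vanish
   at site 0, which decouples the two half lines. *)
Lemma halfline_solution U V W u v w k e : good_family U V W -> coefs U V W u v w ->
  (`|k| <= 1)%N -> bdd e -> (forall i, jac u v w e i = delta k i) -> e 0 != 0 ->
  exists c q : R, [/\ 0 < c, 0 < q < 1 & forall g, bdd g -> exists x a, 
    [/\ bdd x, forall i, i <= 0 -> x i = 0,
        forall i, 0 < i -> jac u v w x i = g i - a * delta k i & dominated c q g x]].
Proof.
move=> [hu hv hw inj] cf k1 be Je e0.
have [[c q] /= [c0 q01] /(_ _ _ _ cf) le] := family_local_estimate FU Foo hu hv hw inj.
have /andP[q0 q1] := q01; have ne0 : 0 < nc (e 0) by rewrite nc_gt0.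
(* The first term bounds x i, the second a * e i. Estimating x 0 by weights centred at i loses
   q^-|i|, which the decay of e i regains up to one factor q, since the source [k] may be one site
   away from 0. *)
exists (c + c * c / q / nc (e 0)), q; split=> //.
  by rewrite addr_gt0 // !divr_gt0 // mulr_gt0.
move=> g bg; have [x bx Jx] := jac_surjective FU Foo hu hv hw inj cf bg.
pose a := x 0 / e 0; pose y i := x i + - a * e i.
have y0 : y 0 = 0 by rewrite /y /a mulNr divfK // subrr.
exists (fun i => if 0 < i then y i else 0), a; split.
- by apply: bdd_mask; exact: bddDZ.
- by move=> i i0; rewrite ltNge i0.
- move=> i i0; transitivity (jac u v w y i); last by rewrite jacDZ Jx Je mulNr.
  rewrite /jac i0; congr (_ + _ * _); last by case: ifP => //; lia.
  congr (_ * _ + _); case: ifP => // h; have -> : i - 1 = 0 by lia.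
  by rewrite y0.
- move=> i s hs.
  have s0 : 0 <= s by apply: le_trans (hs i); rewrite mulr_ge0 ?nc_ge0 // exprn_ge0 // ltW.
  have cc : 0 <= c + c * c / q / nc (e 0).
    by apply: ltW; rewrite addr_gt0 // !divr_gt0 // mulr_gt0.
  case: ifP => [i0|_]; last by rewrite nc0 mulr_ge0.
  have xi : nc (x i) <= c * s by apply: le => // j; rewrite Jx.
  have qi : 0 < q ^+ `|i|%N by exact: exprn_gt0.
  have x0 : nc (x 0) <= c * (s / q ^+ `|i|%N).
    apply: le => // j; rewrite Jx subr0 ler_pdivlMr //.
    apply: le_trans (hs j); rewrite mulrAC -exprD; apply: ler_wpM2r; first exact: nc_ge0.
    by apply: ler_wiXn2l; [exact: ltW..|lia].
  have ei : nc (e i) <= c * (q ^+ `|i|%N / q).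
    apply: (le_trans (local_estimate_delta q01 le be Je i)); apply: ler_wpM2l; first exact: ltW.
    rewrite ler_pdivlMr // -exprSr; by apply: ler_wiXn2l; [exact: ltW..|lia].
  apply: (le_trans (ncD _ _)); rewrite mulrDl; apply: lerD => //.
  rewrite ncM ncN /a ncM ncV mulrAC ler_pdivrMr //.
  have -> : c * c / q / nc (e 0) * s * nc (e 0) = c * (s / q ^+ `|i|%N) * (c * (q ^+ `|i|%N / q)).
    by field; rewrite !gt_eqF.
  by apply: ler_pM => //; exact: nc_ge0.
Qed.

End Family.
End Coburn.

(** * Balls of the l^p norms *)

Section LpBall.
Variable R : realType.
Local Notation C := R[i].

(** Norm bounds are stated as membership in balls with real radii, which keeps the estimates out of
    the extended reals. *)
Definition lpball (I : choiceType) (p : \bar R) (c : R) (x : I -> C) :=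
  (lpnorm p x <= c%:E)%E.

Lemma poweR_le (r : R) (a b : \bar R) : 0 <= r -> (0 <= a)%E -> (a <= b)%E ->
  (a `^ r <= b `^ r)%E.
Proof.
move=> r0 a0 ab; rewrite gt0_ler_poweR // in_itv /= leey andbT //.
exact: le_trans ab.
Qed.

Section Chars.
Variable I : choiceType.
Implicit Types (x y : I -> C).

Lemma lpballP (r c : R) x : 1 <= r -> 0 <= c ->
  lpball r%:E c x <->
  (forall s : seq I, uniq s -> \sum_(i <- s) nc (x i) `^ r <= c `^ r).
Proof.
move=> r1 c0; have r0 : 0 < r by lra.
rewrite /lpball /lpnorm /=; set E := esum _ _.
have E0 : (0 <= E)%E by apply: esum_ge0 => i _; rewrite lee_fin powR_ge0.
have cr : (c `^ r) `^ r^-1 = c by rewrite -powRrM divff ?gt_eqF // powRr1.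
have -> : ((E `^ r^-1 <= c%:E)%E) = (E <= (c `^ r)%:E)%E.
  apply/idP/idP => h.
    have -> : E = ((E `^ r^-1) `^ r)%E by rewrite -poweRrM mulVf ?gt_eqF // poweRe1.
    by rewrite -poweR_EFin; apply: poweR_le; rewrite ?(ltW r0) ?poweR_ge0.
  by rewrite -cr -poweR_EFin; apply: poweR_le; rewrite ?invr_ge0 ?(ltW r0).
split=> [h s us|h].
- rewrite -lee_fin; apply: le_trans h; apply: esum_ge; exists [set` s].
    by split=> //; exact: finite_seq.
  by rewrite -fsbig_seq // sumEFin.
- apply: ge_ereal_sup => _ [A [fA _] <-].
  by rewrite fsbig_finite //= sumEFin lee_fin; apply: h.
Qed.

Lemma lpballyP (c : R) x : lpball +oo%E c x <-> forall i, nc (x i) <= c.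
Proof.
rewrite /lpball /lpnorm; split=> [h i|h].
- by rewrite -lee_fin; apply: le_trans h; apply: ereal_sup_ubound; exists i.
- by apply: ge_ereal_sup => _ [i _ <-]; rewrite lee_fin.
Qed.
End Chars.

Variable p : \bar R.
Hypothesis hp : (1%:E <= p)%E.

Lemma lpball_mono (I : choiceType) (c d : R) (x : I -> C) : c <= d ->
  lpball p c x -> lpball p d x.
Proof. by move=> cd h; apply: (le_trans h); rewrite lee_fin. Qed.

Lemma lpball_coord (I : choiceType) (c : R) (x : I -> C) i : 0 <= c ->
  lpball p c x -> nc (x i) <= c.
Proof.
move: hp; case: p => [r| |]; rewrite ?lee_fin //.
- move=> r1 c0 /(lpballP _ r1 c0) /(_ [:: i] isT); rewrite big_seq1 => h.
  have r0 : 0 < r by lra.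
  by rewrite leNgt; apply/negP => /(gt0_ltr_powR r0); rewrite !nnegrE nc_ge0 c0 => /(_ isT isT); lra.
- by move=> _ _ /lpballyP.
Qed.

Lemma lpball_ge0 (I : choiceType) (c : R) (x : I -> C) (i0 : I) : lpball p c x -> 0 <= c.
Proof.
move: hp; case: p => [r| |]; rewrite ?lee_fin //.
- move=> r1 h; rewrite -lee_fin; apply: le_trans h; exact: poweR_ge0.
- by move=> _ /lpballyP /(_ i0); apply: le_trans; exact: nc_ge0.
Qed.

(* One domination principle covers monotonicity, masks, reindexing along
   injections and extension by zero. *)
Lemma lpball_sub (I J : choiceType) (c : R) (x : I -> C) (y : J -> C) (g : J -> I) :
  0 <= c -> (forall j, y j != 0 -> nc (y j) <= nc (x (g j))) ->
  (forall j k, y j != 0 -> y k != 0 -> g j = g k -> j = k) ->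
  lpball p c x -> lpball p c y.
Proof.
move=> c0 yx gi; move: hp; case: p => [r| |]; rewrite ?lee_fin //.
- move=> r1 /(lpballP _ r1 c0) h; apply/(lpballP _ r1 c0) => s us.
  have r0 : 0 < r by lra.
  rewrite (bigID (fun j => y j != 0)) /= [X in _ + X]big1 ?addr0; last first.
    by move=> j /negPn/eqP ->; rewrite nc0 powR0 // gt_eqF.
  have us' : uniq [seq g j | j <- s & y j != 0].
    rewrite map_inj_in_uniq ?filter_uniq // => j k; rewrite !mem_filter.
    by move=> /andP[yj _] /andP[yk _]; exact: gi.
  apply: le_trans (h _ us'); rewrite big_map big_filter.
  apply: ler_sum => j yj; apply: ge0_ler_powR; rewrite ?nnegrE ?nc_ge0 ?(ltW r0) //.
  exact: yx.
- move=> _ /lpballyP h; apply/lpballyP => j.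
  have [->|yj] := eqVneq (y j) 0; first by rewrite nc0.
  exact: le_trans (yx _ yj) (h _).
Qed.

Lemma lpball_le (I : choiceType) (c : R) (x y : I -> C) : 0 <= c ->
  (forall i, nc (y i) <= nc (x i)) -> lpball p c x -> lpball p c y.
Proof. by move=> c0 h; apply: (lpball_sub (g := id)). Qed.

Lemma lpball0 (I : choiceType) : lpball p 0 (fun _ : I => 0 : C).
Proof.
move: hp; case: p => [r| |]; rewrite ?lee_fin //.
- move=> r1; apply/(lpballP _ r1 (lexx 0)) => s _; rewrite big1 ?powR_ge0 // => i _.
  by rewrite nc0 powR0 // gt_eqF //; lra.
- by move=> _; apply/lpballyP => i; rewrite nc0.
Qed.

Lemma lpball_delta (I : choiceType) (k : I) (a : C) :
  lpball p (nc a) (fun i => if i == k then a else 0).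
Proof.
move: hp; case: p => [r| |]; rewrite ?lee_fin //.
- move=> r1; have r0 : r != 0 by rewrite gt_eqF //; lra.
  apply/(lpballP _ r1 (nc_ge0 a)) => s us.
  have [ks|ks] := boolP (k \in s).
    rewrite (bigD1_seq k) //= eqxx big1 ?addr0 // => i /negbTE ->.
    by rewrite nc0 powR0.
  rewrite big_seq big1 ?powR_ge0 // => i si; case: eqP => [ik|_]; last by rewrite nc0 powR0.
  by move: ks; rewrite -ik si.
- by move=> _; apply/lpballyP => i; case: ifP; rewrite ?nc0 ?nc_ge0.
Qed.

Lemma lpballZ (I : choiceType) (c : R) (x : I -> C) a : 0 <= c ->
  lpball p c x -> lpball p (nc a * c) (fun i => a * x i).
Proof.
move=> c0; have ac : 0 <= nc a * c by rewrite mulr_ge0 ?nc_ge0.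
move: hp; case: p => [r| |]; rewrite ?lee_fin //.
- move=> r1 /(lpballP _ r1 c0) h; apply/(lpballP _ r1 ac) => s us.
  rewrite powRM ?nc_ge0 //; under eq_bigr do rewrite ncM powRM ?nc_ge0 //.
  by rewrite -mulr_sumr; apply: ler_wpM2l; [exact: powR_ge0|exact: h].
- move=> _ /lpballyP h; apply/lpballyP => i; rewrite ncM.
  by apply: ler_wpM2l; [exact: nc_ge0|exact: h].
Qed.

Lemma lpball_eps (I : choiceType) (c : R) (x : I -> C) :
  (forall e, 0 < e -> lpball p (c + e) x) -> lpball p c x.
Proof.
move=> h; rewrite /lpball; apply/lee_addgt0Pr => e e0; rewrite -EFinD; exact: h.
Qed.

Lemma lpball_fatou (I : choiceType) (c : R) (x : I -> C) : 0 <= c ->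
  (forall s : seq I, lpball p c (fun i => if i \in s then x i else 0)) ->
  lpball p c x.
Proof.
move=> c0; move: hp; case: p => [r| |]; rewrite ?lee_fin //.
- move=> r1 h; apply/(lpballP _ r1 c0) => s us.
  have /(lpballP _ r1 c0) /(_ s us) := h s; apply: le_trans.
  rewrite [leLHS]big_seq [leRHS]big_seq; apply: ler_sum => i ->; exact: lexx.
- move=> _ h; apply/lpballyP => i; have /lpballyP /(_ i) := h [:: i].
  by rewrite mem_head.
Qed.

(** Convexity of t^r at X / a and Y / b with weights a / (a + b) and b / (a + b). Summed over the
    sites it gives Minkowski's inequality directly for balls of radii [a] and [b]. *)
Lemma powR_conv (r a b X Y : R) : 1 <= r -> 0 < a -> 0 < b -> 0 <= X -> 0 <= Y ->
  (X + Y) `^ r <= (a + b) `^ r * (a / (a + b) * (X `^ r / a `^ r)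
                                + b / (a + b) * (Y `^ r / b `^ r)).
Proof.
move=> r1 a0 b0 X0 Y0; have ab0 : 0 < a + b by lra.
have t0 : 0 <= a / (a + b) by rewrite divr_ge0 //; lra.
have t1 : a / (a + b) <= 1 by rewrite ler_pdivrMr // mul1r; lra.
have hx : X / a \in (`[0, +oo[%classic : set R).
  by rewrite inE /= in_itv /= andbT divr_ge0 // ltW.
have hy : Y / b \in (`[0, +oo[%classic : set R).
  by rewrite inE /= in_itv /= andbT divr_ge0 // ltW.
have h := @convex_powR R r r1 (Itv01 t0 t1) (X / a) (Y / b) hx hy.
rewrite /= convRE [Z in Z `^ _ <= _]convRE /= /unstable.onem in h.
have E : 1 - a / (a + b) = b / (a + b) by field; rewrite gt_eqF.
rewrite E in h.
have dX : (X / a) `^ r = X `^ r / a `^ r.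
  by rewrite powRM ?invr_ge0 ?(ltW a0) // -powR_inv1 ?(ltW a0) // -powRrM mulN1r powRN.
have dY : (Y / b) `^ r = Y `^ r / b `^ r.
  by rewrite powRM ?invr_ge0 ?(ltW b0) // -powR_inv1 ?(ltW b0) // -powRrM mulN1r powRN.
rewrite dX dY in h.
have -> : X + Y = (a + b) * (a / (a + b) * (X / a) + b / (a + b) * (Y / b)).
  by field; rewrite !gt_eqF.
rewrite powRM ?(ltW ab0) //; last first.
  by rewrite addr_ge0 // mulr_ge0 // divr_ge0 // ltW.
by apply: ler_wpM2l => //; exact: powR_ge0.
Qed.

Lemma lpballD (I : choiceType) (a b : R) (x y : I -> C) : 0 <= a -> 0 <= b ->
  lpball p a x -> lpball p b y -> lpball p (a + b) (fun i => x i + y i).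
Proof.
move=> a0 b0 hx hy; have ab : 0 <= a + b by lra.
have [ea|a0'] := eqVneq a 0.
  apply: (lpball_le (x := y)) => //; last by rewrite ea add0r.
  move=> i; have := lpball_coord i a0 hx; rewrite ea => xi.
  have -> : x i = 0 by apply/eqP; rewrite -nc_eq0 eq_le nc_ge0 xi.
  by rewrite add0r.
have [eb|b0'] := eqVneq b 0.
  apply: (lpball_le (x := x)) => //; last by rewrite eb addr0.
  move=> i; have := lpball_coord i b0 hy; rewrite eb => yi.
  have -> : y i = 0 by apply/eqP; rewrite -nc_eq0 eq_le nc_ge0 yi.
  by rewrite addr0.
have {a0'}a1 : 0 < a by rewrite lt0r a0' a0.
have {b0'}b1 : 0 < b by rewrite lt0r b0' b0.
move: hx hy; move: hp; case: p => [r| |]; rewrite ?lee_fin //.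
- move=> r1 /(lpballP _ r1 a0) hx /(lpballP _ r1 b0) hy; apply/(lpballP _ r1 ab) => s us.
  have r0 : 0 < r by lra.
  apply: (@le_trans _ _ (\sum_(i <- s) (a + b) `^ r *
    (a / (a + b) * (nc (x i) `^ r / a `^ r) + b / (a + b) * (nc (y i) `^ r / b `^ r)))).
    apply: ler_sum => i _; apply: le_trans (powR_conv _ _ _ _ _) => //; rewrite ?nc_ge0 //.
    by apply: ge0_ler_powR; rewrite ?nnegrE ?addr_ge0 ?nc_ge0 ?(ltW r0) // ncD.
  rewrite -mulr_sumr big_split /= -!mulr_sumr -!mulr_suml ler_piMr ?powR_ge0 //.
  have h1 : (\sum_(i <- s) nc (x i) `^ r) / a `^ r <= 1.
    by rewrite ler_pdivrMr ?powR_gt0 // mul1r hx.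
  have h2 : (\sum_(i <- s) nc (y i) `^ r) / b `^ r <= 1.
    by rewrite ler_pdivrMr ?powR_gt0 // mul1r hy.
  have -> : 1 = a / (a + b) * 1 + b / (a + b) * 1 by field; rewrite gt_eqF //; lra.
  by apply: lerD; apply: ler_wpM2l => //; rewrite divr_ge0.
- move=> _ /lpballyP hx /lpballyP hy; apply/lpballyP => i.
  by apply: (le_trans (ncD _ _)); apply: lerD.
Qed.

Lemma lpball_sum (I : choiceType) (T : Type) (s : seq T) (c : T -> R) (x : T -> I -> C) :
  (forall t, 0 <= c t) -> (forall t, lpball p (c t) (x t)) ->
  lpball p (\sum_(t <- s) c t) (fun i => \sum_(t <- s) x t i).
Proof.
move=> c0 h; elim: s => [|t s IH].
  rewrite big_nil; rewrite (_ : (fun i => _) = (fun=> 0)); first exact: lpball0.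
  by apply/funext => i; rewrite big_nil.
rewrite big_cons (_ : (fun i => _) = (fun i => x t i + \sum_(t <- s) x t i)).
  by apply: lpballD => //; exact: sumr_ge0.
by apply/funext => i; rewrite big_cons.
Qed.

Lemma lpE (I : choiceType) (x : I -> C) : lp p x <-> exists c, lpball p c x.
Proof.
rewrite /lp /lpball /=; split=> [h|[c /le_lt_trans]]; last by apply; exact: ltry.
have : (lpnorm p x != -oo)%E -> exists c, (lpnorm p x <= c%:E)%E.
  by move: h; case: (lpnorm p x) => // r _ _; exists r.
have [->|] := eqVneq (lpnorm p x) -oo%E; last by move=> _; apply.
by exists 0; rewrite leNye.
Qed.

Lemma lp_norm (I : choiceType) (x : I -> C) (i0 : I) : lp p x ->
  exists c, [/\ 0 <= c, lpball p c x & lpnorm p x = c%:E].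
Proof.
move=> /lpE[c hc]; have c0 := lpball_ge0 i0 hc; move: hc; rewrite /lpball => hc.
have n0 : (0 <= lpnorm p x)%E.
  move: hp hc; case: p => [r| |]; rewrite ?lee_fin // => _ _; first exact: poweR_ge0.
  by apply: ereal_sup_ge; exists (nc (x i0))%:E; [exists i0|rewrite lee_fin nc_ge0].
exists (fine (lpnorm p x)).
have fn : lpnorm p x \is a fin_num by rewrite ge0_fin_numE //; apply: le_lt_trans hc (ltry _).
by rewrite fineK // fine_ge0.
Qed.

Lemma bounded_operatorI (I : choiceType) (i0 : I) (S : (I -> C) -> I -> C) (M : R) :
  0 <= M ->
  (forall (a : C) x y, lp p x -> lp p y ->
     S (fun i => a * x i + y i) = (fun i => a * S x i + S y i)) ->
  (forall c x, 0 <= c -> lpball p c x -> lpball p (M * c) (S x)) ->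
  bounded_operator p S.
Proof.
move=> M0 lin bd; split=> //.
- move=> x hx; have [c [c0 hc _]] := lp_norm i0 hx.
  by apply/lpE; exists (M * c); exact: bd.
- exists M => x hx; have [c [c0 hc ->]] := lp_norm i0 hx.
  by rewrite -EFinM; exact: bd.
Qed.

Lemma bounded_operatorE (I : choiceType) (i0 : I) (S : (I -> C) -> I -> C) :
  bounded_operator p S -> exists2 M : R, 0 <= M &
    forall c x, 0 <= c -> lpball p c x -> lpball p (M * c) (S x).
Proof.
move=> [Slp _ [M hM]]; exists `|M| => // c x c0 xc.
have hx : lp p x by apply/lpE; exists c.
have [d [d0 _ ed]] := lp_norm i0 hx.
apply: (le_trans (hM _ hx)); rewrite ed -EFinM lee_fin.
have dc : d <= c by rewrite -lee_fin -ed.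
by apply: (le_trans (ler_wpM2r d0 (ler_norm M))); apply: ler_wpM2l.
Qed.

Lemma lpD (I : choiceType) (x y : I -> C) (a : C) (i0 : I) : lp p x -> lp p y ->
  lp p (fun i => a * x i + y i).
Proof.
move=> /(lp_norm i0)[c [c0 hc _]] /(lp_norm i0)[d [d0 hd _]]; apply/lpE.
exists (nc a * c + d); apply: lpballD => //; first by rewrite mulr_ge0 ?nc_ge0.
exact: lpballZ.
Qed.

(* The supremum over [j] is bounded by the sum over a finite window of shifts
   plus a uniformly small tail. *)
Lemma dominated_lpball (c q : R) (g x : int -> C) (d : R) : 0 < c -> 0 < q < 1 ->
  dominated c q g x -> 0 <= d -> lpball p d g ->
  lpball p (c * (2 / (1 - q)) * d) x.
Proof.
move=> c0 q01 dom d0 hg; have /andP[q0 q1] := q01.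
have q1' : 0 < 1 - q by lra.
have qn n : 0 <= q ^+ n by rewrite exprn_ge0 // ltW.
have cd : 0 <= c * (2 / (1 - q)) * d by rewrite !mulr_ge0 ?invr_ge0 //; lra.
have geo N : \sum_(n < N) q ^+ n <= 1 / (1 - q).
  rewrite ler_pdivlMr // mulrC -opprB mulNr -subrX1 opprB.
  by have := qn N; lra.
(* Two one-sided geometric sums of shifts of |g|; each has norm at most d / (1 - q), which is the
   origin of the factor 2 / (1 - q). *)
pose G N : int -> C := fun i => \sum_(n < N) ((q ^+ n)%:C * (nc (g (i + n%:Z)))%:C)
                + \sum_(n < N) ((q ^+ n)%:C * (nc (g (i - n%:Z)))%:C).
have hG N : lpball p (2 / (1 - q) * d) (G N).
  have sh k n : lpball p (q ^+ n * d) (fun i => (q ^+ n)%:C * (nc (g (i + k)))%:C).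
    have -> : q ^+ n * d = nc (q ^+ n)%:C * d by rewrite nc_real ger0_norm.
    apply: lpballZ => //; apply: (lpball_sub (x := g) (g := fun i => i + k)) => //.
    - by move=> j _; rewrite nc_real ger0_norm ?nc_ge0.
    - by move=> j k' _ _ /addIr.
  have hs (f : nat -> int) : lpball p (1 / (1 - q) * d)
      (fun i => \sum_(n < N) ((q ^+ n)%:C * (nc (g (i + f n)))%:C)).
    apply: (lpball_mono (c := \sum_(n < N) (q ^+ n * d))).
      by rewrite -mulr_suml; apply: ler_wpM2r.
    apply: (@lpball_sum int 'I_N (index_enum _) (fun n => q ^+ n * d)
      (fun n i => (q ^+ n)%:C * (nc (g (i + f n)))%:C)) => n.
      exact: mulr_ge0.
    exact: sh.
  have -> : 2 / (1 - q) * d = 1 / (1 - q) * d + 1 / (1 - q) * d by ring.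
  by apply: lpballD; [rewrite mulr_ge0 // divr_ge0 //; lra..|exact: hs|exact: (hs (fun n => - n%:Z))].
have ub N i : nc (x i) <= c * (nc (G N i) + q ^+ N * d).
  have EG : nc (G N i) = \sum_(n < N) (q ^+ n * nc (g (i + n%:Z)))
                + \sum_(n < N) (q ^+ n * nc (g (i - n%:Z))).
    have -> : G N i = (\sum_(n < N) (q ^+ n * nc (g (i + n%:Z)))
                + \sum_(n < N) (q ^+ n * nc (g (i - n%:Z))))%:C.
      by rewrite /G rmorphD /= !rmorph_sum /=; congr (_ + _); apply: eq_bigr => n _; rewrite rmorphM.
    by rewrite nc_real ger0_norm // addr_ge0 // sumr_ge0 // => *; rewrite mulr_ge0 ?nc_ge0.
  have s1 : 0 <= \sum_(n < N) (q ^+ n * nc (g (i + n%:Z))).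
    by rewrite sumr_ge0 // => *; rewrite mulr_ge0 ?nc_ge0.
  have s2 : 0 <= \sum_(n < N) (q ^+ n * nc (g (i - n%:Z))).
    by rewrite sumr_ge0 // => *; rewrite mulr_ge0 ?nc_ge0.
  have qd : 0 <= q ^+ N * d by rewrite mulr_ge0.
  apply: dom => j; rewrite EG.
  have [jN|jN] := ltnP `|j - i|%N N; last first.
    apply: (@le_trans _ _ (q ^+ N * d)); last by lra.
    apply: ler_pM; rewrite ?nc_ge0 //; last exact: (lpball_coord j d0 hg).
    by apply: ler_wiXn2l; [exact: ltW..|].
  have [ij|ij] := lerP i j.
    apply: (@le_trans _ _ (\sum_(n < N) (q ^+ n * nc (g (i + n%:Z))))); last by lra.
    rewrite (bigD1 (Ordinal jN)) //=.
    have -> : i + `|j - i|%N%:Z = j by clear -ij; lia.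
    by rewrite lerDl sumr_ge0 // => *; rewrite mulr_ge0 ?nc_ge0.
  apply: (@le_trans _ _ (\sum_(n < N) (q ^+ n * nc (g (i - n%:Z))))); last by lra.
  rewrite (bigD1 (Ordinal jN)) //=.
  have -> : i - `|j - i|%N%:Z = j by clear -ij; lia.
  by rewrite lerDl sumr_ge0 // => *; rewrite mulr_ge0 ?nc_ge0.
(* The tail q^N d is a constant sequence, hence not small in l^p on the whole line. On a finite set
   s of sites it costs at most c q^N d times the size of s, which tends to 0 with N. *)
apply: lpball_fatou => // s; apply: lpball_eps => e e0.
have [N hN] : exists N, q ^+ N * (c * d * (size s)%:R) <= e.
  have := @cvg_expr _ q; rewrite gtr0_norm // => /(_ q1) /cvgrPdist_lt.
  set M := c * d * (size s)%:R + 1.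
  have M0 : 0 < M.
    have : 0 <= c * d * (size s)%:R by rewrite !mulr_ge0 // ltW.
    by rewrite /M; lra.
  move=> /(_ (e / M)); rewrite divr_gt0 // => /(_ isT)[N _ /(_ N (leqnn N))].
  rewrite /= sub0r normrN ger0_norm // ltr_pdivlMr // => h; exists N.
  apply: le_trans (ltW h); apply: ler_wpM2l => //; rewrite /M; lra.
pose T k : int -> C := fun i => if i == k then (c * (q ^+ N * d))%:C else 0.
have qd : 0 <= q ^+ N * d by rewrite mulr_ge0.
have cqd : 0 <= c * (q ^+ N * d) by rewrite mulr_ge0 // ltW.
have hT : lpball p (\sum_(k <- undup s) (c * (q ^+ N * d))) (fun i => \sum_(k <- undup s) T k i).
  apply: (@lpball_sum int int (undup s) (fun=> c * (q ^+ N * d)) T) => // k.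
  by have := lpball_delta k (c * (q ^+ N * d))%:C; rewrite nc_real ger0_norm.
have hcG : lpball p (c * (2 / (1 - q)) * d) (fun i => c%:C * (nc (G N i))%:C).
  have -> : c * (2 / (1 - q)) * d = nc c%:C * (2 / (1 - q) * d) by rewrite nc_real gtr0_norm // -!mulrA.
  apply: lpballZ; first by rewrite mulr_ge0 // divr_ge0 //; lra.
  apply: (lpball_le (x := G N)) => //; first by rewrite mulr_ge0 // divr_ge0 //; lra.
  by move=> i; rewrite nc_real ger0_norm ?nc_ge0.
have := lpballD cd (sumr_ge0 _ (fun k _ => cqd)) hcG hT.
set e' := \sum_(k <- _) _ => h.
have e'e : e' <= e.
  rewrite /e' big_const_seq count_predT iter_addr_0 -mulr_natr; apply: le_trans hN.
  rewrite [leRHS](_ : _ = c * (q ^+ N * d) * (size s)%:R); last by ring.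
  by apply: ler_wpM2l => //; rewrite ler_nat size_undup.
have e'0 : 0 <= e' by exact: sumr_ge0.
apply: (lpball_mono (c := c * (2 / (1 - q)) * d + e')); first by lra.
apply: lpball_le h; first by lra.
move=> i; case: ifPn => [si|_]; last by rewrite nc0 nc_ge0.
have -> : \sum_(k <- undup s) T k i = (c * (q ^+ N * d))%:C.
  rewrite (bigD1_seq i) ?undup_uniq ?mem_undup //= /T eqxx big1 ?addr0 // => k ki.
  by rewrite eq_sym (negbTE ki).
rewrite -rmorphM -rmorphD nc_real ger0_norm; last by rewrite addr_ge0 // mulr_ge0 ?nc_ge0 // ltW.
by rewrite -mulrDr.
Qed.

End LpBall.

(** * Matrices and the spectrum on the line *)

Definition int_range (N : nat) : seq int := [seq k%:Z - N%:Z | k <- iota 0 (N.*2.+1)].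

Lemma mem_int_range N (i : int) : (i \in int_range N) = (`|i| <= N)%N.
Proof.
apply/mapP/idP => [[k]|h]; first by rewrite mem_iota => h ->; lia.
by exists `|(i + N%:Z)%R|%N; [rewrite mem_iota; lia|lia].
Qed.

Section Matrices.
Variable R : realType.
Local Notation C := R[i].
Implicit Types (u v w : int -> C) (U V W : set C).

Definition shift_set V (l : C) : set C := [set v - l | v in V].

Lemma mxop3 (I : choiceType) (A : I -> I -> C) (x : I -> C) i (s : seq I) :
  uniq s -> (forall j, j \notin s -> A i j = 0) ->
  mxop A x i = \sum_(j <- s) A i j * x j.
Proof.
move=> us h; rewrite /mxop (@fsbigE _ _ _ _ _ s) //.
- by apply: congr_big => // j; rewrite in_setT.
- by move=> j _ js; rewrite h // mul0r.
Qed.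

Lemma M_biE U V W A l : M_bi U V W A -> exists u v w,
  coefs U (shift_set V l) W u v w /\ mxop_sub A l = jac u v w.
Proof.
move=> hA; exists (fun i => A i (i - 1)), (fun i => A i i - l), (fun i => A i (i + 1)).
split=> [i|].
  split.
  - have := hA i (i - 1); rewrite ifN; last by lia.
    by rewrite ifN; [rewrite subrK eqxx|lia].
  - by exists (A i i) => //; have := hA i i; rewrite eqxx.
  - have := hA i (i + 1); rewrite ifN; last by lia.
    by rewrite eqxx.
apply/funext => x; apply/funext => i; rewrite /mxop_sub.
rewrite (@mxop3 _ A x i [:: i - 1; i; i + 1]).
- by rewrite !big_cons big_nil /jac; ring.
- by rewrite /= !inE !negb_or; apply/and3P; split=> //; lia.
- move=> j; rewrite !inE !negb_or => /and3P[h1 h2 h3].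
  have := hA i j; rewrite eq_sym (negbTE h2) (negbTE h3) ifN //.
  by apply: contra h1 => /eqP ->; rewrite addrK.
Qed.

Lemma M_bi_mk U V W u v w l : coefs U (shift_set V l) W u v w -> exists A,
  M_bi U V W A /\ mxop_sub A l = jac u v w.
Proof.
move=> cf; pose A (i j : int) : C := if i == j then v i + l else
  if j == i + 1 then w i else if i == j + 1 then u i else 0.
exists A; split=> [i j|].
  rewrite /A; have [hu [v0 Vv e] hw] := cf i.
  case: eqP => [_|_]; first by rewrite -e subrK.
  by case: eqP => // _; case: eqP.
apply/funext => x; apply/funext => i; rewrite /mxop_sub.
rewrite (@mxop3 _ A x i [:: i - 1; i; i + 1]).
- rewrite !big_cons big_nil /A eqxx ifN; last by lia.
  rewrite ifN; last by lia.
  rewrite subrK eqxx ifN; last by lia.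
  by rewrite eqxx /jac; ring.
- by rewrite /= !inE !negb_or; apply/and3P; split=> //; lia.
- move=> j; rewrite !inE !negb_or => /and3P[h1 h2 h3].
  rewrite /A eq_sym (negbTE h2) (negbTE h3) ifN //.
  by apply: contra h1 => /eqP ->; rewrite addrK.
Qed.

(** Index n becomes site n + 1, so that site 0 carries the zero boundary value required by
    [rkernel]. *)
Definition ext (x : nat -> C) (i : int) : C := if i is Posz n.+1 then x n else 0.

Lemma ext_le0 x i : i <= 0 -> ext x i = 0. Proof. by case: i => [[]|]. Qed.

Definition semi_op u v w (x : nat -> C) (n : nat) : C := jac u v w (ext x) n.+1%:Z.

(** The filler [a] is taken from the coefficient set, because membership in the family is required
    at all sites of the line. *)
Definition semi_coef (a : C) (f : nat -> C) (i : int) : C := if i is Posz n.+1 then f n else a.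

Lemma mxop_semi (A : nat -> nat -> C) l x n :
  (forall m, m \notin [:: n.-1; n; n.+1] -> A n m = 0) ->
  mxop_sub A l x n
  = (if n is m.+1 then A n m * x m else 0) + (A n n - l) * x n + A n n.+1 * x n.+1.
Proof.
move=> hA; rewrite /mxop_sub; case: n hA => [|n] hA.
- rewrite (@mxop3 _ A x 0%N [:: 0%N; 1%N]) //.
  + by rewrite !big_cons big_nil; ring.
  + by move=> j hj; apply: hA; move: hj; rewrite !inE orbA orbb.
- rewrite (@mxop3 _ A x n.+1 [:: n; n.+1; n.+2]) //.
  + by rewrite !big_cons big_nil; ring.
  + by rewrite /= !inE !negb_or; apply/and3P; split=> //; lia.
Qed.

Lemma semi_opE u v w x n : semi_op u v w x n =
  (if n is m.+1 then u n.+1%:Z * x m else 0) + v n.+1%:Z * x n + w n.+1%:Z * x n.+1.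
Proof.
rewrite /semi_op /jac; have -> : n.+1%:Z - 1 = n by lia.
have -> : n.+1%:Z + 1 = n.+2%:Z by lia.
by case: n => [|n] //=; rewrite mulr0.
Qed.

Lemma M_semiE U V W A l : U !=set0 -> V !=set0 -> W !=set0 -> M_semi U V W A ->
  exists u v w, [/\ coefs U (shift_set V l) W u v w, mxop_sub A l = semi_op u v w,
    forall n, u n.+2%:Z = A n.+1 n, forall n, v n.+1%:Z = A n n - l &
    forall n, w n.+1%:Z = A n n.+1].
Proof.
move=> [a Ua] [b Vb] [c Wc] hA.
pose u := semi_coef a (fun n => if n is m.+1 then A n m else a).
pose v := semi_coef (b - l) (fun n => A n n - l); pose w := semi_coef c (fun n => A n n.+1).
have hu n : U (A n.+1 n).
  have := hA n.+1 n; rewrite ifN; last by lia.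
  by rewrite ifN; [rewrite eqxx|lia].
have hv n : V (A n n) by have := hA n n; rewrite eqxx.
have hw n : W (A n n.+1) by have := hA n n.+1; rewrite ifN ?eqxx //; lia.
exists u, v, w; split=> //.
- move=> i; split; rewrite /u /v /w.
  + by case: i => [[|[|n]]|n] //=.
  + by case: i => [[|n]|n] /=; [exists b|exists (A n n)|exists b].
  + by case: i => [[|n]|n] //=.
- apply/funext => x; apply/funext => n; rewrite semi_opE mxop_semi.
    by rewrite /u /v /w /=; case: n.
  move=> m; rewrite !inE !negb_or => /and3P[h1 h2 h3].
  by have := hA n m; rewrite eq_sym (negbTE h2) (negbTE h3) ifN //; apply: contra h1; lia.
Qed.

Lemma M_semi_mk U V W u v w l : coefs U (shift_set V l) W u v w -> exists A,
  M_semi U V W A /\ mxop_sub A l = semi_op u v w.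
Proof.
move=> cf; pose A (i j : nat) : C := if i == j then v i.+1%:Z + l else
  if j == i.+1 then w i.+1%:Z else if i == j.+1 then u i.+1%:Z else 0.
exists A; split=> [i j|].
  rewrite /A; have [hu [v0 Vv e] hw] := cf i.+1%:Z.
  case: eqP => [_|_]; first by rewrite -e subrK.
  by case: eqP => // _; case: eqP.
apply/funext => x; apply/funext => n; rewrite semi_opE mxop_semi.
  rewrite /A eqxx addrK eqxx ifN; last by lia.
  congr (_ + _ + _); case: n => // n; rewrite ifN; last by lia.
  by rewrite ifN ?eqxx //; lia.
move=> m; rewrite !inE !negb_or => /and3P[h1 h2 h3].
by rewrite /A eq_sym (negbTE h2) (negbTE h3) ifN //; apply: contra h1; lia.
Qed.

End Matrices.

Section LineSpectrum.
Variable R : realType.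
Local Notation C := R[i].
Implicit Types (u v w x y z : int -> C) (U V W : set C).
Variable p : \bar R.
Hypothesis hp : (1%:E <= p)%E.

Lemma lpball_bdd x c : lpball p c x -> bdd x.
Proof.
by move=> h; exists c => i; exact: (lpball_coord hp i (lpball_ge0 hp 0 h) h).
Qed.

Section Invertible.
Variable F : set_system nat.
Hypothesis FU : UltraFilter F.
Hypothesis Foo : \oo `<=` F.

Lemma good_family_invertible U V W u v w : good_family F U V W ->
  coefs U V W u v w -> invertible_operator p (jac u v w).
Proof.
move=> G cf; have inj := good_inj G cf.
have [c [q [c0 q01 sol]]] := dominated_solution FU Foo G cf.
(* The inverse is chosen among bounded solutions; uniqueness there makes it linear, and the local
   estimate places it in l^p. *)
pose S y : int -> C := xget (fun=> 0) [set x | bdd x /\ forall i, jac u v w x i = y i].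
have SP y d : lpball p d y ->
    [/\ bdd (S y), forall i, jac u v w (S y) i = y i & lpball p (c * (2 / (1 - q)) * d) (S y)].
  move=> hy; have d0 := lpball_ge0 hp 0 hy.
  have [x [bx Jx dom]] := sol y (lpball_bdd hy).
  have [/= bS JS] : [set x | bdd x /\ forall i, jac u v w x i = y i] (S y).
    by apply: xgetPex; exists x.
  split=> //; suff -> : S y = x by exact: (dominated_lpball hp c0 q01 dom d0 hy).
  apply/funext => i; apply/eqP; rewrite -subr_eq0 -[x i]mul1r -mulNr; apply/eqP.
  apply: (inj (fun i => S y i + -1 * x i)); first exact: bddDZ.
  by move=> j; rewrite jacDZ JS Jx; ring.
have uniqS x y : bdd x -> bdd y -> (forall i, jac u v w x i = jac u v w y i) -> x = y.
  move=> bx by_ e; apply/funext => i; apply/eqP; rewrite -subr_eq0 -[y i]mul1r -mulNr; apply/eqP.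
  apply: (inj (fun i => x i + -1 * y i)); first exact: bddDZ.
  by move=> j; rewrite jacDZ e; ring.
have M0 : 0 <= c * (2 / (1 - q)).
  by have /andP[q0 q1] := q01; rewrite mulr_ge0 ?divr_ge0 //; lra.
exists S; split.
  apply: (bounded_operatorI hp 0 M0).
  - move=> a x y hx hy; have /lpE[d hd] := lpD hp a 0 hx hy.
    have /lpE[d1 hd1] := hx; have /lpE[d2 hd2] := hy.
    have [b1 J1 _] := SP _ _ hd; have [b2 J2 _] := SP _ _ hd1; have [b3 J3 _] := SP _ _ hd2.
    apply: uniqS => //; first by apply: bddD => //; exact: bddZ.
    by move=> i; rewrite J1 jacD jacZ J2 J3.
  - by move=> d x d0 hx; have [] := SP _ _ hx.
move=> x hx; have /lpE[d hd] := hx.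
have [bS JS _] := SP _ _ hd; split; last by apply/funext => i; rewrite JS.
have bx := lpball_bdd hd.
(* For S (J x) = x it is enough that J x is bounded, as both sides are compared among bounded
   sequences. *)
have [K hK] : exists K, forall i, nc (jac u v w x i) <= K.
  have [hu hv hw _] := G; have [b xb] := bx.
  have [K1 hK1] := ultra_closed_bounded FU Foo hu.
  have [K2 hK2] := ultra_closed_bounded FU Foo hv.
  have [K3 hK3] := ultra_closed_bounded FU Foo hw.
  exists (K1 * b + K2 * b + K3 * b) => i; have [ui vi wi] := cf i.
  apply: (le_trans (ncD _ _)); apply: lerD; first (apply: (le_trans (ncD _ _)); apply: lerD);
    by rewrite ncM; apply: ler_pM; rewrite ?nc_ge0 // ?hK1 ?hK2 ?hK3.
have [y [by_ Jy _]] := sol (jac u v w x) (ex_intro _ K hK).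
have [/= b' J'] : [set z | bdd z /\ forall i, jac u v w z i = jac u v w x i] (S (jac u v w x)).
  by apply: xgetPex; exists y.
exact: uniqS.
Qed.

End Invertible.

Lemma lp_finsupp (I : choiceType) (s : seq I) (x : I -> C) :
  (forall i, i \notin s -> x i = 0) -> exists2 c, 0 <= c & lpball p c x.
Proof.
move=> h; exists (\sum_(k <- undup s) nc (x k)); first by apply: sumr_ge0 => *; exact: nc_ge0.
have := @lpball_sum _ p hp I I (undup s) (fun k => nc (x k))
  (fun k i => if i == k then x k else 0) (fun k => nc_ge0 _) (fun k => lpball_delta hp k (x k)).
rewrite (_ : (fun i => _) = x) //; apply/funext => i.
have [si|si] := boolP (i \in s).
- rewrite (bigD1_seq i) ?undup_uniq ?mem_undup //= eqxx big1 ?addr0 // => k ki.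
  by rewrite eq_sym (negbTE ki).
- rewrite h // big_seq big1 // => k; rewrite mem_undup => ks; case: eqP => // ik.
  by move: si; rewrite ik ks.
Qed.

Lemma expr_small (q M e : R) : 0 < q < 1 -> 0 < e -> exists N0, forall N, (N0 <= N)%N -> q ^+ N * M <= e.
Proof.
move=> /andP[q0 q1] e0; set M' := `|M| + 1.
have M0 : 0 < M' by rewrite /M'; have := normr_ge0 M; lra.
have := @cvg_expr _ q; rewrite gtr0_norm // => /(_ q1) /cvgrPdist_lt /(_ (e / M')).
rewrite divr_gt0 // => /(_ isT)[N0 _ h]; exists N0 => N /h /=.
rewrite sub0r normrN ger0_norm ?exprn_ge0 ?(ltW q0) // ltr_pdivlMr // => /ltW; apply: le_trans.
apply: ler_wpM2l; first by rewrite exprn_ge0 // ltW.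
by rewrite /M'; have := ler_norm M; lra.
Qed.

(* Exponential weights make [J z] small relative to [z] pointwise, hence in
   every l^p norm; a plain linear cut-off would not do for p = 1. *)
Lemma approximate_kernel u v w x i0 (K e : R) :
  (forall i, [/\ nc (u i) <= K, nc (v i) <= K & nc (w i) <= K]) ->
  bdd x -> (forall i, jac u v w x i = 0) -> x i0 != 0 -> 0 < e ->
  exists N z, [/\ forall i, (N < `|i|)%N -> z i = 0, ~ lpball p 1 z &
    lpball p e (jac u v w z)].
Proof.
move=> hK [b xb] Jx xi0 e0.
have K0 : 0 <= K by have [h _ _] := hK 0; exact: le_trans (nc_ge0 _) h.
have b0 : 0 <= b by exact: le_trans (nc_ge0 _) (xb 0).
have [q /andP[q2 q1] hq] := @small_rate R (2 * K) (e / 4) ltac:(lra).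
have q01 : 0 < q < 1 by apply/andP; split; lra.
have q0 : 0 < q by lra.
have qn n : 0 < q ^+ n by exact: exprn_gt0.
(* A lower bound, independent of the cut-off N, for the norm of z: the site [i0] survives with
   weight at least (1/2)^|i0|. It is fixed before N is chosen. *)
set kap := (1 / 2) ^+ `|i0|%N * nc (x i0).
have kap0 : 0 < kap by rewrite mulr_gt0 ?exprn_gt0 ?nc_gt0 //; lra.
have ek0 : 0 < e * kap / 4 by rewrite divr_gt0 // mulr_gt0.
have [N0 hN0] := expr_small (12 * K * b) q01 ek0.
have [N [NN0 Ni0]] : exists N, (N0 <= N)%N /\ (`|i0| <= N.+1)%N.
  by exists (maxn N0 `|i0|%N); rewrite leq_maxl leqW // leq_maxr.
pose y j := (q ^+ `|j - 0|%N)%:C * x j.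
pose z j := if (`|j| <= N.+1)%N then y j else 0.
have yb j : nc (y j) <= b * q ^+ `|j|%N.
  by rewrite ncM nc_real gtr0_norm // subr0 mulrC; apply: ler_wpM2r => //; exact: ltW.
have zN j : (N.+1 < `|j|)%N -> z j = 0 by move=> h; rewrite /z leqNgt h.
have [d d0 zd] : exists2 c, 0 <= c & lpball p c z.
  apply: (@lp_finsupp _ (int_range N.+1)) => j; rewrite mem_int_range -ltnNge; exact: zN.
have [a [a0 za ea]] : exists c, [/\ 0 <= c, lpball p c z & lpnorm p z = c%:E].
  by apply: (lp_norm hp 0); apply/lpE; exists d.
have ka : kap <= a.
  apply: le_trans (lpball_coord hp i0 a0 za).
  rewrite /z ifT //.
  rewrite ncM nc_real gtr0_norm // subr0 ler_wpM2r ?nc_ge0 //.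
  by rewrite lerXn2r ?nnegrE //; lra.
have ap : 0 < a by lra.
(* The cut-off spoils only the four rows in [sN], each a sum of three terms of size at most K b
   q^N. *)
set eta := 3 * K * b * q ^+ N.
have eta0 : 0 <= eta by rewrite !mulr_ge0 // ltW.
pose sN : seq int := [:: N.+1%:Z; N.+2%:Z; - N.+1%:Z; - N.+2%:Z].
pose T (k i : int) : C := if i == k then eta%:C else 0.
set rho := K * (q^-1 - 1).
have rho0 : 0 <= rho by rewrite mulr_ge0 // subr_ge0 invf_ge1 //; lra.
pose G (i : int) : C := (rho * (nc (z (i - 1)) + nc (z (i + 1))))%:C + \sum_(k <- sN) T k i.
have G1 : lpball p (rho * (a + a)) (fun i => (rho * (nc (z (i - 1)) + nc (z (i + 1))))%:C).
  rewrite (_ : (fun i => _) = (fun i => rho%:C * ((nc (z (i - 1)))%:C + (nc (z (i + 1)))%:C))); last first.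
    by apply/funext => i; rewrite -rmorphD -rmorphM.
  have -> : rho * (a + a) = nc rho%:C * (a + a) by rewrite nc_real ger0_norm.
  apply: (lpballZ hp) => //; first by lra.
  apply: (lpballD hp) => //.
  - apply: (lpball_sub hp (x := z) (g := fun i => i - 1)) => //.
      by move=> j _; rewrite nc_real ger0_norm ?nc_ge0.
    by move=> j k _ _ /addIr.
  - apply: (lpball_sub hp (x := z) (g := fun i => i + 1)) => //.
      by move=> j _; rewrite nc_real ger0_norm ?nc_ge0.
    by move=> j k _ _ /addIr.
have G2 : lpball p (4 * eta) (fun i => \sum_(k <- sN) T k i).
  have -> : 4 * eta = \sum_(k <- sN) eta by rewrite !big_cons big_nil; ring.
  apply: (@lpball_sum _ p hp int int sN (fun=> eta) T) => // k.
  by have := lpball_delta hp k eta%:C; rewrite nc_real ger0_norm.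
have hG : lpball p (rho * (a + a) + 4 * eta) G.
  by apply: (lpballD hp) => //; [rewrite mulr_ge0 //; lra|rewrite mulr_ge0].
have GE i : nc (G i) = rho * (nc (z (i - 1)) + nc (z (i + 1))) + (if i \in sN then eta else 0).
  have E : \sum_(k <- sN) T k i = (if i \in sN then eta else 0)%:C.
    have us : uniq sN by rewrite /sN /= !inE; clear; lia.
    case: ifPn => si.
      rewrite (bigD1_seq i) //= /T eqxx big1 ?addr0 // => k ki.
      by rewrite eq_sym (negbTE ki).
    by rewrite big_seq big1 // => k ks; rewrite /T; case: eqP => // ik; move: si; rewrite ik ks.
  rewrite /G E -rmorphD nc_real ger0_norm //; apply: addr_ge0; last by case: ifP.
  by rewrite mulr_ge0 // addr_ge0 ?nc_ge0.
have Jz i : nc (jac u v w z i) <= nc (G i).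
  rewrite GE; have [uK vK wK] := hK i.
  have R0 : 0 <= rho * (nc (z (i - 1)) + nc (z (i + 1))) by rewrite mulr_ge0 // addr_ge0 ?nc_ge0.
  have [iN|iN] := leqP `|i|%N N.
    have -> : jac u v w z i = jac u v w y i.
      by rewrite /jac /z !ifT //; clear -iN; lia.
    have := @jac_weight _ u v w x 0 q K i q01 uK wK.
    rewrite Jx mulr0 subr0 -/(y (i - 1)) -/(y (i + 1)) -[jac _ _ _ _ _]/(jac u v w y i) => h.
    have -> : z (i - 1) = y (i - 1) by rewrite /z ifT //; clear -iN; lia.
    have -> : z (i + 1) = y (i + 1) by rewrite /z ifT //; clear -iN; lia.
    by apply: (le_trans h); rewrite lerDl; case: ifP.
  have zk k : (N <= `|k|)%N -> nc (z k) <= b * q ^+ N.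
    rewrite /z => Nk; case: ifP => _; last by rewrite nc0 mulr_ge0 // ltW.
    apply: (le_trans (yb k)); apply: ler_wpM2l => //.
    by apply: ler_wiXn2l => //; exact: ltW.
  have [iN2|iN2] := leqP `|i|%N N.+2.
    have -> : i \in sN by rewrite !inE; clear -iN iN2; lia.
    apply: (@le_trans _ _ eta); last by lra.
    have -> : eta = K * (b * q ^+ N) + K * (b * q ^+ N) + K * (b * q ^+ N) by rewrite /eta; ring.
    apply: (le_trans (ncD _ _)); apply: lerD; first (apply: (le_trans (ncD _ _)); apply: lerD);
      by rewrite ncM; apply: ler_pM; rewrite ?nc_ge0 //; apply: zk; clear -iN iN2; lia.
  have -> : jac u v w z i = 0 by rewrite /jac !zN ?mulr0 ?addr0 //; clear -iN2; lia.
  by rewrite nc0; apply: addr_ge0 => //; case: ifP.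
have Hz : lpball p (e / 2 * a) (jac u v w z).
  apply: (lpball_mono (c := rho * (a + a) + 4 * eta)).
    have -> : rho * (a + a) = (2 * K * (q^-1 - 1)) * a by rewrite /rho; ring.
    have h1 : (2 * K * (q^-1 - 1)) * a <= e / 4 * a by apply: ler_wpM2r.
    have h2 : 4 * eta <= e * kap / 4.
      have -> : 4 * eta = q ^+ N * (12 * K * b) by rewrite /eta; ring.
      exact: hN0.
    have h3 : e * kap / 4 <= e / 4 * a.
      by rewrite mulrAC; apply: ler_wpM2l => //; lra.
    lra.
  apply: (lpball_le hp) Jz hG.
  by apply: addr_ge0; [rewrite mulr_ge0 //; lra|rewrite mulr_ge0].
(* Rescaling to norm 2 puts the vector strictly outside the unit ball, while the bound e / 2 * a on
   the image becomes e. *)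
exists N.+1, (fun i => (2 / a)%:C * z i); split.
- by move=> i /zN ->; rewrite mulr0.
- move=> h; have : lpball p (nc (a / 2)%:C * 1) (fun i => (a / 2)%:C * ((2 / a)%:C * z i)).
    by apply: (lpballZ hp).
  rewrite (_ : (fun i => _) = z); last first.
    apply/funext => i; rewrite mulrA -rmorphM.
    have -> : a / 2 * (2 / a) = 1 by field; rewrite gt_eqF.
    by rewrite rmorph1 mul1r.
  rewrite /lpball ea lee_fin nc_real gtr0_norm ?divr_gt0 //; lra.
- have -> : jac u v w (fun i => (2 / a)%:C * z i) = (fun i => (2 / a)%:C * jac u v w z i).
    by apply/funext => i; rewrite jacZ.
  have -> : e = nc (2 / a)%:C * (e / 2 * a).
    by rewrite nc_real gtr0_norm ?divr_gt0 //; field; rewrite gt_eqF.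
  by apply: (lpballZ hp) => //; rewrite mulr_ge0 //; lra.
Qed.

Lemma invertible_inj u v w (K : R) :
  (forall i, [/\ nc (u i) <= K, nc (v i) <= K & nc (w i) <= K]) ->
  invertible_operator p (jac u v w) ->
  forall x, bdd x -> (forall i, jac u v w x i = 0) -> forall i, x i = 0.
Proof.
move=> hK [S [/(bounded_operatorE hp 0)[M M0 bS] inv]] x bx Jx i.
apply/eqP/negPn/negP => xi.
have e0 : 0 < (M + 1)^-1 by rewrite invr_gt0; lra.
have [N [z [zN nz hz]]] := approximate_kernel hK bx Jx xi e0.
have [d d0 zd] : exists2 c, 0 <= c & lpball p c z.
  apply: (@lp_finsupp _ (int_range N)) => j; rewrite mem_int_range -ltnNge; exact: zN.
have lz : lp p z by apply/lpE; exists d.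
apply: nz; have [<- _] := inv z lz.
apply: (lpball_mono (c := M * (M + 1)^-1)); first by rewrite ler_pdivrMr //; lra.
by apply: bS => //; exact: ltW.
Qed.

End LineSpectrum.

(** * Half-line operators *)

Section HalfLine.
Variable R : realType.
Local Notation C := R[i].
Implicit Types (u v w : int -> C) (U V W : set C).
Variable p : \bar R.
Hypothesis hp : (1%:E <= p)%E.

Definition res (z : int -> C) (n : nat) : C := z n.+1%:Z.

Lemma ext_res (z : int -> C) : (forall i, i <= 0 -> z i = 0) -> ext (res z) = z.
Proof. by move=> z0; apply/funext => -[[|n]|n] //=; rewrite z0. Qed.

Lemma lpball_ext (c : R) (x : nat -> C) : 0 <= c -> lpball p c x -> lpball p c (ext x).
Proof.
move=> c0; apply: (lpball_sub hp (g := fun i : int => `|i|%N.-1)) => //.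
- by case=> [[|n]|n] //=; rewrite eqxx.
- by case=> [[|n]|n] [[|m]|m] //=; rewrite ?eqxx // => _ _ ->.
Qed.

Lemma lpball_res (c : R) (z : int -> C) : 0 <= c -> lpball p c z -> lpball p c (res z).
Proof.
move=> c0; apply: (lpball_sub hp (g := fun n : nat => n.+1%:Z)) => //.
by move=> n m _ _ [].
Qed.

Lemma lp_ext x : lp p x -> lp p (ext x).
Proof.
by move=> /(lp_norm hp 0%N)[c [c0 hc _]]; apply/lpE; exists c; exact: lpball_ext.
Qed.

Lemma lp_res z : lp p z -> lp p (res z).
Proof. by move=> /(lp_norm hp 0)[c [c0 hc _]]; apply/lpE; exists c; exact: lpball_res. Qed.

Lemma lp_bdd z : lp p z -> bdd z.
Proof. by move=> /lpE[c hc]; exact: (lpball_bdd hp hc). Qed.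

Lemma lp_cst0 (I : choiceType) : lp p (fun _ : I => 0 : C).
Proof. by apply/lpE; exists 0; exact: lpball0. Qed.

Lemma lp_comb (I : choiceType) (i0 : I) n (c : 'I_n -> C) (b : 'I_n -> I -> C) :
  (forall k, lp p (b k)) -> lp p (fun i => \sum_(k < n) c k * b k i).
Proof.
elim: n c b => [|n IH] c b hb.
  rewrite (_ : (fun i => _) = (fun=> 0)); first exact: lp_cst0.
  by apply/funext => i; rewrite big_ord0.
rewrite (_ : (fun i => _) = (fun i => c ord0 * b ord0 i +
   \sum_(k < n) c (lift ord0 k) * b (lift ord0 k) i)).
  by apply: (lpD hp _ i0) => //; exact: (IH (fun k => c (lift ord0 k)) (fun k => b (lift ord0 k))).
by apply/funext => i; rewrite big_ord_recl.
Qed.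

Lemma semi_op_lin u v w a x y :
  semi_op u v w (fun i => a * x i + y i) = (fun i => a * semi_op u v w x i + semi_op u v w y i).
Proof. by apply/funext => n; rewrite !semi_opE; case: n => [|n]; ring. Qed.

Section Quotients.
Variable I : choiceType.
Implicit Types X Y : set (I -> C).

(** Every coordinate vector represents the zero sequence. The vectors with all entries 0 and all
    entries 1 must then coincide by uniqueness, which leaves only n = 0. *)
Lemma quotient_dim_zero X Y n : X (fun=> 0) ->
  (forall (b : 'I_n -> I -> C) (c : 'I_n -> C), (forall k, X (b k)) ->
     Y (fun i => - \sum_(k < n) c k * b k i)) ->
  quotient_dim X Y n -> n = 0%N.
Proof.
move=> X0 hY [b [Xb h]]; have [c0 [_ uc]] := h _ X0.
have e a : c0 = const_mx a.
  apply: uc; rewrite [Z in Y Z](_ : _ = fun i => - \sum_(k < n) (const_mx a : 'rV_n) ord0 k * b k i).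
    exact: hY.
  by apply/funext => i; rewrite sub0r.
case: n b Xb h c0 uc e {hY} => // n b Xb h c0 uc e.
by have := congr1 (fun m : 'rV[C]_n.+1 => m ord0 ord0) (etrans (esym (e 0)) (e 1));
   rewrite !mxE => /esym/eqP; rewrite oner_eq0.
Qed.

Lemma quotient_dim0 X Y : (forall x, X x -> Y x) -> quotient_dim X Y 0.
Proof.
move=> XY; exists (fun _ _ => 0); split=> [[]//|x Xx]; exists 0; split.
  by rewrite (_ : (fun i => _) = x); [exact: XY|apply/funext => i; rewrite big_ord0 subr0].
by move=> c _; apply/rowP => -[].
Qed.

Lemma quotient_dim1 X Y b : X b ->
  (forall x, X x -> exists a, Y (fun i => x i - a * b i)) ->
  (forall x a a', Y (fun i => x i - a * b i) -> Y (fun i => x i - a' * b i) -> a = a') ->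
  quotient_dim X Y 1.
Proof.
move=> Xb ex uq; exists (fun=> b); split=> // x Xx.
have E (c : 'rV[C]_1) : (fun i => x i - \sum_(k < 1) c ord0 k * b i) = (fun i => x i - c ord0 ord0 * b i).
  by apply/funext => i; rewrite big_ord1.
have [a ha] := ex x Xx; exists (const_mx a); split; first by rewrite E mxE.
move=> c; rewrite E => hc.
by apply/rowP => k; rewrite ord1 mxE; exact: (uq x).
Qed.
End Quotients.

Lemma kernel_trivial_dim (T : (nat -> C) -> nat -> C) m :
  (forall x, lp p x -> T x = (fun=> 0) -> x = fun=> 0) ->
  T (fun=> 0) = (fun=> 0) ->
  quotient_dim (lp_kernel p T) [set (fun=> 0)] m -> m = 0%N.
Proof.
move=> inj T0; apply: quotient_dim_zero; first by split => //; exact: lp_cst0.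
move=> b c hb; apply/funext => i; rewrite big1 ?oppr0 // => k _.
by have [lb Tb] := hb k; rewrite (inj _ lb Tb) mulr0.
Qed.

Lemma image_full_dim (T : (nat -> C) -> nat -> C) n : (forall y, lp p y -> exists2 x, lp p x & T x = y) ->
  quotient_dim (lp p) (lp_image p T) n -> n = 0%N.
Proof.
move=> surj; apply: quotient_dim_zero; first exact: lp_cst0.
move=> b c hb; have [|x lx Tx] := surj (fun i => - \sum_(k < n) c k * b k i); last by exists x.
have := lp_comb 0%N (fun k => - c k) hb.
rewrite (_ : (fun i => _) = (fun i => - \sum_(k < n) c k * b k i)) //; apply/funext => i.
by rewrite -sumrN; apply: eq_bigr => k _; rewrite mulNr.
Qed.

Lemma invertible_index (T : (nat -> C) -> nat -> C) k : invertible_operator p T ->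
  T (fun=> 0) = (fun=> 0) -> fredholm_index p T k -> k = 0.
Proof.
move=> [S [[Slp _ _] inv]] T0 [m [n [hm hn ->]]].
have S0 : S (fun=> 0) = (fun=> 0) by have [] := inv _ (lp_cst0 nat); rewrite T0.
rewrite (kernel_trivial_dim _ T0 hm); last first.
  by move=> x lx Tx; have [] := inv x lx; rewrite Tx S0.
rewrite (image_full_dim _ hn) // => y ly; exists (S y); first exact: Slp.
by have [] := inv y ly.
Qed.

Lemma invertible_fredholm (T : (nat -> C) -> nat -> C) : invertible_operator p T ->
  T (fun=> 0) = (fun=> 0) -> fredholm_index p T 0.
Proof.
move=> [S [[Slp _ _] inv]] T0.
have S0 : S (fun=> 0) = (fun=> 0) by have [] := inv _ (lp_cst0 nat); rewrite T0.
exists 0%N, 0%N; split=> //; apply: quotient_dim0 => x.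
  by move=> [lx Tx]; have [] := inv x lx; rewrite Tx S0.
by move=> lx; exists (S x); [exact: Slp|have [] := inv x lx].
Qed.

Lemma semi_op0 u v w : semi_op u v w (fun=> 0) = (fun=> 0).
Proof. by apply/funext => n; rewrite semi_opE; case: n => [|n]; rewrite !mulr0 !addr0. Qed.

Section Types.
Variable F : set_system nat.
Hypothesis FU : UltraFilter F.
Hypothesis Foo : \oo `<=` F.
Variables (U V W : set C) (u v w : int -> C).
Hypothesis G : good_family F U V W.
Hypothesis cf : coefs U V W u v w.

(** Each type uses its own source: 0 when there is no half-line kernel, -1 when there is a right
    kernel, 1 when there is a left one. The sources 0 and -1 lie off the half line, so the equation
    is solved exactly; the source 1 leaves a defect along one vector. *)
Lemma semi_solution k e : (`|k| <= 1)%N -> bdd e ->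
  (forall i, jac u v w e i = delta R k i) -> e 0 != 0 ->
  exists2 M : R, 0 <= M & forall c g, lpball p c g -> exists x a, 
    lpball p (M * c) x /\ forall n, semi_op u v w x n = g n - a * delta R k n.+1%:Z.
Proof.
move=> k1 be Je e0; have [c [q [c0 q01 sol]]] := halfline_solution FU Foo G cf k1 be Je e0.
have M0 : 0 <= c * (2 / (1 - q)).
  by have /andP[q0 q1] := q01; rewrite mulr_ge0 ?divr_ge0 //; lra.
exists (c * (2 / (1 - q))) => // d g hg; have d0 := lpball_ge0 hp 0%N hg.
have hg' := lpball_ext d0 hg.
have [x [a [bx x0 Jx dom]]] := sol _ (lpball_bdd hp hg').
exists (res x), a; split.
- by apply: lpball_res; [rewrite mulr_ge0|exact: (dominated_lpball hp c0 q01 dom d0 hg')].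
- by move=> n; rewrite /semi_op ext_res // Jx.
Qed.

Lemma semi_kernel x : bdd (ext x) -> semi_op u v w x = (fun=> 0) -> x <> (fun=> 0) ->
  rkernel u v w (ext x).
Proof.
move=> bx Tx nx; split=> //.
- exact: ext_le0.
- by move=> [[|n]|n] // _; rewrite -[LHS]/(semi_op u v w x n) Tx.
- apply: contrapT => h; apply: nx; apply/funext => n; apply/eqP/negPn/negP => xn.
  by apply: h; exists n.+1%:Z.
Qed.

(** Without half-line kernels the Green function is nonzero at site 0, so it can serve to correct
    line solutions; the missing right kernel gives injectivity. *)
Lemma semi_invertible : ~ (exists x, rkernel u v w x) -> ~ (exists x, lkernel u v w x) ->
  invertible_operator p (semi_op u v w).
Proof.
move=> nr nl; have [e [be Je]] := greenP FU Foo 0 G cf.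
have e0 : e 0 != 0 by apply/eqP => /(green_dichotomy be Je)[].
have [M M0 sol] := semi_solution (k := 0) isT be Je e0.
have inj x : lp p x -> semi_op u v w x = (fun=> 0) -> x = fun=> 0.
  move=> lx Tx; apply: contrapT => nx; apply: nr; exists (ext x).
  by apply: semi_kernel => //; apply: lp_bdd; exact: lp_ext.
have sol' c g : lpball p c g -> exists2 x, lpball p (M * c) x & semi_op u v w x = g.
  move=> /sol[x [a [hx Tx]]]; exists x => //; apply/funext => n.
  by rewrite Tx /delta (_ : (n.+1%:Z == 0) = false) // mulr0 subr0.
pose S y : nat -> C := xget (fun=> 0) [set x | lp p x /\ semi_op u v w x = y].
have uniqS x y : lp p x -> lp p y -> semi_op u v w x = semi_op u v w y -> x = y.
  move=> lx ly e1; have := inj _ (lpD hp (-1) 0%N ly lx).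
  rewrite semi_op_lin e1 => h; have := h _.
  rewrite (_ : (fun i => _ + _) = (fun=> 0)); last by apply/funext => i; ring.
  move=> /(_ erefl) h'; apply/funext => n; have := congr1 (fun f => f n) h'.
  by rewrite /= mulN1r addrC => /eqP; rewrite subr_eq0 => /eqP.
have SP c y : lpball p c y -> [/\ lp p (S y), semi_op u v w (S y) = y & lpball p (M * c) (S y)].
  move=> hy; have [x hx Tx] := sol' c y hy.
  have lx : lp p x by apply/lpE; exists (M * c).
  have [/= lS TS] : [set x | lp p x /\ semi_op u v w x = y] (S y) by apply: xgetPex; exists x.
  by split=> //; rewrite (uniqS (S y) x) // TS Tx.
exists S; split.
  apply: (bounded_operatorI hp 0%N M0).
  - move=> a x y lx ly; have /lpE[d hd] := lpD hp a 0%N lx ly.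
    have /lpE[d1 hd1] := lx; have /lpE[d2 hd2] := ly.
    have [b1 J1 _] := SP _ _ hd; have [b2 J2 _] := SP _ _ hd1; have [b3 J3 _] := SP _ _ hd2.
    apply: uniqS => //; first exact: (lpD hp a 0%N b2 b3).
    by rewrite J1 semi_op_lin J2 J3.
  - by move=> c x c0 hx; have [] := SP _ _ hx.
move=> x lx; have /lpE[d hd] := lx; have [lS TS _] := SP _ _ hd; split=> //.
suff [c hc] : exists c, lpball p c (semi_op u v w x).
  by have [l1 T1 _] := SP _ _ hc; exact: uniqS.
have [hU hV hW _] := G.
have [K1 hK1] := ultra_closed_bounded FU Foo hU.
have [K2 hK2] := ultra_closed_bounded FU Foo hV.
have [K3 hK3] := ultra_closed_bounded FU Foo hW.
have [b [b0 hb _]] := lp_norm hp 0%N lx; have hb' := lpball_ext b0 hb.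
have [u1 v1 w1] := cf 0.
have K10 : 0 <= K1 := le_trans (nc_ge0 _) (hK1 _ u1).
have K20 : 0 <= K2 := le_trans (nc_ge0 _) (hK2 _ v1).
have K30 : 0 <= K3 := le_trans (nc_ge0 _) (hK3 _ w1).
have term (f : int -> C) (K : R) (k : int) : 0 <= K -> (forall i, nc (f i) <= K) ->
    lpball p (K * b) (fun n : nat => f n.+1%:Z * ext x (n.+1%:Z + k)).
  move=> K0 hf; apply: (lpball_le hp (x := fun n : nat => K%:C * ext x (n.+1%:Z + k))).
  - by rewrite mulr_ge0.
  - move=> n; rewrite !ncM nc_real ger0_norm //; apply: ler_wpM2r => //; exact: nc_ge0.
  - have -> : K * b = nc K%:C * b by rewrite nc_real ger0_norm.
    apply: (lpballZ hp) => //; apply: (lpball_sub hp (g := fun n : nat => n.+1%:Z + k)) hb' => //.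
    by move=> n m _ _ /addIr [].
have h1 := term u K1 (-1) K10 (fun i => hK1 _ (let: And3 a _ _ := cf i in a)).
have h2 := term v K2 0 K20 (fun i => hK2 _ (let: And3 _ a _ := cf i in a)).
have h3 := term w K3 1 K30 (fun i => hK3 _ (let: And3 _ _ a := cf i in a)).
exists (K1 * b + K2 * b + K3 * b).
rewrite (_ : semi_op u v w x = (fun n => u n.+1%:Z * ext x (n.+1%:Z + -1)
   + v n.+1%:Z * ext x (n.+1%:Z + 0) + w n.+1%:Z * ext x (n.+1%:Z + 1))); last first.
  by apply/funext => n; rewrite addr0.
by do 2 (apply: (lpballD hp) => //; try by rewrite ?addr_ge0 ?mulr_ge0).
Qed.

Lemma delta0_lp k : lp p (delta R k).
Proof.
apply/lpE; exists 1; have := lpball_delta hp k (1 : C); rewrite nc1.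
by rewrite (_ : (fun i => _) = delta R k) //; apply/funext => i; rewrite /delta; case: eqP.
Qed.

Lemma green_lp k e : bdd e -> (forall i, jac u v w e i = delta R k i) -> lp p e.
Proof.
move=> be Je; have [c [q [c0 q01 sol]]] := dominated_solution FU Foo G cf.
have [x [bx Jx dom]] := sol _ (bdd_delta R k).
have -> : e = x.
  apply/funext => i; apply/eqP; rewrite -subr_eq0 -[x i]mul1r -mulNr; apply/eqP.
  apply: (good_inj G cf (x := fun i => e i + -1 * x i)); first exact: bddDZ.
  by move=> j; rewrite jacDZ Je Jx; ring.
have [d [d0 hd _]] := lp_norm hp 0 (delta0_lp k).
by apply/lpE; eexists; exact: (dominated_lpball hp c0 q01 dom d0 hd).
Qed.

Section RightKernel.
Hypothesis rk : exists u v w x, coefs U V W u v w /\ rkernel u v w x.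

(** The Green function with source 0 vanishes at 0 here. Moving the source to -1 repairs this, since
    row -1 gives w (-1) * e 0 = 1. *)
Lemma rkernel_surjective y : lp p y -> exists2 x, lp p x & semi_op u v w x = y.
Proof.
move=> /lpE[c hc]; have [e [be Je]] := greenP FU Foo (-1) G cf.
have [_ e0] := rkernel_green_supp FU Foo G rk cf be Je.
have e0' : e 0 != 0 by apply/eqP => e00; move: e0; rewrite addNr e00 mulr0 => /eqP; rewrite eq_sym oner_eq0.
have [M M0 sol] := semi_solution (k := -1) isT be Je e0'.
have [x [a [hx Tx]]] := sol _ _ hc; exists x; first by apply/lpE; exists (M * c).
by apply/funext => n; rewrite Tx /delta (_ : (n.+1%:Z == -1) = false) // mulr0 subr0.
Qed.

(** The Green function with source 0 lives on i > 0, and its restriction spans the kernel by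
    [rkernel_green]. *)
Lemma rkernel_dim1 : quotient_dim (lp_kernel p (semi_op u v w)) [set (fun=> 0)] 1.
Proof.
have [e [be Je]] := greenP FU Foo 0 G cf.
have [e0 e1] := rkernel_green_supp FU Foo G rk cf be Je.
have le := green_lp be Je.
have e1' : e 1 != 0 by apply/eqP => e00; move: e1; rewrite add0r e00 mulr0 => /eqP; rewrite eq_sym oner_eq0.
apply: (@quotient_dim1 _ _ _ (res e)).
- split; first exact: lp_res.
  apply/funext => n; rewrite /semi_op ext_res // Je /delta.
- move=> x [lx Tx]; have [->|nx] := pselect (x = fun=> 0).
    by exists 0; apply/funext => i; rewrite mul0r subr0.
  have kx := semi_kernel (lp_bdd (lp_ext lx)) Tx nx.
  have E := rkernel_green (good_inj G cf) be Je kx.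
  by exists (w 0 * ext x 1); apply/funext => n; rewrite -[x n]/(ext x n.+1%:Z) E subrr.
- move=> x a a' h h'; have := congr1 (fun f => f 0%N) (etrans h (esym h')).
  move=> /= /addrI /oppr_inj; rewrite /res; exact: mulIf.
Qed.

Lemma rkernel_fredholm : fredholm_index p (semi_op u v w) 1.
Proof.
exists 1%N, 0%N; split=> //; first exact: rkernel_dim1.
apply: quotient_dim0 => y ly; have [x lx Tx] := rkernel_surjective ly; by exists x.
Qed.

End RightKernel.

Section LeftKernel.
Hypothesis lk : exists u v w x, coefs U V W u v w /\ lkernel u v w x.

Lemma lkernel_injective x : lp p x -> semi_op u v w x = (fun=> 0) -> x = fun=> 0.
Proof.
move=> lx Tx; apply: contrapT => nx; have [_ _ _ inj] := G.
have [u0 [v0 [w0 [y [cf0 ky]]]]] := lk.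
exact: (coburn inj cf cf0 (semi_kernel (lp_bdd (lp_ext lx)) Tx nx) ky).
Qed.

(** With source 1 every equation is solvable modulo delta_1. That delta_1 itself is not in the
    image: the extension of a preimage would combine the Green functions [e] and [f] with sources 1
    and 0, and both vanish on i > 0. *)
Lemma lkernel_codim1 : quotient_dim (lp p) (lp_image p (semi_op u v w)) 1.
Proof.
have [e [be Je]] := greenP FU Foo 1 G cf.
have [e0 e1] := lkernel_green_supp FU Foo G lk cf be Je.
have [f [bf Jf]] := greenP FU Foo 0 G cf.
have [f0 _] := lkernel_green_supp FU Foo G lk cf bf Jf.
have e0' : e 0 != 0 by apply/eqP => e00; move: e1; rewrite subrr e00 mulr0 => /eqP; rewrite eq_sym oner_eq0.
have [M M0 sol] := semi_solution (k := 1) isT be Je e0'.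
pose b : nat -> C := res (delta R 1).
have lb : lp p b by apply: lp_res; exact: delta0_lp.
have nb x : lp p x -> semi_op u v w x <> b.
  move=> lx Tx; have bx := lp_bdd (lp_ext lx).
  have E i : ext x i = e i + w 0 * ext x 1 * f i.
    have h : ext x i + -1 * e i + - (w 0 * ext x 1) * f i = 0.
      apply: (good_inj G cf (x := fun i => ext x i + -1 * e i + - (w 0 * ext x 1) * f i)).
        by apply: bddDZ => //; exact: bddDZ.
      move=> j; rewrite !jacDZ Je Jf; case: j => [[|n]|n].
      - by rewrite /jac /= /delta /=; ring.
      - by rewrite -[jac u v w (ext x) _]/(semi_op u v w x n) Tx /b /res /delta /=; ring.
      - have -> : jac u v w (ext x) (Negz n) = 0 by rewrite /jac !ext_le0 ?mulr0 ?addr0 //; lia.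
        by rewrite /delta /=; ring.
    by apply/eqP; rewrite -subr_eq0 -[X in _ == X]h; apply/eqP; ring.
  have x0 : x = (fun=> 0).
    by apply/funext => n; rewrite -[x n]/(ext x n.+1%:Z) E e0 ?f0 ?mulr0 ?addr0 //; lia.
  move: Tx; rewrite x0 semi_op0 => /(congr1 (fun f => f 0%N)) /eqP.
  by rewrite /b /res /delta /= eq_sym oner_eq0.
apply: (@quotient_dim1 _ _ _ b) => //.
- move=> y /lpE[c hc]; have [x [a [hx Tx]]] := sol _ _ hc.
  exists a; exists x; first by apply/lpE; exists (M * c).
  by apply/funext => n; rewrite Tx.
- move=> x a a' [y ly Ty] [y' ly' Ty']; apply/eqP/negPn/negP => aa.
  have d0 : a' - a != 0 by rewrite subr_eq0 eq_sym.
  pose z i := (a' - a)^-1 * y i + (- (a' - a)^-1 * y' i + 0).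
  have ly2 : lp p (fun i => - (a' - a)^-1 * y' i + 0) by apply: (lpD hp _ 0%N) => //; exact: lp_cst0.
  apply: (nb z); first exact: (lpD hp _ 0%N).
  rewrite /z semi_op_lin semi_op_lin Ty Ty' semi_op0; apply/funext => n.
  by field.
Qed.

Lemma lkernel_fredholm : fredholm_index p (semi_op u v w) (-1).
Proof.
exists 0%N, 1%N; split=> //; last exact: lkernel_codim1.
by apply: quotient_dim0 => x [lx Tx]; exact: lkernel_injective.
Qed.

End LeftKernel.
End Types.
End HalfLine.

(** * Fredholm operators and limit operators *)

Section Fredholm.
Variable R : realType.
Local Notation C := R[i].
Implicit Types (u v w x z : int -> C).
Variable p : \bar R.
Hypothesis hp : (1%:E <= p)%E.

Definition coef_bound (K : R) u v w :=
  forall i, [/\ nc (u i) <= K, nc (v i) <= K & nc (w i) <= K].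

(** The primed operator is a limit operator at +oo of the other one. The lower bound [K] on the
    position lets windows be chosen beyond any given site. *)
Definition windowed u v w u' v' w' := forall (N : nat) (e : R), 0 < e ->
  forall K : nat, exists k : nat, (K <= k)%N /\ forall j : int, (`|j| <= N)%N ->
  [/\ nc (u (j + k%:Z) - u' j) <= e, nc (v (j + k%:Z) - v' j) <= e &
      nc (w (j + k%:Z) - w' j) <= e].

Lemma hump (K : R) u v w u' v' w' x i0 : coef_bound K u' v' w' ->
  windowed u v w u' v' w' -> bdd x -> (forall i, jac u' v' w' x i = 0) -> x i0 != 0 ->
  forall (M : nat) (e : R), 0 < e -> exists (M' : nat) z,
  [/\ forall i, z i != 0 -> M%:Z < i /\ i < M'%:Z, ~ lpball p 1 z & lpball p e (jac u v w z)].
Proof.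
move=> hK win bx Jx xi0 M e e0.
have e2 : 0 < e / 2 by lra.
have [N [z0 [z0N nz0 hz0]]] := approximate_kernel hp hK bx Jx xi0 e2.
have [d d0 zd] : exists2 c, 0 <= c & lpball p c z0.
  apply: (@lp_finsupp _ _ hp _ (int_range N)) => j; rewrite mem_int_range -ltnNge; exact: z0N.
(* Coefficient errors [del] on three diagonals cost 3 * del * d, at most e / 2; the other half is
   the error of [z0]. *)
pose del := e / (6 * (d + 1)).
have del0 : 0 < del by rewrite divr_gt0 // mulr_gt0 //; lra.
(* The image of [z0] reaches one site beyond its support, hence radius N + 1; the centre lies so far
   out that the transplanted support starts after [M]. *)
have [k [Mk hk]] := win N.+1 del del0 (M + N).+1.
pose z j := z0 (j - k%:Z); exists (k + N).+1, z; split.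
- move=> i; rewrite /z => h; have : (`|(i - k%:Z)%R| <= N)%N.
    by rewrite leqNgt; apply: contra h => /z0N ->.
  by clear -Mk; lia.
- move=> h; apply: nz0; apply: (lpball_sub hp (x := z) (g := fun j => j + k%:Z)) h => //.
    by move=> j _; rewrite /z addrK.
  by move=> j l _ _ /addIr.
- pose H i := (nc (jac u' v' w' z0 i))%:C + (del * (nc (z0 (i - 1)) + nc (z0 i) + nc (z0 (i + 1))))%:C.
  have sh l : lpball p d (fun i : int => (nc (z0 (i + l)))%:C).
    apply: (lpball_sub hp (x := z0) (g := fun i => i + l)) => //.
      by move=> j _; rewrite nc_real ger0_norm ?nc_ge0.
    by move=> j l' _ _ /addIr.
  have hH : lpball p (e / 2 + del * (d + d + d)) H.
    apply: (lpballD hp).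
    + by lra.
    + by rewrite mulr_ge0 ?(ltW del0) //; lra.
    + apply: (lpball_le hp) hz0; first by lra.
      by move=> i; rewrite nc_real ger0_norm ?nc_ge0.
    + rewrite (_ : (fun i : int => _) = (fun i =>
        del%:C * ((nc (z0 (i + -1)))%:C + (nc (z0 (i + 0)))%:C + (nc (z0 (i + 1)))%:C))); last first.
        by apply/funext => i; rewrite -!rmorphD -rmorphM addr0.
      have -> : del * (d + d + d) = nc del%:C * (d + d + d) by rewrite nc_real gtr0_norm.
      apply: (lpballZ hp); first by lra.
      by apply: (lpballD hp); [lra|lra|apply: (lpballD hp) => //|].
  have He : e / 2 + del * (d + d + d) <= e.
    have : del * (d + d + d) <= e / 2; last by lra.
    rewrite /del mulrAC ler_pdivrMr; last by lra.
    have : 0 <= e * d by rewrite mulr_ge0 // ltW.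
    lra.
  apply: (lpball_mono He).
  apply: (lpball_sub hp (x := H) (g := fun j => j - k%:Z)) hH.
  + by apply: addr_ge0; [lra|rewrite mulr_ge0 ?(ltW del0) //; lra].
  + move=> j _; set i := j - k%:Z.
    have -> : jac u v w z j =
        jac (fun l => u (l + k%:Z)) (fun l => v (l + k%:Z)) (fun l => w (l + k%:Z)) z0 i.
      rewrite /i -[in LHS](subrK k%:Z j) -jac_shift; congr (jac _ _ _ _ _).
      by apply/funext => l; rewrite /z addrK.
    have P0 : 0 <= del * (nc (z0 (i - 1)) + nc (z0 i) + nc (z0 (i + 1))).
      by rewrite mulr_ge0 ?(ltW del0) // !addr_ge0 ?nc_ge0.
    rewrite /H -rmorphD nc_real ger0_norm ?addr_ge0 ?nc_ge0 //.
    have [iN|iN] := leqP `|i|%N N.+1; last first.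
      have J0 b1 b2 b3 : jac b1 b2 b3 z0 i = 0.
        by rewrite /jac !z0N ?mulr0 ?addr0 //; clear -iN; lia.
      by rewrite !J0 nc0 add0r.
    have [h1 h2 h3] := hk i iN.
    set A := jac _ _ _ _ _; set A' := jac u' v' w' z0 i.
    have -> : A = A' + ((u (i + k%:Z) - u' i) * z0 (i - 1) + (v (i + k%:Z) - v' i) * z0 i
                       + (w (i + k%:Z) - w' i) * z0 (i + 1)) by rewrite /A /A' /jac; ring.
    apply: (le_trans (ncD _ _)); apply: lerD => //; rewrite 2!mulrDr.
    apply: (le_trans (ncD _ _)); apply: lerD; first (apply: (le_trans (ncD _ _)); apply: lerD);
      by rewrite ncM; apply: ler_wpM2r; rewrite ?nc_ge0.
  + by move=> j l _ _ /addIr.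
Qed.

Lemma left_null_vector d D (A : 'M[C]_(D, d)) : (d < D)%N ->
  exists a : 'rV_D, [/\ a *m A = 0, forall i, nc (a 0 i) <= 1 & exists i, nc (a 0 i) = 1].
Proof.
move=> dD; have /rowV0Pn[a aA a0] : kermx A != 0.
  by rewrite -mxrank_eq0 mxrank_ker subn_eq0 -ltnNge (leq_ltn_trans (rank_leq_col A)).
have [i1 ai1] : exists i, a 0 i != 0.
  apply: contrapT => h; move/eqP: a0; apply; apply/rowP => i; rewrite mxE.
  by apply/eqP/negPn/negP => h'; apply: h; exists i.
have [i0 _ hmax] := @Order.TotalTheory.arg_maxP _ _ _ i1 xpredT (fun i => nc (a 0 i)) isT.
have m0 : 0 < nc (a 0 i0).
  by apply: lt_le_trans (hmax i1 isT); rewrite nc_gt0.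
exists ((a 0 i0)^-1 *: a); split.
- by rewrite -scalemxAl (sub_kermxP aA) scaler0.
- by move=> i; rewrite mxE ncM ncV mulrC ler_pdivrMr // mul1r; exact: hmax.
- by exists i0; rewrite mxE ncM ncV mulVf // gt_eqF.
Qed.

Lemma geometric_half M : \sum_(0 <= k < M) (1 / 2 : R) ^+ k <= 2.
Proof.
rewrite big_mkord.
have h := subrX1 (1 / 2 : R) M.
have : 0 <= (1 / 2 : R) ^+ M by rewrite exprn_ge0 //; lra.
lra.
Qed.

Section HumpSequence.
Variables (u v w : int -> C) (s : nat -> nat) (z : nat -> int -> C).
Hypothesis s_lt : forall k, (s k < s k.+1)%N.
Hypothesis z_supp : forall k i, z k i != 0 -> (s k)%:Z < i /\ i < (s k.+1)%:Z.
Hypothesis z_big : forall k, ~ lpball p 1 (z k).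
Hypothesis z_jac : forall k, lpball p ((1 / 4) ^+ k) (jac u v w (z k)).

(** Locally finite: z k lives to the right of s k >= k, so the terms with k >= |j| vanish at j and
    any longer cut-off gives the same value. *)
Definition superpose (a : nat -> C) (j : int) : C :=
  \sum_(0 <= k < `|j|%N.+2) a k * z k j.

Lemma s_mono k l : (k <= l)%N -> (s k <= s l)%N.
Proof. by move/subnK <-; elim: (l - k)%N => // n IH; rewrite addSn (leq_trans IH) // ltnW. Qed.

Lemma s_ge k : (k <= s k)%N.
Proof. by elim: k => // k IH; exact: leq_ltn_trans IH (s_lt k). Qed.

Lemma superposeE a j M : (`|j| <= M)%N -> superpose a j = \sum_(0 <= k < M) a k * z k j.
Proof.
have tail n1 n2 : (`|j| <= n1 <= n2)%N ->
    \sum_(0 <= k < n2) a k * z k j = \sum_(0 <= k < n1) a k * z k j.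
  move=> /andP[jn n12]; rewrite (big_cat_nat _ n12) //= [X in _ + X]big_nat_cond.
  rewrite [X in _ + X]big1 ?addr0 // => k /andP[/andP[nk _] _].
  apply/eqP; rewrite mulf_eq0 orbC; apply/orP; left.
  apply/negPn/negP => /z_supp[h _]; have := s_ge k; clear -h jn nk; lia.
move=> jM; rewrite /superpose (tail `|j|%N M) ?jM ?leqnn //.
by apply: tail; rewrite leqnn /= ltnW.
Qed.

Lemma superpose_jac a j M : (`|j|.+1 <= M)%N ->
  jac u v w (superpose a) j = \sum_(0 <= k < M) a k * jac u v w (z k) j.
Proof.
move=> jM; rewrite /jac !(@superposeE a _ M); [|clear -jM; lia..].
rewrite !mulr_sumr -!big_split /=; apply: eq_bigr => k _; ring.
Qed.

(** Amplitudes 2^k against errors 4^-k leave a geometric series with sum at most 2. The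
    superposition itself may grow. *)
Lemma superpose_lp a : (forall k, nc (a k) <= 2 ^+ k) -> lpball p 2 (jac u v w (superpose a)).
Proof.
move=> ha; apply: (lpball_fatou hp) => // t.
pose M := (\max_(j <- t) `|j|%N).+1.
have h : lpball p 2 (fun j => \sum_(0 <= k < M) a k * jac u v w (z k) j).
  apply: (lpball_mono (geometric_half M)).
  apply: (@lpball_sum _ p hp int nat (index_iota 0 M) (fun k => (1 / 2) ^+ k)
    (fun k j => a k * jac u v w (z k) j)) => k; first by rewrite exprn_ge0 //; lra.
  have q0 : 0 <= (1 / 4 : R) ^+ k by rewrite exprn_ge0 //; lra.
  apply: (lpball_mono _ (lpballZ hp (a k) q0 (z_jac k))).
  have -> : (1 / 2 : R) ^+ k = 2 ^+ k * (1 / 4) ^+ k by rewrite -exprMn; congr (_ ^+ _); field.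
  by apply: ler_wpM2r.
apply: (lpball_le hp) h => // j; case: ifPn => jt; last by rewrite nc0 nc_ge0.
rewrite (@superpose_jac a j M) //.
by rewrite /M ltnS; apply: (@leq_bigmax_seq _ t xpredT (fun j => `|j|%N)).
Qed.

Lemma superpose_block a k j : z k j != 0 -> superpose a j = a k * z k j.
Proof.
move=> zkj; have [sk ks] := z_supp zkj.
rewrite (@superposeE a j (maxn `|j|%N k.+1)); last exact: leq_maxl.
rewrite big_mkord.
have kM : (k < maxn `|j|%N k.+1)%N by rewrite leq_maxr.
rewrite (bigD1 (Ordinal kM)) //= big1 ?addr0 // => l lk.
apply/eqP; rewrite mulf_eq0 orbC; apply/orP; left; apply/negPn/negP => /z_supp[sl ls].
have [h|h|h] := ltngtP l k.
- by have := s_mono h; clear -ls sk; lia.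
- by have := s_mono h; clear -sl ks; lia.
- by move: lk; rewrite -(inj_eq val_inj) /= h eqxx.
Qed.

Lemma superpose_le0 a j : j <= 0 -> superpose a j = 0.
Proof.
move=> j0; rewrite /superpose big1_seq // => k _; apply/eqP; rewrite mulf_eq0 orbC; apply/orP; left.
by apply/negPn/negP => /z_supp[h _]; move: h; clear -j0; lia.
Qed.

(* Superpositions with coefficients growing like 2^k are mapped into l^p. If
   there are enough of them, some combination differs from the image of an l^p
   sequence by a formal null vector [zeta] that vanishes at two neighbouring
   sites; truncating [zeta] there gives elements of the finite-dimensional
   kernel, so a further combination vanishes up to that point. *)
Lemma no_hump_sequence k0 : ~ fredholm_index p (semi_op u v w) k0.
Proof.
move=> [m [n [[bk [kb uk]] [bi [lbi ui]] _]]].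
(* Within a group, n + 3 unknowns face n cokernel coefficients and two zero conditions, at sites N
   and N + 1. Across groups, m + 1 unknowns face a kernel of dimension m. *)
pose T := ('I_m.+1 * 'I_n.+3)%type; pose D := #|{: T}|.
have D0 : (0 < D)%N by apply/card_gt0P; exists (ord0, ord0).
pose rk (t : T) : nat := enum_rank t.
have rkD t : (rk t < D)%N by rewrite /rk ltn_ord.
(* Distinct superpositions use humps from distinct residue classes, so on any single hump at most
   one of them is nonzero. *)
pose a (t : T) (k : nat) : C := if (k %% D == rk t)%N then ((2 : R) ^+ k)%:C else 0.
have p2 k : 0 <= (2 : R) ^+ k by exact: exprn_ge0.
have ha t k : nc (a t k) <= 2 ^+ k.
  by rewrite /a; case: ifP => _; rewrite ?nc0 // nc_real ger0_norm.
have /choice[r hr] t : exists r : 'rV[C]_n * R * (nat -> C),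
    [/\ 0 <= r.1.2, lpball p r.1.2 r.2 & forall i, semi_op u v w r.2 i =
      jac u v w (superpose (a t)) i.+1%:Z - \sum_(k < n) r.1.1 ord0 k * bi k i].
  have hy := lpball_res hp (ler0n _ 2) (superpose_lp (ha t)).
  have ly : lp p (res (jac u v w (superpose (a t)))) by apply/lpE; exists 2.
  have [c [[y ly' Ty] _]] := ui _ ly.
  have [X [X0 hX _]] := lp_norm hp 0%N ly'.
  by exists (c, X, y); split=> // i; rewrite /= Ty.
pose c t := (r t).1.1; pose xs t := (r t).2; pose Xb t := (r t).1.2.
pose zeta t j := superpose (a t) j + -1 * ext (xs t) j.
have zeta0 t j : j <= 0 -> zeta t j = 0.
  by move=> j0; rewrite /zeta superpose_le0 // ext_le0 // mulr0 addr0.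
have Jzeta t (i : nat) : jac u v w (zeta t) i.+1%:Z = \sum_(k < n) c t ord0 k * bi k i.
  rewrite /zeta jacDZ -[jac u v w (ext _) _]/(semi_op u v w (xs t) i).
  by have [_ _ ->] := hr t; ring.
pose Xtot := \sum_t Xb t.
have Xtot0 : 0 <= Xtot by apply: sumr_ge0 => t _; have [] := hr t.
(* [kk t] is a hump of superposition t whose amplitude 2^(kk t) exceeds the total norm [Xtot] of the
   l^p corrections; [N] lies beyond all these humps. *)
pose M0 := (Num.trunc Xtot).+1.
pose N := s (D * M0.+1)%N; pose kk t := (D * M0 + rk t)%N.
have kkmod t : (kk t %% D)%N = rk t by rewrite /kk mulnC modnMDl modn_small.
have kkX t : Xtot <= 2 ^+ kk t.
  apply: (@le_trans _ _ M0%:R); first by apply: ltW; exact: truncnS_gt.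
  apply: (@le_trans _ _ (kk t)%:R).
    by rewrite ler_nat /kk (leq_trans _ (leq_addr _ _)) // leq_pmull.
  by rewrite -natrX ler_nat ltnW // ltn_expl.
have kkN t : (s (kk t).+1 <= N)%N.
  by apply: s_mono; rewrite /kk mulnS addnC ltn_add2r.
have N0 : (0 < N)%N by apply: leq_trans (s_ge _); rewrite muln_gt0 D0.
have /choice[al hal] (g : 'I_m.+1) : exists al : 'rV[C]_n.+3,
    [/\ forall i, \sum_tau al 0 tau * (\sum_(k < n) c (g, tau) ord0 k * bi k i) = 0,
      \sum_tau al 0 tau * zeta (g, tau) N%:Z = 0 /\
      \sum_tau al 0 tau * zeta (g, tau) N.+1%:Z = 0,
      forall i, nc (al 0 i) <= 1 & exists i, nc (al 0 i) = 1].
  have [|al [h h1 h2]] := @left_null_vector (n + (1 + 1)) n.+3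
    (row_mx (\matrix_(tau, k) c (g, tau) ord0 k)
      (row_mx (\col_tau zeta (g, tau) N%:Z) (\col_tau zeta (g, tau) N.+1%:Z))).
    by clear; lia.
  exists al; move/eqP: h; rewrite !mul_mx_row !row_mx_eq0 => /and3P[/eqP e1 /eqP e2 /eqP e3].
  split=> //; last first.
    split.
    - by have := congr1 (fun M : 'M[C]_(1, 1) => M 0 0) e2; rewrite !mxE; under eq_bigr do rewrite mxE.
    - by have := congr1 (fun M : 'M[C]_(1, 1) => M 0 0) e3; rewrite !mxE; under eq_bigr do rewrite mxE.
  move=> i; under eq_bigr do rewrite mulr_sumr; rewrite exchange_big /= big1 // => k _.
  have := congr1 (fun M : 'M[C]_(1, n) => M 0 k) e1; rewrite !mxE => e.
  under eq_bigr do rewrite mulrA; rewrite -mulr_suml.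
  by under eq_bigr do rewrite -[c _ _ _](mxE matrix_key (fun tau k => c (g, tau) ord0 k)); rewrite e mul0r.
pose Sg g j := \sum_tau al g 0 tau * zeta (g, tau) j.
have Sg0 g j : j <= 0 -> Sg g j = 0.
  by move=> j0; rewrite /Sg big1 // => tau _; rewrite zeta0 // mulr0.
have JSg g (i : nat) : jac u v w (Sg g) i.+1%:Z = 0.
  have [/(_ i) <- _ _ _] := hal g; rewrite /jac /Sg !mulr_sumr -!big_split /=.
  by apply: eq_bigr => tau _; rewrite -Jzeta /jac; ring.
pose kap g (i : nat) : C := if (i < N)%N then Sg g i.+1%:Z else 0.
have extkap g j : ext (kap g) j = if j <= N%:Z then Sg g j else 0.
  have [j0|] := lerP j 0; first by rewrite ext_le0 // Sg0 // if_same.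
  by case: j => [[|j]|j].
have kerk g : lp_kernel p (semi_op u v w) (kap g).
  split.
    have [|d d0 hd] := @lp_finsupp _ p hp _ (iota 0 N) (kap g).
      by move=> i; rewrite mem_iota /= add0n /kap => /negbTE ->.
    by apply/lpE; exists d.
  have [_ [SN SN1] _ _] := hal g.
  apply/funext => i; rewrite /semi_op; have [iN|iN] := ltnP i N.
    rewrite -(JSg g i) /jac !extkap.
    have -> : (i.+1%:Z - 1 <= N%:Z) by clear -iN; lia.
    have -> : (i.+1%:Z <= N%:Z) by clear -iN; lia.
    congr (_ + _ * _); case: ifPn => // h.
    by rewrite (_ : i.+1%:Z + 1 = N.+1%:Z) ?[RHS]SN1 //; clear -iN h; lia.
  rewrite /jac !extkap.
  have -> : (i.+1%:Z <= N%:Z) = false by clear -iN; lia.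
  have -> : (i.+1%:Z + 1 <= N%:Z) = false by clear -iN; lia.
  rewrite !mulr0 !addr0; case: ifPn => h; last by rewrite mulr0.
  by rewrite (_ : i.+1%:Z - 1 = N%:Z) ?[Sg _ _]SN ?mulr0 //; clear -iN h; lia.
have /choice[ga hga] g : exists ga : 'rV[C]_m, forall i, kap g i = \sum_(k < m) ga ord0 k * bk k i.
  have [ga [h _]] := uk _ (kerk g); exists ga => i.
  by have := congr1 (fun f => f i) h; move/eqP; rewrite subr_eq0 => /eqP.
have [be [hbe be1 [g0 beg]]] := @left_null_vector m m.+1 (\matrix_(g, k) ga g ord0 k) (ltnSn m).
have [_ _ _ [tau0 altau]] := hal g0.
pose om (t : T) := be 0 t.1 * al t.1 0 t.2.
have om1 t : nc (om t) <= 1.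
  rewrite ncM -[1]mulr1; apply: ler_pM; rewrite ?nc_ge0 //.
  by have [_ _ h _] := hal t.1.
have sum0 j : 0 < j -> j <= N%:Z -> \sum_t om t * zeta t j = 0.
  case: j => [[|i]|//] // _ iN.
  have E : \sum_g be 0 g * kap g i = 0.
    under eq_bigr do rewrite hga mulr_sumr; rewrite exchange_big /= big1 // => k _.
    have := congr1 (fun M : 'M[C]_(1, m) => M 0 k) hbe; rewrite !mxE => e.
    under eq_bigr do rewrite mulrA; rewrite -mulr_suml.
    by under eq_bigr do rewrite -[ga _ _ _](mxE matrix_key (fun g k => ga g ord0 k)); rewrite e mul0r.
  have -> : \sum_t om t * zeta t i.+1%:Z = \sum_g \sum_tau om (g, tau) * zeta (g, tau) i.+1%:Z.
    by rewrite pair_bigA; apply: eq_bigr => -[].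
  rewrite -[RHS]E.
  apply: eq_bigr => g _; rewrite /kap ifT // /Sg mulr_sumr.
  by apply: eq_bigr => tau _; rewrite /om /= mulrA.
pose t0 : T := (g0, tau0); pose k := kk t0.
have omt0 : nc (om t0) = 1 by rewrite ncM /= beg altau mulr1.
pose Y j := \sum_t om t * ext (xs t) j.
have hY : lpball p Xtot Y.
  apply: (@lpball_sum _ p hp int T (index_enum T) Xb (fun t j => om t * ext (xs t) j)) => t.
    by have [] := hr t.
  have [X0 hX _] := hr t.
  apply: (lpball_mono _ (lpballZ hp (om t) X0 (lpball_ext hp X0 hX))).
  by rewrite ler_piMl.
apply: (z_big (k := k)).
have q0 : 0 < (2 : R) ^+ k by exact: exprn_gt0.
(* Up to site N the combination of the zetas vanishes, so the l^p sequence [Y] equals the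
   combination of superpositions. On hump k only t0 contributes, with coefficient of modulus 1. Thus
   z k has norm at most Xtot / 2^k, which is at most 1. *)
have hz : lpball p Xtot (fun j => ((2 : R) ^+ k)%:C * z k j).
  apply: (lpball_sub hp (x := Y) (g := id)) => // j.
  rewrite mulf_eq0 negb_or => /andP[_ zkj].
  have [sk ks] := z_supp zkj.
  have jN : j <= N%:Z by have := kkN t0; rewrite -/k; clear -ks; lia.
  have j0 : 0 < j by clear -sk; lia.
  have := sum0 j j0 jN; rewrite /zeta; under eq_bigr do rewrite mulrDr.
  rewrite big_split /= => /eqP; rewrite addr_eq0 => /eqP e.
  have -> : Y j = \sum_t om t * superpose (a t) j.
    by rewrite e -sumrN; apply: eq_bigr => t _; ring.
  rewrite (bigD1 t0) //= big1 ?addr0 => [|t tt0]; last first.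
    rewrite (superpose_block _ zkj) /a kkmod ifN ?mul0r ?mulr0 //.
    by apply: contra tt0 => /eqP /val_inj /enum_rank_inj ->.
  by rewrite (superpose_block _ zkj) /a kkmod eqxx [leRHS]ncM omt0 mul1r.
have := lpballZ hp (((2 : R) ^+ k)^-1)%:C Xtot0 hz.
rewrite (_ : (fun j => _) = z k); last first.
  apply/funext => j; rewrite mulrA -rmorphM mulVf ?gt_eqF //.
  by rewrite rmorph1 mul1r.
apply: lpball_mono; rewrite nc_real gtr0_norm ?invr_gt0 // ler_pdivrMl // mulr1; exact: kkX.
Qed.

End HumpSequence.

Lemma fredholm_windowed_inj (K : R) u v w u' v' w' k0 : coef_bound K u' v' w' ->
  windowed u v w u' v' w' -> fredholm_index p (semi_op u v w) k0 ->
  forall x, bdd x -> (forall i, jac u' v' w' x i = 0) -> forall i, x i = 0.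
Proof.
move=> hK win fr x bx Jx i; apply/eqP/negPn/negP => xi.
have e0 k : 0 < (1 / 4 : R) ^+ k by rewrite exprn_gt0 //; lra.
have /choice[f hf] (t : nat * nat) : exists r : nat * (int -> C),
    [/\ forall i, r.2 i != 0 -> t.1%:Z < i /\ i < r.1%:Z, ~ lpball p 1 r.2 &
      lpball p ((1 / 4) ^+ t.2) (jac u v w r.2)].
  by have [M' [z h]] := hump hK win bx Jx xi t.1 (e0 t.2); exists (M', z).
pose s := fix s k := if k is k'.+1 then maxn (f (s k', k')).1 (s k').+1 else 0%N.
pose z k := (f (s k, k)).2.
apply: (@no_hump_sequence u v w s z _ _ _ _ k0) => //.
- by move=> k; rewrite /= leq_maxr.
- move=> k j; have [h _ _] := hf (s k, k) => /h[/= h1 h2]; split=> //.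
  by apply: (lt_le_trans h2); rewrite lez_nat leq_maxl.
- by move=> k; have [] := hf (s k, k).
- by move=> k; have [] := hf (s k, k).
Qed.

End Fredholm.

(** * Pseudoergodic matrices and spectra *)

Section Windows.
Variable R : realType.
Local Notation C := R[i].
Implicit Types (u v w : int -> C) (U V W : set C).

Lemma mx_norm_entry n (A : 'M[C]_n) i j : nc (A i j) <= complex.Re `|A|.
Proof.
suff : `|A i j| <= `|A| by rewrite normr_nc lecE => /andP[].
rewrite [leRHS]/Num.norm /= mx_normE -[leLHS]nngE num_le.
exact: (@le_bigmax _ _ _ 0%:nng (fun ij : 'I_n * 'I_n => `|A ij.1 ij.2|%:nng) (i, j)).
Qed.

(** Pseudoergodicity does not say where a block occurs. The window is therefore placed at the end of
    a block padded by [K] extra rows, so that wherever the block is found, its centre is at least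
    [K]. *)
Lemma PE_windowed U V W A l u v w u' v' w' : PE_semi U V W A ->
  (forall n, u n.+2%:Z = A n.+1 n) -> (forall n, v n.+1%:Z = A n n - l) ->
  (forall n, w n.+1%:Z = A n n.+1) ->
  coefs U (shift_set V l) W u' v' w' -> windowed u v w u' v' w'.
Proof.
move=> [_ PE] hu hv hw cf N e e0 K.
pose n := (K + N.*2 + 3)%N; pose off := (N.+1 + K)%N.
pose B : 'M[C]_n := \matrix_(r, s) if r == s then v' (r%:Z - off%:Z) + l else
  if s == r.+1 :> nat then w' (r%:Z - off%:Z) else
  if r == s.+1 :> nat then u' (r%:Z - off%:Z) else 0.
have MB : M_fin U V W B.
  move=> r s; rewrite mxE; have [h1 [v0 Vv ev] h3] := cf (r%:Z - off%:Z).
  case: eqP => [_|_]; first by rewrite -ev subrK.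
  by case: eqP => // _; case: eqP.
have n0 : (0 < n)%N by rewrite /n addn3.
have [k hk] := PE n n0 B MB e e0.
have ent r s : nc (B r s - A (k + r)%N (k + s)%N) <= e.
  have := mx_norm_entry (B - \matrix_(i < n, j < n) A (k + i)%N (k + j)%N) r s.
  rewrite !mxE => /le_trans; apply; apply: ltW.
  by move: hk; rewrite ltcE /= => /andP[_].
exists (k + N + 2 + K)%N; split; first by rewrite leq_addl.
move=> j jN.
pose r := `|(j + off%:Z)%R|%N.
have er : r%:Z = j + off%:Z by rewrite /r /off; clear -jN; lia.
have rn : (r.+1 < n)%N by rewrite /r /off /n; clear -jN; lia.
have r0 : (0 < r)%N by rewrite /r /off; clear -jN; lia.
have site : j + (k + N + 2 + K)%N%:Z = (k + r).+1%:Z by move: er; rewrite /off; clear; lia.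
have rn' : (r < n)%N by rewrite ltnW.
have rn'' : (r.-1 < n)%N by rewrite (leq_ltn_trans (leq_pred r)).
have rj : r%:Z - off%:Z = j by rewrite er addrK.
rewrite site; split.
- have := ent (Ordinal rn') (Ordinal rn''); rewrite mxE -(inj_eq val_inj) /=.
  rewrite ifN; last by clear -r0; lia.
  rewrite ifN; last by clear -r0; lia.
  rewrite prednK // eqxx rj nc_dist.
  suff -> : u (k + r).+1%:Z = A (k + r)%N (k + r.-1)%N by [].
  by rewrite -[in LHS](prednK r0) addnS hu -addnS prednK.
- have := ent (Ordinal rn') (Ordinal rn'); rewrite mxE eqxx /= rj nc_dist hv.
  by rewrite opprD addrA addrAC.
- have := ent (Ordinal rn') (Ordinal rn); rewrite mxE -(inj_eq val_inj) /=.
  rewrite ifN; last by clear; lia.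
  by rewrite eqxx rj nc_dist addnS hw.
Qed.

(* On the dyadic block [2^t, 2^(t+1)) this reads the bi-infinite sequence
   centred at the midpoint of the block. *)
Definition dyadic_site (i : int) : int :=
  `|i|%N%:Z - (3 * 2 ^ (trunc_log 2 `|i|%N).-1)%N%:Z.

Lemma dyadic_windowed u v w :
  windowed (u \o dyadic_site) (v \o dyadic_site) (w \o dyadic_site) u v w.
Proof.
move=> N e e0 K; have [t Nt] : exists t, (N + K < 2 ^ t)%N by exists (N + K)%N; exact: ltn_expl.
exists (3 * 2 ^ t)%N; split; first by clear -Nt; lia.
move=> j jN /=; suff -> : dyadic_site (j + (3 * 2 ^ t)%N%:Z) = j.
  by rewrite !subrr nc0; split; exact: ltW.
rewrite /dyadic_site.
have -> : trunc_log 2 `|(j + (3 * 2 ^ t)%N%:Z)%R|%N = t.+1.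
  by apply: trunc_log_eq => //; rewrite !expnS; clear -Nt jN; lia.
by rewrite /=; clear -Nt jN; lia.
Qed.

End Windows.

Section Spectra.
Variable R : realType.
Local Notation C := R[i].
Variable p : \bar R.
Hypothesis hp : (1%:E <= p)%E.
Variable F : set_system nat.
Hypothesis FU : UltraFilter F.
Hypothesis Foo : \oo `<=` F.
Variables U V W : set C.
Hypotheses (U0 : U !=set0) (V0 : V !=set0) (W0 : W !=set0).
Hypotheses (cU : ultra_closed F U) (cV : ultra_closed F V) (cW : ultra_closed F W).

Definition regular (l : C) := inj_family U (shift_set V l) W.

Lemma regular_good l : regular l -> good_family F U (shift_set V l) W.
Proof. by move=> h; split=> //; exact: ultra_closed_shift. Qed.

Lemma family_bound l : exists K, forall u v w, coefs U (shift_set V l) W u v w ->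
  coef_bound K u v w.
Proof.
have [K1 hK1] := ultra_closed_bounded FU Foo cU.
have [K2 hK2] := ultra_closed_bounded FU Foo (ultra_closed_shift FU (a := l) cV).
have [K3 hK3] := ultra_closed_bounded FU Foo cW.
exists (Num.max K1 (Num.max K2 K3)) => u v w cf i; have [h1 h2 h3] := cf i.
by split; rewrite !le_max; apply/orP;
  [left; exact: hK1|right; apply/orP; left; exact: hK2|right; apply/orP; right; exact: hK3].
Qed.

Lemma SigmaE l : Sigma p U V W l <-> ~ regular l.
Proof.
split=> [[A MA sA] reg|h].
  apply: sA; have [u [v [w [cf ->]]]] := M_biE l MA.
  exact: (good_family_invertible hp FU Foo (regular_good reg) cf).
apply: contrapT => ns; apply: h => u v w cf.
have [K /(_ _ _ _ cf) hK] := family_bound l.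
have [A [MA eA]] := M_bi_mk cf.
apply: (invertible_inj hp hK); apply: contrapT => ni; apply: ns.
by exists A => //; rewrite /spec /= eA.
Qed.

(** A given line operator is a limit operator of its dyadic half-line copy, whose invertibility
    makes it Fredholm; no pseudoergodic matrix has to be constructed. *)
Lemma Sigma_plus_regular l : ~ Sigma_plus p U V W l -> regular l.
Proof.
move=> ns u v w cf; have [K /(_ _ _ _ cf) hK] := family_bound l.
have cf' : coefs U (shift_set V l) W (u \o dyadic_site) (v \o dyadic_site) (w \o dyadic_site).
  by move=> i; exact: cf.
have [A [MA eA]] := M_semi_mk cf'.
apply: (fredholm_windowed_inj hp hK (dyadic_windowed u v w)).
apply: invertible_fredholm; last exact: semi_op0.
  exact: hp.
by rewrite -eA; apply: contrapT => ni; apply: ns; exists A.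
Qed.

Lemma Sigma_idx_regular B k l : PE_semi U V W B -> Sigma_idx p B k l -> regular l.
Proof.
move=> PE fr u v w cf; have [K /(_ _ _ _ cf) hK] := family_bound l.
have [ub [vb [wb [cfb eB hu hv hw]]]] := M_semiE l U0 V0 W0 PE.1.
have win := PE_windowed PE hu hv hw cf.
by move: fr; rewrite /Sigma_idx /= eB => fr; exact: (fredholm_windowed_inj hp hK win fr).
Qed.

(** For regular [l] one such operator suffices: by [rkernel_propagates] all members then have a
    right kernel, and by Coburn's lemma none has a left one. *)
Definition right_type l := exists u v w x, coefs U (shift_set V l) W u v w /\ rkernel u v w x.
Definition left_type l := exists u v w x, coefs U (shift_set V l) W u v w /\ lkernel u v w x.

Section Regular.
Variables (l : C) (B : nat -> nat -> C).
Hypotheses (reg : regular l) (MB : M_semi U V W B).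

Lemma neutral_invertible : ~ right_type l -> ~ left_type l ->
  invertible_operator p (mxop_sub B l).
Proof.
move=> nr nl; have [u [v [w [cf -> _ _ _]]]] := M_semiE l U0 V0 W0 MB.
apply: (semi_invertible hp FU Foo (regular_good reg) cf) => -[x kx].
  by apply: nr; exists u, v, w, x.
by apply: nl; exists u, v, w, x.
Qed.

Lemma mxop_sub0 : mxop_sub B l (fun=> 0) = (fun=> 0).
Proof.
by have [u [v [w [_ -> _ _ _]]]] := M_semiE l U0 V0 W0 MB; exact: semi_op0.
Qed.

Lemma right_index : right_type l -> fredholm_index p (mxop_sub B l) 1.
Proof.
move=> rt; have [u [v [w [cf -> _ _ _]]]] := M_semiE l U0 V0 W0 MB.
exact: (rkernel_fredholm hp FU Foo (regular_good reg) cf rt).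
Qed.

Lemma left_index : left_type l -> fredholm_index p (mxop_sub B l) (-1).
Proof.
move=> lt; have [u [v [w [cf -> _ _ _]]]] := M_semiE l U0 V0 W0 MB.
exact: (lkernel_fredholm hp FU Foo (regular_good reg) cf lt).
Qed.

(** Surjectivity forces codimension 0. The sign of the index is all that is needed to tell index 1
    from index -1. *)
Lemma right_index_ge0 k : right_type l -> fredholm_index p (mxop_sub B l) k -> 0 <= k.
Proof.
move=> rt; have [u [v [w [cf -> _ _ _]]]] := M_semiE l U0 V0 W0 MB.
move=> [m [n [_ hn ->]]]; rewrite (image_full_dim hp _ hn) ?subr0 //.
by move=> y ly; exact: (rkernel_surjective hp FU Foo (regular_good reg) cf rt ly).
Qed.

Lemma left_index_le0 k : left_type l -> fredholm_index p (mxop_sub B l) k -> k <= 0.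
Proof.
move=> lt; have [u [v [w [cf -> _ _ _]]]] := M_semiE l U0 V0 W0 MB.
move=> [m [n [hm _ ->]]].
rewrite (kernel_trivial_dim hp _ (semi_op0 _ _ _) hm) ?sub0r ?oppr_le0 //.
by move=> x lx; exact: (lkernel_injective hp (regular_good reg) cf lt lx).
Qed.

Lemma type_of_spec : spec p B l -> right_type l \/ left_type l.
Proof.
move=> sB; apply: contrapT => /not_orP[nr nl]; apply: sB; exact: neutral_invertible.
Qed.

Lemma spec_of_index k : k != 0 -> fredholm_index p (mxop_sub B l) k -> spec p B l.
Proof.
by move=> k0 fr inv; move: k0; rewrite (invertible_index hp inv mxop_sub0 fr) eqxx.
Qed.

Lemma spec_of_type : right_type l \/ left_type l -> spec p B l.
Proof.
move=> [rt|lt]; first exact: (@spec_of_index 1 isT (right_index rt)).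
exact: (@spec_of_index (-1) isT (left_index lt)).
Qed.

Lemma index1_right : fredholm_index p (mxop_sub B l) 1 -> right_type l.
Proof.
move=> fr; have [//|lt] := type_of_spec (@spec_of_index 1 isT fr).
by have := left_index_le0 lt fr.
Qed.

Lemma indexN1_left : fredholm_index p (mxop_sub B l) (-1) -> left_type l.
Proof.
move=> fr; have [rt|//] := type_of_spec (@spec_of_index (-1) isT fr).
by have := right_index_ge0 rt fr.
Qed.

End Regular.

Lemma semi_nonempty : exists B, M_semi U V W B.
Proof.
have [[u Uu] [v Vv] [w Ww]] := And3 U0 V0 W0.
have [|B [MB _]] := @M_semi_mk R U V W (fun=> u) (fun=> v - 0) (fun=> w) 0; last by exists B.
by move=> i; split=> //; exists v.
Qed.

Lemma Sigma_plusE l : Sigma_plus p U V W l <->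
  Sigma p U V W l \/ (regular l /\ (right_type l \/ left_type l)).
Proof.
split=> [[B MB sB]|[/SigmaE nreg|[reg ty]]].
- have [reg|nreg] := pselect (regular l); last by left; apply/SigmaE.
  by right; split=> //; exact: (type_of_spec reg MB).
- by apply: contrapT => /Sigma_plus_regular.
- have [B MB] := semi_nonempty; exists B => //; exact: spec_of_type.
Qed.

End Spectra.

(** * Toeplitz operators *)

Section Roots.
Variable R : realType.
Local Notation C := R[i].

Lemma conj_mul (x : C) : x * (x^*)%C = (nc x ^+ 2)%:C.
Proof. by rewrite -sqr_normc normr_nc -rmorphXn. Qed.

(* For s with u s + w (conj s) = l - v this is the Schur-Cohn relation for the
   quadratic w z^2 + (v - l) z + u with roots z1 and z2. *)
Lemma schur_cohn (z1 z2 s : C) : z1 + z2 = z1 * z2 * s + (s^*)%C ->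
  (s^*)%C * (1 - nc z1 ^+ 2 * nc z2 ^+ 2)%:C
  = z1 * (1 - nc z2 ^+ 2)%:C + z2 * (1 - nc z1 ^+ 2)%:C.
Proof.
move=> e; have e' := congr1 (@conjc R) e.
rewrite !(rmorphD, rmorphM) /= conjcK in e'.
have -> : (1 - nc z1 ^+ 2 * nc z2 ^+ 2)%:C = 1 - (z1 * (z1^*)%C) * (z2 * (z2^*)%C).
  by rewrite !conj_mul -rmorphM -(rmorph1 (real_complex R)) -rmorphB.
have E (z : C) : (1 - nc z ^+ 2)%:C = 1 - z * (z^*)%C.
  by rewrite conj_mul -(rmorph1 (real_complex R)) -rmorphB.
rewrite !E; move: (s^*)%C (z1^*)%C (z2^*)%C e e' => t y1 y2 e e'.
have es : s = y1 + y2 - y1 * y2 * t by rewrite e'; ring.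
apply/eqP; rewrite -subr_eq0; apply/eqP.
have : z1 + z2 - (z1 * z2 * s + t) = 0 by rewrite e subrr.
rewrite es => h; rewrite -[RHS]oppr0 -h; ring.
Qed.

(** With r1, r2 the moduli of the roots, the Schur-Cohn relation gives |s| (1 + r1 r2) <= r1 + r2,
    and (1 - r1)(1 - r2) > 0 finishes. *)
Lemma roots_in_disc (z1 z2 s : C) : z1 + z2 = z1 * z2 * s + (s^*)%C ->
  nc z1 < 1 -> nc z2 < 1 -> nc s < 1.
Proof.
move=> /schur_cohn e h1 h2; have r1 := nc_ge0 z1; have r2 := nc_ge0 z2.
have p12 : nc z1 * nc z2 < 1 by nra.
have q1 : 0 <= 1 - nc z1 ^+ 2 by nra.
have q2 : 0 <= 1 - nc z2 ^+ 2 by nra.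
have q12 : 0 <= 1 - nc z1 ^+ 2 * nc z2 ^+ 2 by nra.
have := congr1 (fun x => nc x) e; rewrite ncM nc_conj nc_real ger0_norm // => E.
have : nc s * (1 - nc z1 ^+ 2 * nc z2 ^+ 2) <= (nc z1 + nc z2) * (1 - nc z1 * nc z2).
  rewrite E; apply: (le_trans (ncD _ _)); rewrite !ncM !nc_real !ger0_norm //.
  by rewrite le_eqVlt; apply/orP; left; apply/eqP; ring.
have -> : 1 - nc z1 ^+ 2 * nc z2 ^+ 2 = (1 + nc z1 * nc z2) * (1 - nc z1 * nc z2) by ring.
rewrite mulrA ler_pM2r; last by lra.
have s0 := nc_ge0 s.
move=> h; rewrite ltNge; apply/negP => s1.
have : 1 + nc z1 * nc z2 <= nc s * (1 + nc z1 * nc z2) by rewrite ler_peMl //; nra.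
nra.
Qed.

(** If r1 >= 1, then r2 < 1, and the reverse triangle inequality gives r1 + r2 <= |s| (1 + r1 r2) <
    1 + r1 r2, against (r1 - 1)(1 - r2) >= 0. *)
Lemma disc_in_roots (z1 z2 s : C) : z1 + z2 = z1 * z2 * s + (s^*)%C ->
  nc z1 * nc z2 < 1 -> nc s < 1 -> nc z1 < 1.
Proof.
move=> /schur_cohn e p12 s1; have r1 := nc_ge0 z1; have r2 := nc_ge0 z2.
rewrite ltNge; apply/negP => h1; have h2 : nc z2 < 1 by nra.
have q1 : 0 <= nc z1 ^+ 2 - 1 by nra.
have q2 : 0 <= 1 - nc z2 ^+ 2 by nra.
have q12 : 0 <= 1 - nc z1 ^+ 2 * nc z2 ^+ 2.
  have -> : 1 - nc z1 ^+ 2 * nc z2 ^+ 2 = (1 + nc z1 * nc z2) * (1 - nc z1 * nc z2) by ring.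
  by rewrite mulr_ge0 //; nra.
have := congr1 (fun x => nc x) e; rewrite ncM nc_conj nc_real ger0_norm // => E.
have : (nc z1 + nc z2) * (1 - nc z1 * nc z2) <= nc s * (1 - nc z1 ^+ 2 * nc z2 ^+ 2).
  rewrite E; set a := z1 * _; set b := z2 * _.
  have ha : nc a = nc z1 * (1 - nc z2 ^+ 2) by rewrite ncM nc_real ger0_norm.
  have hb : nc b = nc z2 * (nc z1 ^+ 2 - 1).
    by rewrite ncM nc_real ler0_norm ?opprB //; lra.
  have : nc a <= nc (a + b) + nc b by rewrite -{1}(addrK b a); exact: ncB.
  rewrite ha hb.
  have -> : (nc z1 + nc z2) * (1 - nc z1 * nc z2) =
      nc z1 * (1 - nc z2 ^+ 2) - nc z2 * (nc z1 ^+ 2 - 1) by ring.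
  lra.
have -> : 1 - nc z1 ^+ 2 * nc z2 ^+ 2 = (1 + nc z1 * nc z2) * (1 - nc z1 * nc z2) by ring.
rewrite mulrA ler_pM2r; last by lra.
move=> h; have h3 : 1 + nc z1 * nc z2 <= nc z1 + nc z2 by nra.
have : nc s * (1 + nc z1 * nc z2) < 1 + nc z1 * nc z2 by rewrite gtr_pMl //; nra.
lra.
Qed.

Lemma quadratic_roots (a b c : C) : a != 0 -> exists z1 z2,
  b = - a * (z1 + z2) /\ c = a * (z1 * z2).
Proof.
move=> a0; set d := sqrtc (b ^+ 2 - 4 * a * c).
have dd : d ^+ 2 = b ^+ 2 - 4 * a * c by rewrite sqr_sqrtc.
exists ((- b + d) / (2 * a)), ((- b - d) / (2 * a)).
have a2 : 2 * a != 0 by rewrite mulf_neq0 // pnatr_eq0.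
split; first by field; rewrite a0 /= ?pnatr_eq0.
have -> : a * ((- b + d) / (2 * a) * ((- b - d) / (2 * a))) = (b ^+ 2 - d ^+ 2) / (4 * a).
  by field; rewrite a0 /= ?pnatr_eq0.
by rewrite dd; field; rewrite a0 /= ?pnatr_eq0.
Qed.

End Roots.

Section Toeplitz.
Variable R : realType.
Local Notation C := R[i].
Implicit Types (u v w : C).

Lemma toeplitz_rkernel u w (z1 z2 : C) : w != 0 -> u = w * (z1 * z2) ->
  nc z1 < 1 -> nc z2 < 1 ->
  exists x, rkernel (fun=> u) (fun=> - w * (z1 + z2)) (fun=> w) x.
Proof.
move=> w0 eu h1 h2.
(* [y n] is the sum of z1^i z2^j over i + j = n; unlike a quotient of differences of powers it also
   covers a double root. *)
pose y := fix y n : C := if n is m.+1 then z1 * y m + z2 ^+ m.+1 else 1.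
set r := Num.max (nc z1) (nc z2).
have r1 : r < 1 by rewrite gt_max h1.
have r0 : 0 <= r by rewrite le_max nc_ge0.
have K0 : 0 < 1 - r by lra.
have yK n : nc (y n) <= (1 - r)^-1.
  elim: n => [|n IH].
    by rewrite -[y 0%N]/(1 : C) nc1 -[leRHS]mul1r ler_pdivlMr // mul1r; lra.
  rewrite -[y n.+1]/(z1 * y n + z2 ^+ n.+1); apply: (le_trans (ncD _ _)); rewrite ncM ncX.
  have a1 : nc z1 * nc (y n) <= r * (1 - r)^-1.
    by apply: ler_pM; rewrite ?nc_ge0 // le_max lexx.
  have a2 : nc z2 ^+ n.+1 <= 1 by rewrite exprn_ile1 ?nc_ge0 // ltW.
  have : (1 - r)^-1 = r * (1 - r)^-1 + 1 by field; rewrite gt_eqF.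
  lra.
exists (ext y); split.
- exists (1 - r)^-1 => i; have [i0|] := lerP i 0.
    by rewrite ext_le0 // nc0 invr_ge0 ltW.
  by case: i => [[|n]|n] // _; exact: yK.
- exact: ext_le0.
- move=> [[|n]|n] // _; rewrite -[LHS]/(semi_op _ _ _ y n) semi_opE eu.
  have yS k : y k.+1 = z1 * y k + z2 ^+ k.+1 by [].
  case: n => [|n].
    by rewrite yS expr1 (_ : y 0%N = 1) //; ring.
  by rewrite (yS n.+1) (yS n) (exprS z2 n.+1); ring.
- by exists 1; rewrite /= oner_neq0.
Qed.

(** Factoring out [z2], y (n+1) - z2 y n equals z1^(n+1) y 0, which cannot decay if |z1| >= 1.
    Exchanging the roots treats the other one. *)
Lemma toeplitz_decay (w z1 z2 : C) (y : nat -> C) (c q : R) : w != 0 -> 0 < q < 1 ->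
  (forall n, nc (y n) <= c * q ^+ n) -> y 0%N != 0 ->
  w * y 1%N = w * (z1 + z2) * y 0%N ->
  (forall n, w * y n.+2 = w * (z1 + z2) * y n.+1 - w * (z1 * z2) * y n) ->
  nc z1 < 1.
Proof.
move=> w0 q01 yq y0 e1 e2; have /andP[q0 q1] := q01.
have {}e1 : y 1%N = (z1 + z2) * y 0%N by apply: (mulfI w0); rewrite e1; ring.
have {}e2 n : y n.+2 = (z1 + z2) * y n.+1 - z1 * z2 * y n.
  by apply: (mulfI w0); rewrite e2; ring.
have P n : y n.+1 - z2 * y n = z1 ^+ n.+1 * y 0%N.
  elim: n => [|n IH]; first by rewrite e1; ring.
  by rewrite e2 (exprS z1 n.+1) -[RHS]mulrA -IH; ring.
rewrite ltNge; apply/negP => h.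
have c0 : 0 <= c by have := yq 0%N; rewrite expr0 mulr1; apply: le_trans; exact: nc_ge0.
have : nc (y 0%N) <= 0.
  apply: (@geometric_le0 _ _ (c + nc z2 * c) q) => // n.
  apply: (@le_trans _ _ (nc (z1 ^+ n.+1 * y 0%N))).
    by rewrite ncM ncX ler_peMl ?nc_ge0 // exprn_ege1.
  rewrite -P; apply: (le_trans (ncB _ _)); rewrite ncM mulrDl; apply: lerD.
    apply: (le_trans (yq _)); apply: ler_wpM2l => //.
    by apply: ler_wiXn2l; [exact: ltW..|].
  by rewrite -mulrA; apply: ler_wpM2l => //; exact: nc_ge0.
by move=> h0; move: y0; rewrite -nc_eq0 eq_le h0 nc_ge0.
Qed.

(** A point of the ellipse is a value of the Toeplitz symbol at some unimodular t, and the powers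
    t^(-i) form a bounded null sequence. *)
Lemma ellipse_singular U V W u v w l : U u -> V v -> W w -> ellipse u v w l ->
  ~ inj_family U (shift_set V l) (W : set C).
Proof.
move=> Uu Vv Ww [t /= t1 <-] inj.
have t0 : t != 0 by rewrite -nc_eq0 t1 oner_neq0.
pose x (i : int) : C := t ^ (- i).
have cf : coefs U (shift_set V (u * t + v + w * t^-1)) W (fun=> u)
    (fun=> v - (u * t + v + w * t^-1)) (fun=> w).
  by move=> i; split=> //; exists v.
have := inj _ _ _ cf x _ _ 0; rewrite /x oppr0 expr0z => h.
have /eqP : (1 : C) = 0; last by rewrite oner_eq0.
apply: h.
  exists 1 => i; suff E k : nc (t ^ k) = 1 by rewrite E.
  by case: k => n; rewrite ?NegzE ?exprnN ?ncV -?exprnP ncX t1 expr1n ?invr1.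
move=> i; rewrite /jac.
have -> : t ^ (- (i - 1)) = t ^ (- i) * t by rewrite opprB addrC expfzDr // expr1z.
have -> : t ^ (- (i + 1)) = t ^ (- i) * t^-1 by rewrite opprD expfzDr // exprN1.
ring.
Qed.

End Toeplitz.

(** * Ellipses *)

Section EllipseTopology.
Variable R : realType.
Local Notation C := R[i].
Variables (u v w : C).
Hypothesis uw : nc u != nc w.

(* The real-linear bijection s |-> u s + w (conj s) maps the unit circle onto
   the ellipse centred at 0; [foc] is its inverse. *)
Definition foc (z : C) : C := ((u^*)%C * z - w * (z^*)%C) / (nc u ^+ 2 - nc w ^+ 2)%:C.

Let D0 : (nc u ^+ 2 - nc w ^+ 2)%:C != 0 :> C.
Proof.
rewrite -nc_eq0 nc_real normr_eq0 subr_eq0 eqrXn2 ?nc_ge0 //.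
Qed.

Let DE : (nc u ^+ 2 - nc w ^+ 2)%:C = u * (u^*)%C - w * (w^*)%C :> C.
Proof. by rewrite !conj_mul -rmorphB. Qed.

Lemma focK z : u * foc z + w * (foc z)^*%C = z.
Proof.
move: D0 DE (conjc_real (nc u ^+ 2 - nc w ^+ 2)); rewrite /foc.
move: ((nc u ^+ 2 - nc w ^+ 2)%:C) => d d0 dE dJ.
rewrite rmorphM rmorphB !rmorphM fmorphV /= !conjcK dJ.
apply: (mulIf d0); rewrite mulrDl -!mulrA mulVf // !mulr1 dE; ring.
Qed.

Lemma Kfoc s : foc (u * s + w * (s^*)%C) = s.
Proof.
rewrite /foc rmorphD !rmorphM /= conjcK; apply: (mulIf D0).
rewrite -mulrA mulVf // mulr1 DE; ring.
Qed.

Lemma focB a b : foc a - foc b = foc (a - b).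
Proof. by rewrite /foc rmorphB /=; ring. Qed.

Lemma focZ (t : R) a : foc (t%:C * a) = t%:C * foc a.
Proof.
have E : ((t%:C * a)^*)%C = t%:C * (a^*)%C by rewrite rmorphM; congr (_ * _); exact: conjc_real.
by rewrite /foc E; ring.
Qed.

Lemma foc_lipschitz : exists2 L : R, 0 < L & forall a, nc (foc a) <= L * nc a.
Proof.
set d := nc (nc u ^+ 2 - nc w ^+ 2)%:C.
have d0 : 0 < d by rewrite nc_gt0.
exists ((nc u + nc w + 1) / d).
  by rewrite divr_gt0 //; have := nc_ge0 u; have := nc_ge0 w; lra.
move=> a; rewrite /foc ncM ncV -/d mulrAC ler_pM2r ?invr_gt0 //.
apply: (le_trans (ncB _ _)); rewrite !ncM !nc_conj.
have := nc_ge0 a; lra.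
Qed.

Lemma unit_circle_inv (t : C) : nc t = 1 -> t^-1 = (t^*)%C.
Proof.
move=> t1; have t0 : t != 0 by rewrite -nc_eq0 t1 oner_neq0.
by apply: (mulfI t0); rewrite divff // conj_mul t1 expr1n.
Qed.

Lemma ellipse_foc l : ellipse u v w l <-> nc (foc (l - v)) = 1.
Proof.
split=> [[t /= t1 <-]|h].
  have -> : u * t + v + w * t^-1 - v = u * t + w * (t^*)%C by rewrite unit_circle_inv //; ring.
  by rewrite Kfoc.
exists (foc (l - v)) => //=; rewrite unit_circle_inv //.
by rewrite addrAC focK subrK.
Qed.

Lemma lipschitz_open (f : C -> R) (L r : R) : 0 < L ->
  (forall z z', f z' <= f z + L * nc (z' - z)) -> open ([set z | f z < r] : set R[i]^o).
Proof.
move=> L0 hf; rewrite openE => z /= fz; apply/nbhs_ballP.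
exists (((r - f z) / L)%:C) => /=; first by rewrite ltcR divr_gt0 // subr_gt0.
move=> y; rewrite /ball /= distrC normr_nc ltcR ltr_pdivlMr // => h.
by apply: (le_lt_trans (hf z y)); rewrite mulrC; lra.
Qed.

Let N (l : C) : R := nc (foc (l - v)).

Let N_lip : exists2 L : R, 0 < L & forall z z', N z' <= N z + L * nc (z' - z).
Proof.
have [L L0 hL] := foc_lipschitz; exists L => // z z'.
have -> : N z' = nc (foc (z - v) + foc (z' - z)).
  have -> : foc (z' - z) = foc (z' - v) - foc (z - v) by rewrite focB; congr foc; ring.
  by rewrite addrC subrK.
by apply: (le_trans (ncD _ _)); rewrite lerD2l.
Qed.

(** N is never 1 off the ellipse, so N < 1 cuts out an open and closed part of the component, hence
    all of it; there [focK] bounds the points. *)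
Lemma inner_component l : N l < 1 ->
  bounded_set (connected_component (~` ellipse u v w) l).
Proof.
move=> Nl; set A := connected_component _ _.
have [L L0 hL] := N_lip.
have lA : A l.
  apply: connected_component_refl => /ellipse_foc; rewrite -/(N l) => e.
  by move: Nl; rewrite e ltxx.
have AE z : A z -> N z != 1.
  by move=> /connected_component_sub h; apply/eqP => /ellipse_foc.
have AN : A `&` [set z | N z < 1] = A.
  have := @component_connected _ (~` ellipse u v w) l; rewrite -/A; apply.
  - by exists l.
  - by exists [set z | N z < 1] => //; exact: (lipschitz_open L0 hL).
  - exists (~` [set z | - N z < - 1]).
      rewrite closedC; apply: (lipschitz_open (L := L)) => // z z'.
      by rewrite lerNl opprD opprK lerBlDr nc_dist.
    apply/seteqP; split=> z /= [Az Nz]; split=> //.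
      by apply/negP; rewrite -leNgt lerN2 ltW.
    by move/negP: Nz; rewrite -leNgt lerN2 le_eqVlt (negbTE (AE z Az)).
exists ((nc u + nc w + nc v)%:C); split; first by rewrite complex_real.
move=> M hM z Az /=; apply: le_trans (ltW hM); rewrite normr_nc lecR.
have /= Nz : N z < 1 by move: Az; rewrite -AN => -[].
rewrite -[z](subrK v) -(focK (z - v)).
apply: (le_trans (ncD _ _)); rewrite lerD2r; apply: (le_trans (ncD _ _)).
rewrite (ncM u) (ncM w) nc_conj -/(N z).
by apply: lerD; (apply: ler_piMr; [exact: nc_ge0|exact: ltW]).
Qed.

(** The ray from [l] away from the centre [v] stays in N > 1, since [foc] is real-linear, and is an
    unbounded connected set off the ellipse. *)
Lemma outer_component l : 1 < N l ->
  ~ bounded_set (connected_component (~` ellipse u v w) l).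
Proof.
move=> Nl [M [Mr hM]].
pose f (t : R) : R[i]^o := v + t%:C * (l - v).
have lv : 0 < nc (l - v).
  rewrite nc_gt0; apply/eqP => e; move: Nl; rewrite /N e /foc rmorph0 !mulr0 subr0 mul0r nc0.
  by rewrite ltNge ler01.
have cf : continuous f.
  move=> t A /nbhs_ballP[e /= e0 he]; apply/nbhs_ballP.
  have e1 : e = (complex.Re e)%:C by case: e e0 {he} => a b; rewrite ltcE /= => /andP[/eqP ->].
  have e2 : 0 < complex.Re e by move: e0; rewrite e1 ltcR.
  exists (complex.Re e / nc (l - v)) => /=; first by rewrite divr_gt0.
  move=> t'; rewrite /ball /= ltr_pdivlMr // => h; apply: he.
  rewrite /ball /= normr_nc e1 ltcR.
  have -> : f t - f t' = (t - t')%:C * (l - v) by rewrite /f rmorphB /=; ring.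
  by rewrite ncM nc_real.
have cray : connected [set f t | t in `[1, +oo[%classic].
  apply: connected_continuous_connected; last exact: continuous_subspaceT.
  by apply/connected_intervalP; exact: interval_is_interval.
have fN t : 1 <= t -> 1 < N (f t).
  move=> t1; rewrite /N /f [v + _]addrC addrK focZ ncM nc_real ger0_norm; last by lra.
  by apply: lt_le_trans Nl _; rewrite ler_peMl ?nc_ge0.
have sub : [set f t | t in `[1, +oo[%classic] `<=` connected_component (~` ellipse u v w) l.
  apply: connected_component_max => //.
  - by exists 1; [rewrite /= in_itv /= lexx|rewrite /f rmorph1 mul1r addrC subrK].
  - move=> _ [t /= ht <-]; move: ht; rewrite in_itv /= andbT => t1 /ellipse_foc.
    by rewrite -/(N _) => e; have := fN t t1; rewrite e ltxx.
pose M1 := complex.Re M + 1.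
have MM1 : M < M1%:C.
  move: Mr; case: M {hM} @M1 => a b; rewrite complex_real /= => /eqP ->.
  by rewrite ltcR; lra.
pose t := 1 + (`|M1| + nc v + 1) / nc (l - v).
have t1 : 1 <= t.
  by rewrite /t lerDl divr_ge0 ?nc_ge0 //; have := normr_ge0 M1; have := nc_ge0 v; lra.
have := hM _ MM1 (f t) (sub _ _) => /(_ _).
rewrite /= normr_nc lecR => h; have {h}: nc (f t) <= M1.
  by apply: h; exists t => //=; rewrite in_itv /= t1.
have : t * nc (l - v) <= nc (f t) + nc v.
  have -> : t * nc (l - v) = nc (f t - v).
    by rewrite /f [v + _]addrC addrK ncM nc_real ger0_norm //; lra.
  exact: ncB.
rewrite /t mulrDl divfK ?gt_eqF // mul1r.
have := ler_norm M1; lra.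
Qed.

Lemma ellipse_interiorE l : ellipse_interior u v w l <-> nc (foc (l - v)) < 1.
Proof.
rewrite /ellipse_interior (negbTE uw) /=; split=> [[nE bd]|h].
- have [//|h|h] := ltgtP (nc (foc (l - v))) 1.
  + by case: (outer_component h).
  + by case: nE; apply/ellipse_foc.
- split; last exact: inner_component.
  by move/ellipse_foc => e; move: h; rewrite e ltxx.
Qed.

End EllipseTopology.

Section EllipseTypes.
Variable R : realType.
Local Notation C := R[i].
Variable F : set_system nat.
Hypothesis FU : UltraFilter F.
Hypothesis Foo : \oo `<=` F.
Implicit Types (U V W : set C).

Lemma ellipse_sym (u v w : C) : ellipse u v w = ellipse w v u.
Proof.
have H (a b c : C) : ellipse a b c `<=` ellipse c b a.
  move=> _ [t /= t1 <-]; exists t^-1 => /=; first by rewrite ncV t1 invr1.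
  by rewrite invrK; ring.
by apply/seteqP; split; exact: H.
Qed.

Lemma ellipse_interior_sym (u v w : C) : ellipse_interior u v w = ellipse_interior w v u.
Proof. by rewrite /ellipse_interior ellipse_sym eq_sym. Qed.

Lemma focal_relation (u v w z1 z2 l : C) : w != 0 -> v - l = - w * (z1 + z2) ->
  u = w * (z1 * z2) -> nc u != nc w ->
  z1 + z2 = z1 * z2 * foc u w (l - v) + (foc u w (l - v))^*%C.
Proof.
move=> w0 eb ec uw; apply: (mulfI w0).
have -> : w * (z1 + z2) = l - v by rewrite -[l - v]opprB eb mulNr opprK.
by rewrite -{1}(focK uw (l - v)) {1}ec; ring.
Qed.

Lemma flip_regular U V W l : regular U V W l -> regular W V U l.
Proof. exact: inj_family_flip. Qed.

Lemma flip_left U V W l : left_type U V W l -> right_type W V U l.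
Proof.
move=> [u [v [w [x [cf kx]]]]].
by do 4 eexists; split; [exact: coefs_flip cf|exact: rkernel_flip kx].
Qed.

Lemma flip_right U V W l : right_type U V W l -> left_type W V U l.
Proof.
move=> [u [v [w [x [cf kx]]]]].
by do 4 eexists; split; [exact: coefs_flip cf|exact: lkernel_flip kx].
Qed.

Lemma interior_right U V W u v w l : U u -> V v -> W w -> nc u < nc w ->
  ellipse_interior u v w l -> right_type U V W l.
Proof.
move=> Uu Vv Ww uw; have uw' : nc u != nc w by rewrite lt_eqF.
move=> /(ellipse_interiorE v uw' l) s1.
have w0 : w != 0 by rewrite -nc_gt0; exact: le_lt_trans (nc_ge0 u) uw.
have [z1 [z2 [eb ec]]] := quadratic_roots (v - l) u w0.
have e := focal_relation w0 eb ec uw'.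
have nw : 0 < nc w by rewrite nc_gt0.
have p12 : nc z1 * nc z2 < 1.
  by rewrite -(ltr_pM2l nw) mulr1 -!ncM -ec.
have h1 := disc_in_roots e p12 s1.
have h2 : nc z2 < 1.
  apply: (disc_in_roots (z2 := z1) _ _ s1); first by rewrite addrC [z2 * z1]mulrC.
  by rewrite mulrC.
have [x kx] := toeplitz_rkernel w0 ec h1 h2.
exists (fun=> u), (fun=> - w * (z1 + z2)), (fun=> w), x; split=> // i.
by split=> //; exists v.
Qed.

Lemma interior_left U V W u v w l : U u -> V v -> W w -> nc w < nc u ->
  ellipse_interior u v w l -> left_type U V W l.
Proof.
move=> Uu Vv Ww wu; rewrite ellipse_interior_sym => h.
exact: flip_right (interior_right Ww Vv Uu wu h).
Qed.

(** The Green function of the Toeplitz operator starts at site 1 and decays exponentially, so both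
    roots lie in the open unit disc. Their product gives |u| < |w|, and Schur-Cohn puts [l] inside
    the ellipse. *)
Lemma right_interior U V W u v w l : ultra_closed F U -> ultra_closed F V -> ultra_closed F W ->
  regular U V W l -> right_type U V W l -> U u -> V v -> W w ->
  nc u < nc w /\ ellipse_interior u v w l.
Proof.
move=> cU cV cW reg rt Uu Vv Ww; have G := regular_good FU cU cV cW reg.
have cf : coefs U (shift_set V l) W (fun=> u) (fun=> v - l) (fun=> w).
  by move=> i; split=> //; exists v.
have [e [be Je]] := greenP FU Foo 0 G cf.
have [e0 e1] := rkernel_green_supp FU Foo G rt cf be Je.
have [hU hV hW inj] := G.
have [[c q] [_ q01] /(_ _ _ _ cf) le] := family_local_estimate FU Foo hU hV hW inj.
have ed := local_estimate_delta q01 le be Je.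
have w0 : w != 0 by apply/eqP => w0; move: e1; rewrite w0 mul0r => /eqP; rewrite eq_sym oner_eq0.
have [z1 [z2 [eb ec]]] := quadratic_roots (v - l) u w0.
pose y n := e n.+1%:Z.
have y0 : y 0%N != 0.
  by apply/eqP => h; move: e1; rewrite add0r -[e 1]/(y 0%N) h mulr0 => /eqP; rewrite eq_sym oner_eq0.
have /andP[q0 q1] := q01.
have c0 : 0 <= c by have := ed 0; rewrite expr0 mulr1; apply: le_trans; exact: nc_ge0.
have yq n : nc (y n) <= c * q ^+ n.
  apply: (le_trans (ed _)); apply: ler_wpM2l => //.
  by apply: ler_wiXn2l; [exact: ltW..|rewrite sub0r abszN absz_nat].
have E1 : w * y 1%N = w * (z1 + z2) * y 0%N.
  have := Je 1; rewrite /jac /delta /= subrr (e0 0) // mulr0 add0r eb -[e (1 + 1)]/(y 1%N) -[e 1]/(y 0%N).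
  by move/eqP; rewrite addrC addr_eq0 => /eqP ->; ring.
have E2 n : w * y n.+2 = w * (z1 + z2) * y n.+1 - w * (z1 * z2) * y n.
  have := Je n.+2%:Z; rewrite /jac /delta /= eb ec.
  have -> : n.+2%:Z - 1 = n.+1%:Z by lia.
  have -> : n.+2%:Z + 1 = n.+3%:Z by lia.
  rewrite -/(y n) -/(y n.+1) -/(y n.+2) => /eqP; rewrite addrC addr_eq0 => /eqP ->; ring.
have h1 := toeplitz_decay w0 q01 yq y0 E1 E2.
have h2 : nc z2 < 1.
  apply: (@toeplitz_decay _ w z2 z1 y c q) => //; first by rewrite E1 addrC.
  by move=> n; rewrite E2 [z2 + _]addrC [z2 * _]mulrC.
have uw : nc u < nc w.
  have nw : 0 < nc w by rewrite nc_gt0.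
  rewrite ec !ncM gtr_pMr //.
  have := nc_ge0 z1; have := nc_ge0 z2; nra.
split=> //; have uw' : nc u != nc w by rewrite lt_eqF.
apply/(ellipse_interiorE v uw' l).
exact: roots_in_disc (focal_relation w0 eb ec uw') h1 h2.
Qed.

Lemma left_interior U V W u v w l : ultra_closed F U -> ultra_closed F V -> ultra_closed F W ->
  regular U V W l -> left_type U V W l -> U u -> V v -> W w ->
  nc w < nc u /\ ellipse_interior u v w l.
Proof.
move=> cU cV cW reg lt Uu Vv Ww; rewrite ellipse_interior_sym.
exact: (right_interior cW cV cU (flip_regular reg) (flip_left lt) Ww Vv Uu).
Qed.

Lemma abs_max_attained U : U !=set0 -> ultra_closed F U ->
  (exists2 u, U u & nc u = abs_max U) /\ forall u, U u -> nc u <= abs_max U.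
Proof.
move=> [u0 Uu0] cU; have [M hM] := ultra_closed_bounded FU Foo cU.
have hs : has_sup [set nc u | u in U].
  by split; [exists (nc u0); exists u0|exists M => _ [u Uu <-]; exact: hM].
have ub u : U u -> nc u <= abs_max U by move=> Uu; apply: ub_le_sup; [exact: hs.2|exists u].
split=> //.
have /choice[s hs'] n : exists u, U u /\ abs_max U - n.+1%:R^-1 < nc u.
  have [_ [u Uu <-] h] : exists2 x, [set nc u | u in U] x & sup [set nc u | u in U] - n.+1%:R^-1 < x.
    by apply: sup_adherent => //; rewrite invr_gt0.
  by exists u.
have [l Ul sl] := cU s (fun n => (hs' n).1).
exists l => //; apply/eqP; rewrite eq_le ub //= leNgt; apply/negP => h.
have d0 : 0 < (abs_max U - nc l) / 2 by rewrite divr_gt0 // subr_gt0.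
have [n [/= h1 h2]] := ultra_meet FU (sl _ d0) (Foo (near_infty_natSinv_lt (PosNum d0))).
have h3 : n.+1%:R^-1 < (abs_max U - nc l) / 2 := h2.
have := (hs' n).2; have : nc (s n) <= nc (s n - l) + nc l by rewrite -{1}[s n](subrK l); exact: ncD.
by move: h1 h3; move: (n.+1%:R^-1) => a; lra.
Qed.

Lemma abs_min_attained U : U !=set0 -> ultra_closed F U ->
  (exists2 u, U u & nc u = abs_min U) /\ forall u, U u -> abs_min U <= nc u.
Proof.
move=> [u0 Uu0] cU.
have hs : has_inf [set nc u | u in U].
  by split; [exists (nc u0); exists u0|exists 0 => _ [u Uu <-]; exact: nc_ge0].
have lb u : U u -> abs_min U <= nc u by move=> Uu; apply: ge_inf; [exact: hs.2|exists u].
split=> //.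
have /choice[s hs'] n : exists u, U u /\ nc u < abs_min U + n.+1%:R^-1.
  have [_ [u Uu <-] h] : exists2 x, [set nc u | u in U] x & x < inf [set nc u | u in U] + n.+1%:R^-1.
    by apply: inf_adherent => //; rewrite invr_gt0.
  by exists u.
have [l Ul sl] := cU s (fun n => (hs' n).1).
exists l => //; apply/eqP; rewrite eq_le lb // andbT leNgt; apply/negP => h.
have d0 : 0 < (nc l - abs_min U) / 2 by rewrite divr_gt0 // subr_gt0.
have [n [/= h1 h2]] := ultra_meet FU (sl _ d0) (Foo (near_infty_natSinv_lt (PosNum d0))).
have h3 : n.+1%:R^-1 < (nc l - abs_min U) / 2 := h2.
have := (hs' n).2; have : nc l <= nc (s n - l) + nc (s n).
  by have := ncB (s n) (s n - l); rewrite subKr [leRHS]addrC.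
by move: h1 h3; move: (n.+1%:R^-1) => a; lra.
Qed.

End EllipseTypes.

(** * The theorem *)

Section EllipseSets.
Variable R : realType.
Local Notation C := R[i].
Variable F : set_system nat.
Hypothesis FU : UltraFilter F.
Hypothesis Foo : \oo `<=` F.
Variables U V W : set C.
Hypotheses (U0 : U !=set0) (V0 : V !=set0) (W0 : W !=set0).
Hypotheses (cU : ultra_closed F U) (cV : ultra_closed F V) (cW : ultra_closed F W).

Lemma right_E_one l : regular U V W l -> right_type U V W l -> E_one U V W l.
Proof.
move=> reg rt.
have H u v w Uu Vv Ww := right_interior FU Foo cU cV cW reg rt (u := u) (v := v) (w := w) Uu Vv Ww.
split; first by move=> u v w Uu Vv Ww; exact: (H u v w Uu Vv Ww).2.
by move=> u w Uu Ww; have [v Vv] := V0; exact: (H u v w Uu Vv Ww).1.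
Qed.

Lemma left_E_mone l : regular U V W l -> left_type U V W l -> E_mone U V W l.
Proof.
move=> reg lt.
have H u v w Uu Vv Ww := left_interior FU Foo cU cV cW reg lt (u := u) (v := v) (w := w) Uu Vv Ww.
split; first by move=> u v w Uu Vv Ww; exact: (H u v w Uu Vv Ww).2.
by move=> u w Uu Ww; have [v Vv] := V0; exact: (H u v w Uu Vv Ww).1.
Qed.

Lemma interior_type u v w l : U u -> V v -> W w -> ellipse_interior u v w l ->
  right_type U V W l \/ left_type U V W l.
Proof.
move=> Uu Vv Ww h; have [uw|wu|e] := ltgtP (nc u) (nc w).
- by left; exact: interior_right h.
- by right; exact: interior_left h.
- by move: h; rewrite /ellipse_interior e eqxx.
Qed.

Lemma E_cap_sub_cup : E_cap U V W `<=` E_cup U V W.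
Proof.
have [[u Uu] [v Vv] [w Ww]] := And3 U0 V0 W0.
move=> l /(_ u v w Uu Vv Ww) hi /(_ u v w Uu Vv Ww); move: hi.
by rewrite /ellipse_interior /ellipse_exterior; case: eqP => // _ [_ bd] [_ nbd].
Qed.

Lemma E_pm1_sub_cap : E_pm1 U V W `<=` E_cap U V W.
Proof. by move=> l [[]|[]]. Qed.

(** Contrapositive: regularity keeps [l] off every ellipse, and if neither type holds [l] is inside
    none, so it is exterior to all. For degenerate ellipses being off the segment is enough. *)
Lemma E_cup_type l : regular U V W l -> E_cup U V W l ->
  right_type U V W l \/ left_type U V W l.
Proof.
move=> reg nE; apply: contrapT => nt; apply: nE => u v w Uu Vv Ww.
have nell : ~ ellipse u v w l by move=> h; exact: (ellipse_singular Uu Vv Ww h reg).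
rewrite /ellipse_exterior; case: ifPn => // uw; split=> // bd.
by apply: nt; apply: (interior_type Uu Vv Ww); rewrite /ellipse_interior (negbTE uw).
Qed.

End EllipseSets.

Unset Implicit Arguments.

Theorem theorem2p7 (R : realType) (p : \bar R) (hp : (1%:E <= p)%E)
    (U V W : set R[i])
    (U0 : U !=set0) (V0 : V !=set0) (W0 : W !=set0)
    (cU : compact (U : set R[i]^o)) (cV : compact (V : set R[i]^o))
    (cW : compact (W : set R[i]^o)) :
  [/\ forall B, PE_semi U V W B ->
        Sigma_plus p U V W = Sigma p U V W `|` Sigma_pm1 p B,
      Sigma_plus p U V W = Sigma p U V W `|` E_pm1 U V W,
      Sigma_plus p U V W = Sigma p U V W `|` E_cap U V W
    & Sigma_plus p U V W = Sigma p U V W `|` E_cup U V W] /\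
  [/\ exactly_one
        (abs_min W <= abs_max U /\ abs_min U <= abs_max W)
        (abs_max U < abs_min W)
        (abs_max W < abs_min U),
      (abs_min W <= abs_max U /\ abs_min U <= abs_max W) ->
        [/\ forall B, PE_semi U V W B -> Sigma_pm1 p B = set0,
            E_pm1 U V W = set0,
            E_cup U V W `<=` Sigma_plus p U V W
          & Sigma_plus p U V W = Sigma p U V W],
      abs_max U < abs_min W ->
        [/\ forall B, PE_semi U V W B ->
              Sigma_idx p B (-1) = set0 /\ Sigma_idx p B 1 `<=` E_one U V W,
            E_mone U V W = set0
          & E_one U V W = E_cap U V W]
    & abs_max W < abs_min U ->
        [/\ forall B, PE_semi U V W B ->
              Sigma_idx p B 1 = set0 /\ Sigma_idx p B (-1) `<=` E_mone U V W,
            E_one U V W = set0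
          & E_mone U V W = E_cap U V W]].
Proof.
have [F [FU Foo]] := ultraFilterLemma (eventually_filter : ProperFilter \oo).
have qU := compact_ultra_closed FU cU; have qV := compact_ultra_closed FU cV.
have qW := compact_ultra_closed FU cW.
have SP l := Sigma_plusE hp FU Foo U0 V0 W0 qU qV qW l.
have SE l := SigmaE hp FU Foo qU qV qW l.
have RE l := right_E_one FU Foo V0 qU qV qW (l := l).
have LE l := left_E_mone FU Foo V0 qU qV qW (l := l).
have idx B k l := Sigma_idx_regular hp FU Foo U0 V0 W0 qU qV qW (B := B) (k := k) (l := l).
have idx1 B l : PE_semi U V W B -> Sigma_idx p B 1 l -> regular U V W l /\ right_type U V W l.
  move=> PE h; have reg := idx B 1 l PE h; split=> //.
  exact: (index1_right hp FU Foo U0 V0 W0 qU qV qW reg PE.1 h).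
have idxN1 B l : PE_semi U V W B -> Sigma_idx p B (-1) l -> regular U V W l /\ left_type U V W l.
  move=> PE h; have reg := idx B (-1) l PE h; split=> //.
  exact: (indexN1_left hp FU Foo U0 V0 W0 qU qV qW reg PE.1 h).
(* The equalities come from one cycle: [Sigma_plus] lies in [Sigma] joined with [E_pm1], this grows
   to [E_cap] and then to [E_cup], and [cup_plus] closes the cycle. *)
have plus_pm1 : Sigma_plus p U V W `<=` Sigma p U V W `|` E_pm1 U V W.
  by move=> l /SP[|[reg [/(RE _ reg)|/(LE _ reg)]]]; [left|right; right|right; left].
have cup_plus : Sigma p U V W `|` E_cup U V W `<=` Sigma_plus p U V W.
  move=> l [h|h]; apply/SP; first by left.
  have [reg|nreg] := pselect (regular U V W l); last by left; apply/SE.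
  by right; split=> //; exact: E_cup_type.
have capcup := E_cap_sub_cup U0 V0 W0; have pmcap := @E_pm1_sub_cap R U V W.
have EqPm : Sigma_plus p U V W = Sigma p U V W `|` E_pm1 U V W.
  apply/seteqP; split=> // l [h|/pmcap/capcup h]; apply: cup_plus; [by left|by right].
(* Attained extrema turn the orientation conditions in [E_one] and [E_mone] into the strict
   inequalities that separate the cases. *)
have [[uM UuM euM] hUM] := abs_max_attained FU Foo U0 qU.
have [[um Uum eum] hUm] := abs_min_attained FU Foo U0 qU.
have [[wM WwM ewM] hWM] := abs_max_attained FU Foo W0 qW.
have [[wm Wwm ewm] hWm] := abs_min_attained FU Foo W0 qW.
have hU : abs_min U <= abs_max U by rewrite -eum; exact: hUM.
have hW : abs_min W <= abs_max W by rewrite -ewm; exact: hWM.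
have one_lt l : E_one U V W l -> abs_max U < abs_min W.
  by move=> [_ h]; rewrite -euM -ewm; exact: h.
have mone_lt l : E_mone U V W l -> abs_max W < abs_min U.
  by move=> [_ h]; rewrite -ewM -eum; exact: h.
split.
  split=> //.
  - move=> B PE; apply/seteqP; split=> l.
      move=> /SP[|[reg [rt|lt]]]; [by left|right; right|right; left].
        exact: (right_index hp FU Foo U0 V0 W0 qU qV qW reg PE.1 rt).
      exact: (left_index hp FU Foo U0 V0 W0 qU qV qW reg PE.1 lt).
    move=> [h|h]; apply/SP; first by left.
    by right; case: h => [/(idxN1 _ _ PE)|/(idx1 _ _ PE)] [reg ty]; split=> //; [right|left].
  - apply/seteqP; split=> l; first by move=> /plus_pm1[|/pmcap]; [left|right].
    by move=> [h|/capcup h]; apply: cup_plus; [left|right].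
  - apply/seteqP; split=> // l.
    by move=> /plus_pm1[|/pmcap/capcup]; [left|right].
split.
- split.
  + have [h1|h1] := leP (abs_min W) (abs_max U); last by right; left.
    by have [h2|h2] := leP (abs_min U) (abs_max W); [left|right; right].
  + by move=> [[h _] h']; move: (le_lt_trans h h'); rewrite ltxx.
  + by move=> [[_ h] h']; move: (le_lt_trans h h'); rewrite ltxx.
  + by move=> [h h']; move: (lt_trans h (le_lt_trans hW (lt_le_trans h' hU))); rewrite ltxx.
- move=> [h1 h2].
  have n1 l : ~ E_one U V W l by move=> /one_lt; rewrite ltNge h1.
  have n2 l : ~ E_mone U V W l by move=> /mone_lt; rewrite ltNge h2.
  have e0 : E_pm1 U V W = set0 by apply/seteqP; split=> // l [/n2|/n1].
  split=> //.
  + move=> B PE; apply/seteqP; split=> // l.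
    by move=> [/(idxN1 _ _ PE)[reg /(LE _ reg)/n2]|/(idx1 _ _ PE)[reg /(RE _ reg)/n1]].
  + by move=> l h; apply: cup_plus; right.
  + by rewrite EqPm e0 setU0.
- move=> h.
  have n2 l : ~ E_mone U V W l.
    by move=> /mone_lt h'; move: (lt_trans h (le_lt_trans hW (lt_le_trans h' hU))); rewrite ltxx.
  split.
  + move=> B PE; split; last by move=> l /(idx1 _ _ PE)[reg /(RE _ reg)].
    by apply/seteqP; split=> // l /(idxN1 _ _ PE)[reg /(LE _ reg)/n2].
  + by apply/seteqP; split=> // l /n2.
  + apply/seteqP; split=> l; first by case.
    move=> hl; split=> // u w Uu Ww.
    exact: le_lt_trans (hUM u Uu) (lt_le_trans h (hWm w Ww)).
- move=> h.
  have n1 l : ~ E_one U V W l.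
    by move=> /one_lt h'; move: (lt_trans h (le_lt_trans hU (lt_le_trans h' hW))); rewrite ltxx.
  split.
  + move=> B PE; split; last by move=> l /(idxN1 _ _ PE)[reg /(LE _ reg)].
    by apply/seteqP; split=> // l /(idx1 _ _ PE)[reg /(RE _ reg)/n1].
  + by apply/seteqP; split=> // l /n1.
  + apply/seteqP; split=> l; first by case.
    move=> hl; split=> // u w Uu Ww.
    exact: le_lt_trans (hWM w Ww) (lt_le_trans h (hUm u Uu)).
Qed.
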